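(* Let $T>0$, $J=[0,T]$, $q\in(1,2]$, $\alpha\in[0,1]$, and let $(X_1,d_1)$, $(X_2,d_2)$ be metric spaces. Let $F:J\times\mathbb{R}^n\to E^n$ be a fuzzy mapping, let $g:J\times\mathbb{R}^n\to\mathbb{R}^{n\times m}$, $Q:J\times\mathbb{R}^n\to\mathbb{R}^m$, $c_1,c_2:J\times\mathbb{R}^n\to\mathbb{R}^n$ be continuous, and let $\widehat S:\mathbb{R}^m\times X_1\to\mathbb{R}^m$ and $\widehat K:X_2\to2^{\mathbb{R}^m}$. Assume: (1) there is $L_F>0$ with $\mathcal{H}(F_{(t,z_1)},F_{(t,z_2)})\le L_F\|z_1-z_2\|$ for all $t\in J$, $z_1,z_2\in\mathbb{R}^n$; (2) for every $z\in\mathbb{R}^n$, $F_{(\cdot,z)}$ is strongly measurable; (3) there is $p\in L^\infty(J,\mathbb{R}^+)$ such that for every $z\in\mathbb{R}^n$ and a.e. $t\in J$, $\|F_{(t,z)}\|\le p(t)$; (4) there are $\eta_g,L_g>0$ with $\|g(t,z)\|\le\eta_g$ for all $(t,z)\in J\times\mathbb{R}^n$ and $g(t,\cdot)$ is $L_g$-Lipschitz for every $t\in J$; (5) there is $L_Q>0$ with $\|Q(t_1,z_1)-Q(t_2,z_2)\|\le L_Q(|t_1-t_2|+\|z_1-z_2\|)$ for all $t_1,t_2\in J$, $z_1,z_2\in\mathbb{R}^n$; (6) there is $m_{\widehat S}>0$ with $\langle\widehat S(u_1,\xi)-\widehat S(u_2,\xi),u_1-u_2\rangle\ge m_{\widehat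 S}\|u_1-u_2\|^2$ for all $u_1,u_2\in\mathbb{R}^m$, $\xi\in X_1$; (7) $\widehat K$ has nonempty, compact and convex values; (8) for $i=1,2$ there are $M_i,L_{c_i}>0$ with $\|c_i(t,z)\|\le M_i$ for all $t\in J$, $z\in\mathbb{R}^n$, and $c_i(t,\cdot)$ is $L_{c_i}$-Lipschitz for every $t\in J$; (9) for every $(\xi,\varsigma)\in X_1\times X_2$ there is a constant $\eta_{\widehat K}>0$ with $\|u_y\|_C\le\eta_{\widehat K}$ for all $y\in C(J,\mathbb{R}^n)$ such that $$\widetilde\lambda=2\,\frac{L_F+L_g\eta_{\widehat K}+\eta_g\frac{L_Q}{m_{\widehat S}}}{\Gamma(q+1)}\,T^q+L_{c_2}T+L_{c_1}T<1,$$ where $u_y\in C(J,\mathbb{R}^m)$ is the unique function such that, for every $t\in J$, $u_y(t)$ is the solution of the variational inequality $\mathrm{VI}(\widehat K(\varsigma),Q(t,y(t))+\widehat S(\cdot,\xi))$; (10) $\widehat S$ is continuous and the set-valued mapping $\widehat K$ is continuous; (11) the set-valued mapping $\widehat K$ is locally compact. Then the set-valued mapping $$X_1\times X_2\to2^{C(J,\mathbb{R}^n)\times C(J,\mathbb{R}^m)},\qquad(\xi,\varsigma)\mapsto\mathrm{SOL}(\mathrm{PBFFDVI}(\xi,\varsigma)),$$ is upper semicontinuous.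
   Context: Notation. $\langle\cdot,\cdot\rangle$ and $\|\cdot\|$ are the Euclidean inner product and norm; on $\mathbb{R}^{n\times m}$, $\|\cdot\|$ is a matrix norm compatible with these ($\|Av\|\le\|A\|\|v\|$). $\Gamma$ is the Gamma function. $C(J,\mathbb{R}^k)$ carries the maximum norm $\|\cdot\|_C$. Fuzzy sets. A fuzzy set of $\mathbb{R}^n$ is a map $\omega:\mathbb{R}^n\to[0,1]$; $[\omega]_\alpha=\{x:\omega(x)\ge\alpha\}$ for $\alpha\in(0,1]$ and $[\omega]_0=\overline{\bigcup_{\alpha\in(0,1]}[\omega]_\alpha}$. $E^n$ is the set of fuzzy sets of $\mathbb{R}^n$ that are normal ($\omega(x)=1$ for some $x$), fuzzy convex ($\omega(\lambda x+(1-\lambda)x')\ge\min\{\omega(x),\omega(x')\}$ for $\lambda\in[0,1]$), upper semicontinuous as functions, and have compact level sets (including $[\omega]_0$). A fuzzy mapping $F:J\times\mathbb{R}^n\to E^n$ assigns to $(t,z)$ the fuzzy set $F_{(t,z)}$. With $H$ the Hausdorff distance, $\mathcal{H}(\omega_1,\omega_2)=\sup_{0\le\alpha\le1}H([\omega_1]_\alpha,[\omega_2]_\alpha)$, and $\|\omega\|=\sup_{x\in[\omega]_0}\|x\|$. $F_{(\cdot,z)}$ is strongly measurable if for every $\alpha\in[0,1]$ the set-valued map $t\mapsto[F_{(t,z)}]_\alpha$ is (Lebesgue) measurable. Variational inequality. $\mathrm{VI}(\widehat K(\varsigma),Q(t,z)+\widehat S(\cdot,\xi))$ asks for $u\in\widehat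 K(\varsigma)$ with $\langle Q(t,z)+\widehat S(u,\xi),v-u\rangle\ge0$ for all $v\in\widehat K(\varsigma)$; its solution set is $\mathrm{SOL}(\widehat K(\varsigma),Q(t,z)+\widehat S(\cdot,\xi))$. Under the stated hypotheses it has a unique solution, and for $y\in C(J,\mathbb{R}^n)$ the solution function $u_y$ is continuous (it depends on $\xi,\varsigma$). Parametric problem. $\mathrm{PBFFDVI}(\xi,\varsigma)$ is the system ${}^C_0D_t^qy(t)\in[F_{(t,y(t))}]_\alpha+g(t,y(t))u(t)$, $u(t)\in\mathrm{SOL}(\widehat K(\varsigma),Q(t,y(t))+\widehat S(\cdot,\xi))$, with $y(0)=\int_0^Tc_1(\tau,y(\tau))d\tau$, $y(T)=\int_0^Tc_2(\tau,y(\tau))d\tau$ (${}^C_0D^q_t$ the Caputo derivative), understood in the mild sense: $\mathrm{SOL}(\mathrm{PBFFDVI}(\xi,\varsigma))$ is the set of pairs $(y,u)\in C(J,\mathbb{R}^n)\times C(J,\mathbb{R}^m)$ such that $u(t)\in\mathrm{SOL}(\widehat K(\varsigma),Q(t,y(t))+\widehat S(\cdot,\xi))$ for all $t\in J$ and there is $f\in L^1(J,\mathbb{R}^n)$ with $f(\tau)\in[F_{(\tau,y(\tau))}]_\alpha$ for a.e. $\tau\in J$ such that for all $t\in J$ $$y(t)=\frac1{\Gamma(q)}\int_0^t(t-\tau)^{q-1}[f(\tau)+g(\tau,y(\tau))u(\tau)]\,d\tau-\frac{t}{\Gamma(q)T}\int_0^T(T-\tau)^{q-1}[f(\tau)+g(\tau,y(\tau))u(\tau)]\,d\tau+\frac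 tT\int_0^Tc_2(\tau,y(\tau))\,d\tau+\Big(1-\frac tT\Big)\int_0^Tc_1(\tau,y(\tau))\,d\tau.$$ Set-valued maps. $\Upsilon:Z_1\to2^{Z_2}\setminus\{\emptyset\}$ is upper semicontinuous if for every $z_0\in Z_1$ and every open $U\supset\Upsilon(z_0)$ there is an open neighbourhood $O$ of $z_0$ with $\Upsilon(z)\subset U$ for all $z\in O$; lower semicontinuous if for every $z_0$ and every open $U$ with $\Upsilon(z_0)\cap U\ne\emptyset$ there is an open neighbourhood $O$ of $z_0$ with $\Upsilon(z)\cap U\neq\emptyset$ for all $z\in O$; continuous if both. $\widehat K$ is locally compact if every $\varsigma^*\in X_2$ has a neighbourhood $\Xi_2$ such that the closure of $\bigcup_{\varsigma\in\Xi_2}\widehat K(\varsigma)$ is compact in $\mathbb{R}^m$. *)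

(* Defs.v *)
From HB Require Import structures.
From mathcomp Require Import all_boot all_order all_algebra.
From mathcomp Require Import all_classical all_reals all_analysis.
From mathcomp Require Import measurable_realfun.
From mathcomp Require Import ring lra.

Set Implicit Arguments.
Unset Strict Implicit.
Unset Printing Implicit Defensive.

Import Order.TTheory GRing.Theory Num.Theory.
Import numFieldNormedType.Exports.

Local Open Scope classical_set_scope.
Local Open Scope ring_scope.

(* The library norm on 'cV[R]_k is the maximum of the coordinates; it is used
   below only through its topology, every metric condition being stated with
   the Euclidean norm [enorm]. *)
Section Euclidean.
Variable R : realType.

Definition dotp k (u v : 'cV[R]_k) : R := \sum_(i < k) u i 0 * v i 0.

Definition enorm k (u : 'cV[R]_k) : R := Num.sqrt (dotp u u).

Section lemmas.
Variable k : nat.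
Implicit Types u v w : 'cV[R]_k.

Lemma dotpC u v : dotp u v = dotp v u.
Proof. by apply: eq_bigr => i _; rewrite mulrC. Qed.

Lemma dotpDl u v w : dotp (u + v) w = dotp u w + dotp v w.
Proof. by rewrite -big_split; apply: eq_bigr => i _; rewrite mxE mulrDl. Qed.

Lemma dotpZl a u v : dotp (a *: u) v = a * dotp u v.
Proof. by rewrite mulr_sumr; apply: eq_bigr => i _; rewrite mxE mulrA. Qed.

Lemma dotpDr u v w : dotp w (u + v) = dotp w u + dotp w v.
Proof. by rewrite dotpC dotpDl !(dotpC w). Qed.

Lemma dotpZr a u v : dotp v (a *: u) = a * dotp v u.
Proof. by rewrite dotpC dotpZl dotpC. Qed.

Lemma dotp_ge0 u : 0 <= dotp u u.
Proof. by apply: sumr_ge0 => i _; rewrite -expr2 sqr_ge0. Qed.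

Lemma dotp_eq0 u : dotp u u = 0 -> u = 0.
Proof.
move=> /eqP; rewrite psumr_eq0 => [/allP u0|i _]; last by rewrite -expr2 sqr_ge0.
apply/matrixP => i j; rewrite mxE ord1.
by have := u0 i (mem_index_enum _); rewrite -expr2 sqrf_eq0 => /eqP.
Qed.

Lemma enorm_ge0 u : 0 <= enorm u.
Proof. exact: sqrtr_ge0. Qed.

Lemma sqr_enorm u : enorm u ^+ 2 = dotp u u.
Proof. by rewrite sqr_sqrtr // dotp_ge0. Qed.

Lemma enorm_eq0 u : enorm u = 0 -> u = 0.
Proof. by move=> u0; apply: dotp_eq0; rewrite -sqr_enorm u0 expr0n. Qed.

Lemma enorm0 : enorm (0 : 'cV[R]_k) = 0.
Proof.
by rewrite /enorm /dotp big1 ?sqrtr0 // => i _; rewrite mxE mul0r.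
Qed.

Lemma enormZ a u : enorm (a *: u) = `|a| * enorm u.
Proof.
by rewrite /enorm dotpZl dotpZr mulrA -expr2 sqrtrM ?sqr_ge0 // sqrtr_sqr.
Qed.

Lemma dotp_le u v : dotp u v <= enorm u * enorm v.
Proof.
have [u0|u0] := eqVneq (enorm u) 0.
  rewrite (enorm_eq0 u0) enorm0 mul0r /dotp big1 // => i _.
  by rewrite mxE mul0r.
have [v0|v0] := eqVneq (enorm v) 0.
  rewrite (enorm_eq0 v0) enorm0 mulr0 /dotp big1 // => i _.
  by rewrite mxE mulr0.
have up : 0 < enorm u by rewrite lt_neqAle eq_sym u0 enorm_ge0.
have vp : 0 < enorm v by rewrite lt_neqAle eq_sym v0 enorm_ge0.
have := dotp_ge0 (enorm v *: u + (- enorm u) *: v).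
rewrite dotpDl !dotpDr !dotpZl !dotpZr -!sqr_enorm (dotpC v u) => h.
have ab : 0 < 2 * (enorm u * enorm v) by rewrite !mulr_gt0.
rewrite -subr_ge0 -(pmulr_rge0 _ ab).
by apply: le_trans h _; rewrite le_eqVlt; apply/orP; left; apply/eqP; ring.
Qed.

Lemma enormD u v : enorm (u + v) <= enorm u + enorm v.
Proof.
rewrite -(@ler_pXn2r _ 2) ?nnegrE ?addr_ge0 ?enorm_ge0 //.
rewrite sqr_enorm dotpDl !dotpDr (dotpC v u) sqrrD -!sqr_enorm mulr2n.
by have := dotp_le u v; lra.
Qed.

Lemma enorm_continuous : continuous (@enorm k).
Proof.
move=> u; apply: continuous_comp; last exact: sqrt_continuous.
pose p (s : seq 'I_k) (v : 'cV[R]_k) : R := \sum_(i <- s) v i 0 * v i 0.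
suff pc s : {for u, continuous (p s)} by exact: pc.
elim: s => [|i s IHs].
  have -> : p [::] = fun=> (0 : R) by apply/funext => v; rewrite /p big_nil.
  exact: cst_continuous.
have -> : p (i :: s) = (fun v => (v i 0 * v i 0 + p s v : R)).
  by apply/funext => v; rewrite /p big_cons.
by apply: continuousD => //; apply: continuousM; exact: coord_continuous.
Qed.

End lemmas.
End Euclidean.

Definition matrix_norm (R : realType) n m (N : 'M[R]_(n, m) -> R) : Prop :=
  [/\ forall A B, N (A + B) <= N A + N B,
      forall a A, N (a *: A) = `|a| * N A &
      forall A, N A = 0 -> A = 0].

Definition compatible_norm (R : realType) n m (N : 'M[R]_(n, m) -> R) : Prop :=
  forall A v, enorm (A *m v) <= N A * enorm v.

(* An element of C([0, T], R^k) is represented by its extension by 0 to the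
   whole line. Continuity is required on [0, T] only (subspace topology), so the
   extension is a mere normal form: distinct elements differ on [0, T], and an
   element can be evaluated, hence integrated, at any real. *)
Section continuous_functions.
Variables (R : realType) (T : R) (k : nat).

Definition contJ_pred : {pred R -> 'cV[R]_k} :=
  [pred f : R -> 'cV[R]_k |
    `[< {within `[0, T], continuous f} /\
        forall t : R, t \notin `[0, T] -> f t = 0 >]].

Record contJ := ContJ { contJ_fun :> R -> 'cV[R]_k; _ : contJ_pred contJ_fun }.

HB.instance Definition _ := [isSub for contJ_fun].
HB.instance Definition _ := [Choice of contJ by <:].

Lemma contJ_submod_closed : submod_closed contJ_pred.
Proof.
split=> [|a f g /asboolP[fc f0] /asboolP[gc g0]]; apply/asboolP; split.
- by apply: continuous_subspaceT => x; exact: (@cst_continuous R 'cV[R]_k 0).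
- by [].
- move=> x; have fx := fc x; have gx := gc x.
  exact: cvgD (cvgZ (cvg_cst a) fx) gx.
- move=> t tJ; rewrite -[LHS]/(a *: f t + g t) (f0 _ tJ) (g0 _ tJ).
  by rewrite scaler0 addr0.
Qed.

HB.instance Definition _ :=
  GRing.isSubmodClosed.Build R (R -> 'cV[R]_k) contJ_pred contJ_submod_closed.
HB.instance Definition _ := [SubChoice_isSubLmodule of contJ by <:].

Lemma contJ_cts (y : contJ) : {within `[0, T], continuous y}.
Proof. by case: y => y /= /asboolP[]. Qed.

Lemma contJ_out (y : contJ) t : t \notin `[0, T] -> y t = 0.
Proof. by case: y => y /= /asboolP[_]; exact. Qed.

Definition maxnorm (y : contJ) : R := sup [set enorm (y t) | t in `[0, T]].

Lemma maxnorm_ub (y : contJ) t : t \in `[0, T] -> enorm (y t) <= maxnorm y.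
Proof.
move=> tJ; apply: ub_le_sup; last by exists t.
have cy : {within `[0, T], continuous (fun t => enorm (y t))}.
  by move=> x; apply: continuous_comp; [exact: contJ_cts|exact: enorm_continuous].
have /compact_bounded[M [_ /(_ (M + 1))]] :=
  continuous_compact cy (@segment_compact R 0 T).
rewrite ltrDl ltr01 => /(_ isT) yM.
exists (M + 1) => _ [s sJ <-].
by rewrite (le_trans (ler_norm _)) // yM //; exists s.
Qed.

Lemma maxnorm_le (y : contJ) M :
  0 <= M -> (forall t, t \in `[0, T] -> enorm (y t) <= M) -> maxnorm y <= M.
Proof.
move=> M0 yM; have [E|/set0P E] :=
  eqVneq [set enorm (y t) | t in `[0, T]] set0.
  by rewrite /maxnorm E sup0.
by apply: ge_sup => // _ [t tJ <-]; exact: yM.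
Qed.

Lemma maxnorm_ge0 (y : contJ) : 0 <= maxnorm y.
Proof.
have [E|/set0P[_ [t tJ _]]] := eqVneq [set enorm (y t) | t in `[0, T]] set0.
  by rewrite /maxnorm E sup0.
exact: le_trans (enorm_ge0 _) (maxnorm_ub y tJ).
Qed.

Lemma maxnormD (y z : contJ) : maxnorm (y + z) <= maxnorm y + maxnorm z.
Proof.
apply: maxnorm_le => [|t tJ]; first by rewrite addr_ge0 ?maxnorm_ge0.
by rewrite (le_trans (enormD _ _)) // lerD ?maxnorm_ub.
Qed.

Lemma maxnormZ_le (a : R) (y : contJ) : maxnorm (a *: y) <= `|a| * maxnorm y.
Proof.
apply: maxnorm_le => [|t tJ]; first by rewrite mulr_ge0 ?maxnorm_ge0.
by rewrite -[contJ_fun _ t]/(a *: y t) enormZ ler_wpM2l ?maxnorm_ub.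
Qed.

Lemma maxnormZ (a : R) (y : contJ) : maxnorm (a *: y) = `|a| * maxnorm y.
Proof.
apply/eqP; rewrite eq_le maxnormZ_le /=.
have [->|a0] := eqVneq a 0; first by rewrite normr0 mul0r maxnorm_ge0.
rewrite -ler_pdivlMl ?normr_gt0 // -normfV.
by rewrite -{1}[y](scalerK a0) maxnormZ_le.
Qed.

Lemma maxnorm_eq0 (y : contJ) : maxnorm y = 0 -> y = 0.
Proof.
move=> y0; apply/val_inj/funext => t /=.
have [tJ|tJ] := boolP (t \in `[0, T]); last by rewrite contJ_out.
apply: enorm_eq0; apply/eqP; rewrite eq_le enorm_ge0 andbT -y0.
exact: maxnorm_ub.
Qed.

HB.instance Definition _ :=
  Lmodule_isNormed.Build R contJ maxnormD maxnormZ maxnorm_eq0.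

End continuous_functions.

Section fuzzy_sets.
Variables (R : realType) (n : nat).
Implicit Types (w : 'cV[R]_n -> R) (A B : set 'cV[R]_n).

Definition level w (a : R) : set 'cV[R]_n :=
  if a == 0 then closure (\bigcup_(b in `]0, 1]) [set x | b <= w x])
  else [set x | a <= w x].

Record fuzzy := Fuzzy {
  fuzzy_fun :> 'cV[R]_n -> R ;
  fuzzy_01 : forall x, 0 <= fuzzy_fun x <= 1 ;
  fuzzy_normal : exists x, fuzzy_fun x = 1 ;
  fuzzy_convex : forall (l : R) x x', 0 <= l <= 1 ->
    Num.min (fuzzy_fun x) (fuzzy_fun x') <= fuzzy_fun (l *: x + (1 - l) *: x') ;
  fuzzy_usc : forall x a, fuzzy_fun x < a -> \forall x' \near x, fuzzy_fun x' < a ;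
  fuzzy_compact : forall a : R, 0 <= a <= 1 -> compact (level fuzzy_fun a) }.

Local Open Scope ereal_scope.

Definition set_dist (x : 'cV[R]_n) A : \bar R :=
  ereal_inf [set (enorm (x - a))%:E | a in A].

Definition hausdorff_dist A B : \bar R :=
  maxe (ereal_sup [set set_dist a B | a in A])
       (ereal_sup [set set_dist b A | b in B]).

Definition fuzzy_dist (w1 w2 : fuzzy) : \bar R :=
  ereal_sup [set hausdorff_dist (level w1 a) (level w2 a) | a in `[0%R, 1%R]].

Definition fuzzy_norm (w : fuzzy) : \bar R :=
  ereal_sup [set (enorm x)%:E | x in level w 0].

End fuzzy_sets.

(* Borel sets completed by the Lebesgue-null sets; [measurable] alone would mean
   Borel on a realType. *)
Definition Lebesgue_measurable (R : realType) (A : set R) : Prop :=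
  (completed_algebra_gen (@lebesgue_measure R)).-sigma.-measurable A.

Definition measurable_multimap (R : realType) n (J : set R)
    (G : R -> set 'cV[R]_n) : Prop :=
  forall U : set 'cV[R]_n, open U ->
    Lebesgue_measurable [set t | J t /\ (G t `&` U !=set0)].

Definition strongly_measurable (R : realType) n (J : set R)
    (F : R -> fuzzy R n) : Prop :=
  forall a : R, 0 <= a <= 1 -> measurable_multimap J (fun t => level (F t) a).

(* The functions of L^oo(J, R^+) and L^1(J, R^n) are classes modulo null sets and
   every class has a Borel representative, which is what [measurable_fun] and
   [integrable] select. *)
Definition Linfty_nonneg (R : realType) (J : set R) (p : R -> R) : Prop :=
  measurable_fun J p /\
  exists M : R, {ae @lebesgue_measure R, forall t, J t -> 0 <= p t <= M}.

Definition L1 (R : realType) n (J : set R) (f : R -> 'cV[R]_n) : Prop :=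
  forall i, (@lebesgue_measure R).-integrable J (fun t => (f t i 0)%:E).

Definition vintegral (R : realType) n (J : set R) (f : R -> 'cV[R]_n) : 'cV[R]_n :=
  \col_i \int[@lebesgue_measure R]_(t in J) f t i 0.

Definition Gamma (R : realType) (x : R) : R :=
  \int[@lebesgue_measure R]_(t in `]0, +oo[) (t `^ (x - 1) * expR (- t)).

Section multimaps.
Variables Z1 Z2 : topologicalType.
Implicit Type Y : Z1 -> set Z2.

(* Semicontinuity is a notion for maps from Z1 to 2^Z2 minus the empty set:
   nonemptiness of the values is part of both definitions. *)
Definition multimap_usc Y : Prop :=
  (forall z, Y z !=set0) /\
  forall z0 (U : set Z2), open U -> Y z0 `<=` U ->
    exists O : set Z1, [/\ open O, O z0 & forall z, O z -> Y z `<=` U].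

Definition multimap_lsc Y : Prop :=
  (forall z, Y z !=set0) /\
  forall z0 (U : set Z2), open U -> Y z0 `&` U !=set0 ->
    exists O : set Z1, [/\ open O, O z0 & forall z, O z -> Y z `&` U !=set0].

Definition multimap_continuous Y : Prop := multimap_usc Y /\ multimap_lsc Y.

Definition multimap_locally_compact Y : Prop :=
  forall z : Z1, exists2 V, nbhs z V & compact (closure (\bigcup_(z' in V) Y z')).

End multimaps.

Definition convex_subset (R : realType) m (K : set 'cV[R]_m) : Prop :=
  forall (l : R) u v, 0 <= l <= 1 -> K u -> K v -> K (l *: u + (1 - l) *: v).

Definition SOL_VI (R : realType) m (K : set 'cV[R]_m)
    (G : 'cV[R]_m -> 'cV[R]_m) : set 'cV[R]_m :=
  [set u | K u /\ forall v, K v -> 0 <= dotp (G u) (v - u)].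

Section parametric_problem.
Variables (R : realType) (n m : nat) (X1 X2 : Type) (T q alpha : R).
Variables (F : R -> 'cV[R]_n -> fuzzy R n) (g : R -> 'cV[R]_n -> 'M[R]_(n, m)).
Variables (Q : R -> 'cV[R]_n -> 'cV[R]_m) (c1 c2 : R -> 'cV[R]_n -> 'cV[R]_n).
Variables (S : 'cV[R]_m -> X1 -> 'cV[R]_m) (K : X2 -> set 'cV[R]_m).

Definition VI_function (xi : X1) (sigma : X2) (y : contJ T n) (u : contJ T m) :
    Prop :=
  forall t, t \in `[0, T] -> SOL_VI (K sigma) (fun v => Q t (y t) + S v xi) (u t).

Definition mild_rhs (y : contJ T n) (h : R -> 'cV[R]_n) (t : R) : 'cV[R]_n :=
  (Gamma q)^-1 *: vintegral `[0, t] (fun s => (t - s) `^ (q - 1) *: h s)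
  - (t / (Gamma q * T)) *: vintegral `[0, T] (fun s => (T - s) `^ (q - 1) *: h s)
  + (t / T) *: vintegral `[0, T] (fun s => c2 s (y s))
  + (1 - t / T) *: vintegral `[0, T] (fun s => c1 s (y s)).

Definition SOL_PBFFDVI (p : X1 * X2) : set (contJ T n * contJ T m) :=
  [set yu | VI_function p.1 p.2 yu.1 yu.2 /\
    exists f : R -> 'cV[R]_n, [/\ L1 `[0, T] f,
      {ae @lebesgue_measure R, forall s, s \in `[0, T] ->
        level (F s (yu.1 s)) alpha (f s)} &
      forall t, t \in `[0, T] ->
        yu.1 t = mild_rhs yu.1 (fun s => f s + g s (yu.1 s) *m yu.2 s) t]].

End parametric_problem.

(* Main.v *)
Require Import Defs.
From HB Require Import structures.
From mathcomp Require Import all_boot all_order all_algebra.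
From mathcomp Require Import all_classical all_reals all_analysis.
From mathcomp Require Import measurable_realfun.
From mathcomp Require Import ring lra.
Set Implicit Arguments.
Unset Strict Implicit.
Unset Printing Implicit Defensive.
Import Order.TTheory GRing.Theory Num.Theory.
Import numFieldNormedType.Exports.
Local Open Scope classical_set_scope.
Local Open Scope ring_scope.

(** The values of the solution map are nonempty by Nadler's iteration: hypothesis (9)
makes the multivalued integral operator a contraction for the maximum norm, the
measurable selections being projections onto the convex level sets. Upper
semicontinuity is proved by contradiction along a sequence of parameters with
solutions (y_k, u_k). The y_k are equicontinuous, hence cluster uniformly at some y;
by Minty's form of the variational inequality the u_k then cluster at the solution
function u of y. The selections f_k only converge weakly, but convex combinations of
them converge almost everywhere, and the level sets are convex, so that (y, u) is a
solution. *)

(** Both halves end in the same closure statement, [SOL_approx_closed]: a uniform limit of pairs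
    that nearly solve the problem is a solution, provided its control satisfies the variational
    inequality. No convergence of the selections is assumed there. The bounded functions that are
    nearly selections along the limit, and nearly reproduce it, form decreasing sets closed under
    midpoints; members of almost minimal L2 norm converge almost everywhere, and their limit is the
    selection sought.

    For this reason the iteration only has to cluster: the geometric decay makes consecutive
    iterates close, so that a late iterate nearly solves the integral equation, while equicontinuity
    supplies the cluster point.

    The constant [etaK] of hypothesis (9) depends on the parameters. It serves for the iteration,
    where they are fixed; along a sequence of parameters the controls are bounded through the local
    compactness of [K] instead. *)

Lemma continuous_sum_for (R : realType) (T : topologicalType) I (s : seq I)
    (f : I -> T -> R) (x : T) : (forall i, {for x, continuous (f i)}) ->
  {for x, continuous (fun y => \sum_(i <- s) f i y)}.
Proof.
move=> cf; elim: s => [|i s IHs].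
  have -> : (fun y => \sum_(i <- [::]) f i y) = fun=> 0.
    by apply/funext => v; rewrite big_nil.
  exact: cst_continuous.
have -> : (fun y => \sum_(j <- i :: s) f j y) =
    (fun y => f i y + \sum_(j <- s) f j y).
  by apply/funext => v; rewrite big_cons.
exact: continuousD.
Qed.

(** * Euclidean norm, its topology, and convex combinations *)

Section euclidean_space.
Variables (R : realType) (k : nat).
Implicit Types u v w : 'cV[R]_k.

Lemma dotp0l v : dotp 0 v = 0.
Proof. by rewrite /dotp big1 // => i _; rewrite mxE mul0r. Qed.

Lemma dotpNl u v : dotp (- u) v = - dotp u v.
Proof. by rewrite -scaleN1r dotpZl mulN1r. Qed.

Lemma dotpNr u v : dotp u (- v) = - dotp u v.
Proof. by rewrite dotpC dotpNl dotpC. Qed.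

Lemma dotpBl u v w : dotp (u - v) w = dotp u w - dotp v w.
Proof. by rewrite dotpDl dotpNl. Qed.

Lemma dotpBr u v w : dotp w (u - v) = dotp w u - dotp w v.
Proof. by rewrite dotpDr dotpNr. Qed.

Lemma dotp_sumr I (r : seq I) (a : I -> 'cV[R]_k) w :
  dotp w (\sum_(i <- r) a i) = \sum_(i <- r) dotp w (a i).
Proof.
elim/big_rec2: _ => [|i x y _ <-]; first by rewrite dotpC dotp0l.
by rewrite dotpDr.
Qed.

Lemma enormN u : enorm (- u) = enorm u.
Proof. by rewrite -scaleN1r enormZ normrN1 mul1r. Qed.

Lemma enormB u v : enorm (u - v) = enorm (v - u).
Proof. by rewrite -opprB enormN. Qed.

Lemma enormD3 u v w : enorm (u - w) <= enorm (u - v) + enorm (v - w).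
Proof. by apply: le_trans (enormD _ _); rewrite addrA subrK. Qed.

Lemma sqr_enormD u v : enorm (u + v) ^+ 2 = enorm u ^+ 2 + 2 * dotp u v + enorm v ^+ 2.
Proof. by rewrite !sqr_enorm dotpDl !dotpDr (dotpC v u); ring. Qed.

Lemma sqr_enormB u v : enorm (u - v) ^+ 2 = enorm u ^+ 2 - 2 * dotp u v + enorm v ^+ 2.
Proof. by rewrite sqr_enormD dotpNr enormN mulrN. Qed.

Lemma enorm_dist3 u v w x (a b c : R) : enorm (u - v) <= a ->
  enorm (v - w) <= b -> enorm (x - w) <= c -> enorm (u - x) <= a + b + c.
Proof.
have := enormD3 u v x; have := enormD3 v w x; rewrite (enormB w x); lra.
Qed.

Lemma coord_le_enorm u i : `|u i 0| <= enorm u.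
Proof.
rewrite -sqrtr_sqr ler_wsqrtr // /dotp (bigD1 i) //= expr2 lerDl.
by apply: sumr_ge0 => j _; rewrite -expr2 sqr_ge0.
Qed.

Lemma mx_norm_le_enorm u : `|u| <= enorm u.
Proof.
rewrite [leLHS]mx_normrE; apply/bigmax_leP; split; first exact: enorm_ge0.
by move=> [i j] _; rewrite /= ord1 coord_le_enorm.
Qed.

(** The constant is not sharp: the square root of [k] is enlarged to [k], using [k <= k ^ 2]. *)
Lemma enorm_le_mx_norm u : enorm u <= k%:R * `|u|.
Proof.
rewrite -(@ler_pXn2r _ 2) ?nnegrE ?mulr_ge0 ?enorm_ge0 // sqr_enorm exprMn.
have ui i : u i 0 * u i 0 <= `|u| ^+ 2.
  rewrite -expr2 -real_normK ?num_real // lerXn2r ?nnegrE //.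
  rewrite [leRHS]mx_normrE.
  by apply: (le_bigmax _ (fun ij => `|u ij.1 ij.2|) (i, 0)).
have: dotp u u <= \sum_(i < k) `|u| ^+ 2 by apply: ler_sum.
move=> /le_trans; apply; rewrite sumr_const card_ord -[leLHS]mulr_natl ler_wpM2r ?sqr_ge0 //.
by rewrite -natrX ler_nat; case: k => // p; rewrite leq_pmulr.
Qed.

Lemma near_enorm u (e : R) : 0 < e -> \forall v \near u, enorm (v - u) < e.
Proof.
move=> e0.
have c : {for u, continuous (fun v => enorm (v - u))}.
  apply: continuous_comp; last exact: enorm_continuous.
  by apply: continuousB => //; exact: cst_continuous.
have : (fun v => enorm (v - u)) @ u --> (0 : R).
  by rewrite -(enorm0 R k) -(subrr u); exact: c.
move=> /cvgr0_norm_lt/(_ e e0).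
apply: filterS => v; exact: le_lt_trans (ler_norm _).
Qed.

Lemma enorm_nbhs u (U : set 'cV[R]_k) : nbhs u U ->
  exists2 e : R, 0 < e & forall v, enorm (v - u) < e -> U v.
Proof.
move=> /nbhs_ballP[e /= e0 eU]; exists e => // v uv; apply: eU.
rewrite -ball_normE /=; apply: le_lt_trans uv; rewrite enormB.
exact: mx_norm_le_enorm.
Qed.

Lemma open_enorm_ball u (r : R) : open [set v | enorm (v - u) < r].
Proof.
rewrite openE => v /= vr; rewrite /interior.
have /near_enorm : 0 < r - enorm (v - u) by rewrite subr_gt0.
move=> /(_ v); apply: filterS => w /= h.
by rewrite (le_lt_trans (enormD3 _ v _)) // -ltrBrDr.
Qed.

Lemma closed_enorm_lim (A : set 'cV[R]_k) u : closed A ->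
  (forall e : R, 0 < e -> exists2 a, A a & enorm (a - u) < e) -> A u.
Proof.
move=> cA h; apply: cA => U /enorm_nbhs[e e0 eU].
by have [a Aa ae] := h e e0; exists a; split => //; exact: eU.
Qed.

Lemma continuous_dotp (T : topologicalType) (f h : T -> 'cV[R]_k) (x : T) :
  {for x, continuous f} -> {for x, continuous h} ->
  {for x, continuous (fun y => dotp (f y) (h y))}.
Proof.
move=> cf ch; apply: continuous_sum_for => i.
apply: continuousM.
  exact: continuous_comp cf (@coord_continuous _ _ _ i 0 _).
exact: continuous_comp ch (@coord_continuous _ _ _ i 0 _).
Qed.

Lemma compact_enorm_bounded (A : set 'cV[R]_k) : compact A ->
  exists2 M : R, 0 <= M & forall a, A a -> enorm a <= M.
Proof.
move=> cA; have [M [_ /(_ (`|M| + 1))]] := compact_bounded cA.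
rewrite (le_lt_trans (ler_norm _)) ?ltrDl // => /(_ isT) hM.
exists (k%:R * (`|M| + 1)); first by rewrite mulr_ge0 ?addr_ge0.
by move=> a /hM h; rewrite (le_trans (enorm_le_mx_norm _)) // ler_wpM2l.
Qed.

Lemma convex_subset_sum (A : set 'cV[R]_k) I (s : seq I) (r : I -> R)
    (a : I -> 'cV[R]_k) : convex_subset A ->
  (forall i, 0 <= r i) -> (forall i, A (a i)) -> 0 < \sum_(i <- s) r i ->
  A ((\sum_(i <- s) r i)^-1 *: \sum_(i <- s) r i *: a i).
Proof.
move=> cvxA r0 Aa; elim: s => [|i s IHs]; first by rewrite big_nil ltxx.
rewrite !big_cons.
have := @sumr_ge0 R I s xpredT r (fun i _ => r0 i).
set p := \sum_(j <- s) r j; set w := \sum_(j <- s) _ => p0 ip.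
(* If the remaining weights sum to 0 they all vanish, and only [a i] is left. Otherwise the
   combination lies on the segment from [a i] to the barycenter of the remaining points. *)
have [E|pn] := eqVneq p 0.
  have -> : w = 0.
    have pE : p == 0 by apply/eqP.
    move: pE; rewrite /p /w; elim: s {IHs p w p0 ip E} => [|j s IHs].
      by rewrite !big_nil.
    rewrite !big_cons paddr_eq0 ?sumr_ge0 // => /andP[/eqP -> /IHs ->].
    by rewrite scale0r addr0.
  rewrite E !addr0 scalerA mulVf ?scale1r //.
  by move: ip; rewrite E addr0 => /lt0r_neq0.
have {}p0 : 0 < p by rewrite lt_def pn.
have -> : (r i + p)^-1 *: (r i *: a i + w) =
    (r i / (r i + p)) *: a i + (1 - r i / (r i + p)) *: (p^-1 *: w).
  rewrite scalerDr !scalerA; congr (_ *: _ + _ *: _); first exact: mulrC.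
  by field; rewrite !gt_eqF.
apply: cvxA => //; last exact: IHs.
by rewrite divr_ge0 ?(ltW ip) //= ler_pdivrMr // mul1r lerDl ltW.
Qed.

End euclidean_space.

(** * Monotone variational inequalities on compact convex sets *)

Section variational_inequality.
Variables (R : realType) (k : nat).
Implicit Types (A : set 'cV[R]_k) (G : 'cV[R]_k -> 'cV[R]_k).

(* At a minimiser w over A of [sum_a max(0, <G a, w - a>)^2], moving towards the
   barycenter of the points a with weights [max(0, <G a, w - a>)] would decrease
   the sum, by monotonicity, unless it is 0. *)
Lemma finite_Minty A G (s : seq 'cV[R]_k) :
  A !=set0 -> compact A -> convex_subset A ->
  (forall u v, 0 <= dotp (G u - G v) (u - v)) ->
  (forall a, a \in s -> A a) ->
  exists2 w, A w & forall a, a \in s -> 0 <= dotp (G a) (a - w).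
Proof.
move=> A0 cptA cvxA mono sA.
pose r (w a : 'cV[R]_k) : R := Num.max 0 (dotp (G a) (w - a)).
have r0 w a : 0 <= r w a by rewrite le_max lexx.
pose phi w : R := \sum_(a <- s) r w a ^+ 2.
have cphi : continuous phi.
  move=> w; apply: continuous_sum_for => a.
  have cr : {for w, continuous (r ^~ a)}.
    apply: continuous_max; first exact: cst_continuous.
    apply: continuous_dotp; first exact: cst_continuous.
    by apply: continuousB => //; exact: cst_continuous.
  exact: (continuousM cr cr).
have [w /set_mem Aw wmin] := compact_EVT_min A0 cptA (continuous_subspaceT cphi).
exists w => // a sa; rewrite leNgt; apply/negP => aw.
have ra0 : 0 < r w a.
  by rewrite lt_max; apply/orP; right; rewrite -oppr_lt0 -dotpNr opprB.
have sum_gt0 (f : 'cV[R]_k -> R) : (forall b, 0 <= f b) -> 0 < f a ->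
    0 < \sum_(b <- s) f b.
  move=> f0 fa; elim: s sa {sA phi cphi wmin} => // b t IHt.
  rewrite inE big_cons => /orP[/eqP <-|/IHt tp].
    by rewrite ltr_pwDl // sumr_ge0.
  by rewrite ltr_pwDr.
have S1 : 0 < \sum_(b <- s) r w b by exact: sum_gt0.
have S2 : 0 < phi w by apply: sum_gt0 => [b|]; rewrite ?sqr_ge0 ?exprn_gt0.
have [a0 Aa0] := A0.
(* [convex_subset_sum] wants every point in [A], so those outside [s] are sent to [a0]; the sums
   over [s] do not see the change. *)
pose pt b := if b \in s then b else a0.
have Apt b : A (pt b) by rewrite /pt; case: ifP => // /sA.
pose mu := (\sum_(b <- s) r w b)^-1 *: \sum_(b <- s) r w b *: pt b.
have Amu : A mu by apply: convex_subset_sum => // b; exact: r0.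
pose B := \sum_(b <- s) dotp (G b) (mu - w) ^+ 2.
have B0 : 0 <= B by apply: sumr_ge0 => b _; rewrite sqr_ge0.
(* The left side is half the derivative of [phi] at [w] in the direction [mu - w]. Splitting
   [mu - w] into [mu - b] minus [w - b] isolates [- phi w]; the rest is, up to a positive factor,
   the double sum shown to be nonpositive below. *)
have dirderiv : \sum_(b <- s) r w b * dotp (G b) (mu - w) <= - phi w.
  have E b : r w b * dotp (G b) (mu - w)
      = r w b * dotp (G b) (mu - b) - r w b ^+ 2.
    have -> : r w b ^+ 2 = r w b * dotp (G b) (w - b).
      rewrite expr2 /r; have [h|h] := ltP 0 (dotp (G b) (w - b)) => //.
      by rewrite !mul0r.
    by rewrite -mulrBr -dotpBr opprB addrA subrK.
  rewrite (eq_bigr _ (fun b _ => E b)) sumrB gerDr.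
  suff : \sum_(b <- s) \sum_(c <- s) r w b * r w c * dotp (G b) (c - b) <= 0.
    move=> h; rewrite -(pmulr_rle0 _ S1); apply: le_trans h.
    rewrite le_eqVlt; apply/orP; left; apply/eqP.
    rewrite mulr_sumr [in LHS]big_seq [RHS]big_seq.
    apply: eq_bigr => b bs.
    have -> : mu - b = (\sum_(c <- s) r w c)^-1 *:
        \sum_(c <- s) r w c *: (pt c - b).
      rewrite (eq_bigr _ (fun c _ => scalerBr (r w c) _ _)) sumrB scalerBr.
      by rewrite -scaler_suml scalerA mulVf ?scale1r // gt_eqF.
    rewrite dotpZr dotp_sumr.
    rewrite mulrCA (mulrA (\sum_(c <- s) r w c)) mulfV ?gt_eqF // mul1r mulr_sumr.
    rewrite big_seq [RHS]big_seq; apply: eq_bigr => c cs.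
    by rewrite dotpZr /pt cs mulrA.
  (* Exchanging the names of [b] and [c] and adding turns each term into a nonnegative weight times
     minus the monotonicity pairing of [b] and [c]. *)
  set X := (X in X <= 0).
  have : X + X <= 0; last by lra.
  rewrite {2}/X exchange_big /= /X -big_split /=.
  rewrite -oppr_ge0 -sumrN; apply: sumr_ge0 => b _.
  rewrite -big_split -sumrN; apply: sumr_ge0 => c _ /=.
  rewrite [r w c * _]mulrC -mulrDr -mulrN mulr_ge0 ?mulr_ge0 //.
  rewrite -(opprB b c) dotpNr addrC opprD opprK addrC.
  by rewrite -dotpBl mono.
(* With [e * B <= phi w] the quadratic term costs at most [e * phi w], against a first-order gain of
   [2 * e * phi w]. *)
pose e := Num.min 1 (phi w / (B + 1)).
have B1 : 0 < B + 1 by rewrite ltr_wpDl.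
have e0 : 0 < e by rewrite lt_min ltr01 divr_gt0.
have e1 : 0 <= e <= 1 by rewrite ltW //= ge_min lexx.
have eB : e * B <= phi w.
  rewrite (@le_trans _ _ (e * (B + 1))) ?ler_wpM2l ?(ltW e0) ?lerDl //.
  by rewrite -ler_pdivlMr // ge_min lexx orbT.
have := wmin (e *: mu + (1 - e) *: w) (mem_set (cvxA _ _ _ e1 Amu Aw)).
apply/negP; rewrite -ltNge.
have -> : e *: mu + (1 - e) *: w = w + e *: (mu - w).
  by rewrite scalerBl scale1r scalerBr addrCA.
(* The square of the positive part lies below its second-order expansion; the four cases are the
   signs before and after the move. *)
have step b : r (w + e *: (mu - w)) b ^+ 2 <=
    r w b ^+ 2 + 2 * e * (r w b * dotp (G b) (mu - w))
    + e ^+ 2 * dotp (G b) (mu - w) ^+ 2.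
  rewrite /r (addrAC w) [dotp _ (w - b + _)]dotpDr dotpZr.
  set x := dotp _ (w - b); set h := dotp _ _.
  have [p|p] := ltP 0 (x + e * h); have [p'|p'] := ltP 0 x.
  - by rewrite le_eqVlt; apply/orP; left; apply/eqP; ring.
  - have xe : x + e * h <= e * h by rewrite gerDr.
    rewrite expr0n mul0r mulr0 !add0r -exprMn.
    by rewrite lerXn2r ?nnegrE // ?(ltW p) // (le_trans (ltW p)).
  - rewrite expr0n.
    have -> : x ^+ 2 + 2 * e * (x * h) + e ^+ 2 * h ^+ 2 = (x + e * h) ^+ 2 by ring.
    exact: sqr_ge0.
  - by rewrite expr0n mul0r mulr0 !add0r -exprMn sqr_ge0.
apply: (@le_lt_trans _ _
  (phi w + 2 * e * (\sum_(b <- s) r w b * dotp (G b) (mu - w)) + e ^+ 2 * B)).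
  by rewrite /phi /B !mulr_sumr -!big_split /=; apply: ler_sum.
have h1 := ler_wpM2l (ltW e0) dirderiv; have h2 := ler_wpM2l (ltW e0) eB.
have : 0 < e * phi w by rewrite mulr_gt0.
by move: h1 h2; rewrite expr2; lra.
Qed.

(** [finite_Minty] gives the finite intersection property of the closed sets [C a], hence by
    compactness a point solving the Minty form against all of [A]. Testing it along the segment from
    [w] to [v], dividing by the step and letting it tend to 0 gives the original form, by continuity
    of [G]. *)
Lemma monotone_VI_exists A G :
  A !=set0 -> compact A -> convex_subset A -> continuous G ->
  (forall u v, 0 <= dotp (G u - G v) (u - v)) -> SOL_VI A G !=set0.
Proof.
move=> A0 cptA cvxA cG mono.
have clA := compact_closed (@norm_hausdorff _ _) cptA.
pose C a := A `&` [set w | 0 <= dotp (G a) (a - w)].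
have [w hw] : \bigcap_(a in A) C a !=set0.
  have := cptA; rewrite compact_In0; apply.
    exists (fun a => [set w | 0 <= dotp (G a) (a - w)]) => // a Aa.
    have : closed ((fun w : 'cV[R]_k => dotp (G a) (a - w)) @^-1` [set x : R | 0 <= x]); last by [].
    apply: preimage_closed; last exact: closed_ge.
    move=> w _.
    have cw : {for w, continuous (fun w : 'cV[R]_k => dotp (G a) (a - w))}.
      apply: continuous_dotp; first exact: cst_continuous.
      by apply: continuousB => //; exact: cst_continuous.
    exact: cw.
  move=> D DA; have [|w Aw hw] := @finite_Minty A G (finmap.enum_fset D) A0 cptA cvxA mono.
    by move=> a /DA /set_mem.
  by exists w => a /= aD; split => //; exact: hw.
have Aw : A w by have [a Aa] := A0; have [] := hw a Aa.
exists w; split => // v Av.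
pose z (e : R) := e *: v + (1 - e) *: w.
have zw e : z e - w = e *: (v - w).
  by rewrite /z scalerBl scale1r scalerBr addrA addrAC addrK.
have zpos e : 0 < e -> e <= 1 -> 0 <= dotp (G (z e)) (v - w).
  move=> e0 e1; have e01 : 0 <= e <= 1 by rewrite ltW.
  have [_ /=] := hw _ (cvxA _ _ _ e01 Av Aw).
  by rewrite zw dotpZr pmulr_rge0.
have cz : {for (0 : R), continuous (fun e => dotp (G (z e)) (v - w))}.
  apply: continuous_dotp; last exact: cst_continuous.
  apply: (@continuous_comp _ _ _ z G); last exact: cG.
  have -> : z = (fun e => w + e *: (v - w)).
    by apply/funext => e; rewrite -zw addrC subrK.
  apply: continuousD; first exact: cst_continuous.
  exact: scalel_continuous.
rewrite leNgt; apply/negP => neg.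
have z0 : z 0 = w by rewrite /z scale0r add0r subr0 scale1r.
have : \forall e \near (0 : R), dotp (G (z e)) (v - w) < 0.
  have cz' : (fun e => dotp (G (z e)) (v - w)) @ (0 : R) --> dotp (G (z 0)) (v - w).
    exact: cz.
  by apply: (cvgr_lt _ cz'); rewrite z0.
move=> /nbhs_ballP[d /= d0 /(_ (Num.min 1 (d / 2)))].
have m0 : 0 < Num.min 1 (d / 2) by rewrite lt_min ltr01 divr_gt0.
have md : ball 0 d (Num.min 1 (d / 2)).
  rewrite -ball_normE /= sub0r normrN gtr0_norm // gt_min.
  by apply/orP; right; lra.
by move=> /(_ md); rewrite ltNge zpos // ge_min lexx.
Qed.

(* The Minty form of the first inequality evaluates G only at the point w. *)
Lemma VI_Minty_lower A G (c : R) u w : SOL_VI A G u -> A w ->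
  (forall u v, c * enorm (u - v) ^+ 2 <= dotp (G u - G v) (u - v)) ->
  c * enorm (w - u) ^+ 2 <= dotp (G w) (w - u).
Proof.
move=> [_ /(_ w) Gu] Aw mono; have := mono w u; have := Gu Aw.
by rewrite dotpBl; lra.
Qed.

(** Each inequality is tested at the other solution; strong monotonicity leaves the square of the
    distance on one side and [G1 - G2] at the single point [u2] on the other. *)
Lemma VI_Lipschitz A G1 G2 (c d : R) u1 u2 : 0 < c ->
  (forall u v, c * enorm (u - v) ^+ 2 <= dotp (G1 u - G1 v) (u - v)) ->
  (forall u, enorm (G1 u - G2 u) <= d) ->
  SOL_VI A G1 u1 -> SOL_VI A G2 u2 -> enorm (u1 - u2) <= d / c.
Proof.
move=> c0 mono hd s1 s2.
have [A1 _] := s1; have [A2 h2] := s2.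
have := VI_Minty_lower s1 A2 mono; have := h2 _ A1.
rewrite -(opprB u2 u1) dotpNr enormN => p1 p2.
have : c * enorm (u2 - u1) ^+ 2 <= d * enorm (u2 - u1).
  have := dotp_le (G1 u2 - G2 u2) (u2 - u1).
  have := ler_wpM2r (enorm_ge0 (u2 - u1)) (hd u2).
  by rewrite dotpBl; lra.
have [->|n0] := eqVneq (enorm (u2 - u1)) 0.
  by rewrite divr_ge0 ?(ltW c0) // (le_trans _ (hd 0)) ?enorm_ge0.
rewrite expr2 mulrA ler_pM2r ?lt_def ?n0 ?enorm_ge0 // => h.
by rewrite ler_pdivlMr // mulrC.
Qed.

End variational_inequality.

(** * Compactness for continuous functions on a segment *)

Lemma ultra_bounded_cvg (R : realType) I (G : set_system I) (a : I -> R) (M : R) :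
  UltraFilter G -> (forall i, `|a i| <= M) -> exists l : R, a @ G --> l.
Proof.
move=> UG aM; have PG : ProperFilter G by case: UG.
have [l [_ al]] : `[- M, M] `&` cluster (a @ G) !=set0.
  have aG : G (a @^-1` `[- M, M]).
    by apply: filterE => i; rewrite /= in_itv /= -ler_norml.
  exact: (@segment_compact _ (- M) M (a @ G)).
exists l => U lU.
have [//|GC] := in_ultra_setVsetC (a @^-1` U) UG.
by have [x []] := al (~` U) U GC lU.
Qed.

Lemma coord_cvg_enorm (R : realType) k I (G : set_system I) {FG : Filter G}
    (x : I -> 'cV[R]_k) (l : 'cV[R]_k) (e : R) :
  (forall j, (fun i => x i j 0) @ G --> l j 0) -> 0 < e ->
  \forall i \near G, enorm (x i - l) <= e.
Proof.
move=> xl e0; have e1 : 0 < e / (k%:R + 1) by rewrite divr_gt0 // ltr_wpDl.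
have : \forall i \near G, forall j, `|(x i - l) j 0| <= e / (k%:R + 1).
  apply: filter_forall => j.
  have := xl j => /cvgr_dist_le/(_ _ e1); apply: filterS => i.
  by rewrite !mxE distrC.
apply: filterS => i h.
apply: le_trans (enorm_le_mx_norm _) _.
have : `|x i - l| <= e / (k%:R + 1).
  rewrite [leLHS]mx_normrE; apply/bigmax_leP; split; first exact: ltW.
  by move=> [a b] _; rewrite /= ord1.
move=> /(ler_wpM2l (ler0n R k)) /le_trans; apply.
rewrite mulrCA ler_piMr ?(ltW e0) // ler_pdivrMr ?ltr_wpDl //.
by rewrite mul1r lerDl.
Qed.

Section continuous_functions_on_segment.
Variables (R : realType) (T : R) (k : nat).
Implicit Types (y z : contJ T k) (f : R -> 'cV[R]_k).

Lemma within_continuous_enormP f :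
  (forall t e : R, t \in `[0, T] -> 0 < e -> exists2 d : R, 0 < d &
    forall s, s \in `[0, T] -> `|s - t| < d -> enorm (f s - f t) < e) <->
  {within `[0, T], continuous f}.
Proof.
split=> [cf|/subspace_continuousP cf t e tJ e0].
  apply/subspace_continuousP => t tJ U /enorm_nbhs[e e0 eU].
  have [d d0 h] := cf t e tJ e0.
  apply/nbhs_ballP; exists d => // s; rewrite -ball_normE /= => sd sJ.
  by apply: eU; apply: h => //; rewrite distrC.
have /= := cf t tJ _ (near_enorm (f t) e0).
move=> /nbhs_ballP[d d0 h]; exists d => // s sJ sd.
by apply: (h s) => //; rewrite -ball_normE /= distrC.
Qed.

Lemma contJ_ex f : {within `[0, T], continuous f} ->
  exists y : contJ T k, forall t, t \in `[0, T] -> y t = f t.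
Proof.
move=> cf; pose h (t : R) := if t \in `[0, T] then f t else 0.
have hE t : t \in `[0, T] -> h t = f t by rewrite /h => ->.
have hJ : h \in @contJ_pred R T k.
  apply/asboolP; split; last by move=> t /negbTE tJ; rewrite /h tJ.
  apply/within_continuous_enormP => t e tJ e0.
  have [d d0 hd] := (within_continuous_enormP f).2 cf t e tJ e0.
  by exists d => // s sJ sd; rewrite !hE // hd.
by exists (ContJ hJ).
Qed.

Lemma contJ_enorm y t e : t \in `[0, T] -> 0 < e -> exists2 d : R, 0 < d &
  forall s, s \in `[0, T] -> `|s - t| < d -> enorm (y s - y t) < e.
Proof. by apply: (within_continuous_enormP y).2; exact: contJ_cts. Qed.

Lemma maxnormB_ub y z t : t \in `[0, T] -> enorm (y t - z t) <= maxnorm (y - z).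
Proof. exact: (maxnorm_ub (y - z)). Qed.

Lemma maxnormB_le y z M : 0 <= M ->
  (forall t, t \in `[0, T] -> enorm (y t - z t) <= M) -> maxnorm (y - z) <= M.
Proof. exact: (@maxnorm_le _ _ _ (y - z)). Qed.

Lemma maxnormBC y z : maxnorm (y - z) = maxnorm (z - y).
Proof. exact: (distrC y z). Qed.

(* Arzela-Ascoli: along an ultrafilter the functions converge pointwise, hence
   uniformly by equicontinuity. *)
Lemma equicontinuous_cluster (y : nat -> contJ T k) (M : R) :
  (forall i t, t \in `[0, T] -> enorm (y i t) <= M) ->
  (forall e : R, 0 < e -> exists2 d : R, 0 < d & forall i s t,
    s \in `[0, T] -> t \in `[0, T] -> `|s - t| < d ->
    enorm (y i s - y i t) <= e) ->
  exists z : contJ T k, forall (e : R) (N : nat), 0 < e ->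
    exists2 i, (N <= i)%N & maxnorm (y i - z) <= e.
Proof.
move=> yM equi.
have [G [UG leG]] := ultraFilterLemma eventually_filter.
have PG : ProperFilter G by case: UG.
have M0 i t : enorm (y i t) <= `|M|.
  have [tJ|tJ] := boolP (t \in `[0, T]); last by rewrite contJ_out // enorm0.
  exact: le_trans (yM i t tJ) (ler_norm _).
have [f hf] : {f : R -> 'cV[R]_k & forall t j, (fun i => y i t j 0) @ G --> f t j 0}.
  have h t j : {l : R | (fun i => y i t j 0) @ G --> l}.
    apply: cid; apply: (@ultra_bounded_cvg _ _ _ _ `|M|) => i.
    exact: le_trans (coord_le_enorm _ _) (M0 i t).
  exists (fun t => \col_j sval (h t j)) => t j; rewrite mxE.
  exact: svalP (h t j).
have near_f t (e : R) : 0 < e -> \forall i \near G, enorm (y i t - f t) <= e.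
  by move=> e0; apply: coord_cvg_enorm => // j; exact: hf.
have f_equi (e : R) : 0 < e -> exists2 d : R, 0 < d & forall s t,
    s \in `[0, T] -> t \in `[0, T] -> `|s - t| < d ->
    enorm (f s - f t) <= 3 * e.
  move=> e0; have [d d0 hd] := equi e e0; exists d => // s t sJ tJ st.
  have [i [hs ht]] := filter_ex (filterI (near_f s e e0) (near_f t e e0)).
  have := hd i s t sJ tJ st.
  have := enormD3 (f s) (y i s) (f t); have := enormD3 (y i s) (y i t) (f t).
  by rewrite (enormB (f s) (y i s)); move: hs ht => /=; lra.
have [|z zf] := @contJ_ex f.
  apply/within_continuous_enormP => t e tJ e0.
  have e4 : 0 < e / 4 by rewrite divr_gt0.
  have [d d0 hd] := f_equi _ e4; exists d => // s sJ st.
  by have := hd s t sJ tJ st; lra.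
exists z => e N e0.
(* One fifth for the equicontinuity of the [y i], one for the convergence at [t], and three for the
   limit through [f_equi]. *)
have e5 : 0 < e / 5 by rewrite divr_gt0.
have [d1 d10 hd1] := equi _ e5; have [d2 d20 hd2] := f_equi _ e5.
(* Compactness of the segment, as a near-covering property, turns an estimate valid for [s] near [t]
   and [G]-most [i] into one valid for all [s] at once. *)
have : \forall i \near G, `[0, T] `<=` [set t | enorm (y i t - z t) <= e].
  have /compact_near_coveringP/near_covering_withinP := @segment_compact R 0 T.
  apply => t tJ.
  exists (ball t (Num.min d1 d2), [set i | enorm (y i t - f t) <= e / 5]).
    split=> /=; last exact: near_f.
    by apply: nbhsx_ballx; rewrite lt_min d10.
  move=> [s i] /= [+ it] sJ.
  rewrite -ball_normE /= lt_min => /andP[st1 st2].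
  rewrite zf //.
  have := hd1 i t s tJ sJ st1; have := hd2 t s tJ sJ st2.
  have := enormD3 (y i s) (y i t) (f s); have := enormD3 (y i t) (f t) (f s).
  by rewrite (enormB (y i s) (y i t)); move: it => /=; lra.
(* [G] refines the filter at infinity, so an index beyond [N] is available. *)
move=> /(filterI (leG _ (nbhs_infty_ge N))) /filter_ex[i [iN h]].
exists i => //; apply: maxnormB_le; first exact: ltW.
by move=> t tJ; exact: h.
Qed.

End continuous_functions_on_segment.

(** * The solution function of the variational inequality: existence and stability *)

Section solution_function.
Variables (R : realType) (n m : nat) (T : R) (X1 X2 : metricType R).
Variables (Q : R -> 'cV[R]_n -> 'cV[R]_m) (S : 'cV[R]_m -> X1 -> 'cV[R]_m).
Variables (K : X2 -> set 'cV[R]_m) (LQ mS : R).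
Hypotheses (LQ0 : 0 < LQ) (mS0 : 0 < mS).
Hypothesis hQ : forall (t1 t2 : R) z1 z2, t1 \in `[0, T] -> t2 \in `[0, T] ->
  enorm (Q t1 z1 - Q t2 z2) <= LQ * (`|t1 - t2| + enorm (z1 - z2)).
Hypothesis Smono : forall u1 u2 xi,
  mS * enorm (u1 - u2) ^+ 2 <= dotp (S u1 xi - S u2 xi) (u1 - u2).
Hypothesis hK : forall sigma,
  [/\ K sigma !=set0, compact (K sigma) & convex_subset (K sigma)].
Hypothesis cS : continuous (fun ux : 'cV[R]_m * X1 => S ux.1 ux.2).
Hypothesis cK : multimap_continuous K.

Let VI b xi sigma := SOL_VI (K sigma) (fun v => b + S v xi).

Let cS1 b xi : continuous (fun v => b + S v xi).
Proof.
move=> v; apply: continuousD; first exact: cst_continuous.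
apply: (@continuous_comp _ _ _ (fun v => (v, xi)) (fun ux => S ux.1 ux.2)).
  exact: (cvg_pair (@cvg_id _ (nbhs v)) (@cvg_cst _ xi _ _ _)).
exact: cS.
Qed.

Let mono b xi u v :
  mS * enorm (u - v) ^+ 2 <= dotp (b + S u xi - (b + S v xi)) (u - v).
Proof. by rewrite opprD addrACA subrr add0r Smono. Qed.

Lemma VI_ex b xi sigma : VI b xi sigma !=set0.
Proof.
have [K0 Kc Kx] := hK sigma; apply: monotone_VI_exists => //.
move=> u v; apply: le_trans (mono b xi u v).
by rewrite mulr_ge0 ?(ltW mS0) ?sqr_ge0.
Qed.

Lemma VI_dist b1 b2 xi sigma u1 u2 :
  VI b1 xi sigma u1 -> VI b2 xi sigma u2 -> enorm (u1 - u2) <= enorm (b1 - b2) / mS.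
Proof.
move=> h1 h2; apply: (VI_Lipschitz mS0 (mono b1 xi) _ h1 h2) => u.
by rewrite opprD addrACA subrr addr0.
Qed.

Lemma VI_function_dist xi sigma (y z : contJ T n) (u v : contJ T m) t :
  VI_function Q S K xi sigma y u -> VI_function Q S K xi sigma z v ->
  t \in `[0, T] -> enorm (u t - v t) <= LQ / mS * enorm (y t - z t).
Proof.
move=> hu hv tJ; apply: le_trans (VI_dist (hu t tJ) (hv t tJ)) _.
rewrite mulrAC ler_pM2r ?invr_gt0 //.
by apply: le_trans (hQ _ _ tJ tJ) _; rewrite subrr normr0 add0r.
Qed.

(** Pointwise solutions exist; they depend on the value of [Q] with Lipschitz constant [1 / mS], so
    continuity in time is inherited from [y] and [Q]. *)
Lemma VI_function_ex xi sigma (y : contJ T n) :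
  exists u : contJ T m, VI_function Q S K xi sigma y u.
Proof.
have [u hu] := choice (fun t => VI_ex (Q t (y t)) xi sigma).
have [|v vu] := @contJ_ex R T m u; last first.
  by exists v => t tJ; rewrite vu //; exact: hu.
apply/within_continuous_enormP => t e tJ e0.
pose e' := e * mS / (2 * LQ).
have e'0 : 0 < e' by rewrite divr_gt0 ?mulr_gt0.
have [d d0 hd] := contJ_enorm y tJ e'0.
exists (Num.min d e'); first by rewrite lt_min d0.
move=> s sJ; rewrite lt_min => /andP[st1 st2].
apply: le_lt_trans (VI_dist (hu s) (hu t)) _.
rewrite ltr_pdivrMr //; apply: le_lt_trans (hQ _ _ sJ tJ) _.
have -> : e * mS = LQ * (e' + e') by rewrite /e'; field; rewrite gt_eqF.
by rewrite ltr_pM2l // ltrD // hd.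
Qed.

(** The two semicontinuities of [K] supply the two test points: the lower one a [w] in [K sigma]
    near [u0], to test the inequality of [v]; the upper one a [v'] in [K sigma0] near [v], to test
    that of [u0]. In Minty's form the perturbed operator is evaluated at [w] only, so continuity of
    [S] at [(u0, xi0)] is enough. *)
Lemma VI_stable b xi0 sigma0 u0 (e : R) : 0 < e -> VI b xi0 sigma0 u0 ->
  \forall p \near (xi0, sigma0), forall v, VI b p.1 p.2 v -> enorm (v - u0) <= e.
Proof.
move=> e0 [Ku0 hu0].
pose c := enorm (b + S u0 xi0); have c0 : 0 <= c by exact: enorm_ge0.
(* Tuned for the final contradiction: if the distance [x] exceeded [e / 2], then
   [c * (2 * d1) < mS * e ^+ 2 / 8] and [d2 * x] would each stay below half of [mS * x ^+ 2]. *)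
pose d1 := Num.min (e / 2) (mS * e ^+ 2 / (16 * (c + 1))).
pose d2 := mS * e / 4.
have c1 : 0 < c + 1 by rewrite ltr_wpDl.
have d10 : 0 < d1 by rewrite lt_min !divr_gt0 ?mulr_gt0 ?exprn_gt0.
have d20 : 0 < d2 by rewrite !divr_gt0 ?mulr_gt0.
have [[_ uscK] [_ lscK]] := cK.
have [A A0 [d3 d30 hA]] : exists2 A, nbhs xi0 A & exists2 d3 : R, 0 < d3 &
    forall w xi, enorm (w - u0) < d3 -> A xi -> enorm (S w xi - S u0 xi0) < d2.
  have [[B A] [/= uB xA] BA] := @cS (u0, xi0) _ (near_enorm (S u0 xi0) d20).
  have [d3 d30 h] := enorm_nbhs uB.
  by exists A => //; exists d3 => // w xi /h Bw Ax; exact: (BA (w, xi)).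
pose d := Num.min d1 d3; have d_gt0 : 0 < d by rewrite lt_min d10.
have [V1 [oV1 V1s lscV]] : exists O, [/\ open O, O sigma0 &
    forall sigma, O sigma -> K sigma `&` [set v | enorm (v - u0) < d] !=set0].
  apply: lscK; first exact: open_enorm_ball.
  by exists u0; split => //=; rewrite subrr enorm0.
pose U := \bigcup_(v' in K sigma0) [set v | enorm (v - v') < d1].
have [V2 [oV2 V2s uscV]] : exists O, [/\ open O, O sigma0 &
    forall sigma, O sigma -> K sigma `<=` U].
  apply: uscK; first by apply: bigcup_open => v _; exact: open_enorm_ball.
  by move=> v Kv; exists v => //=; rewrite subrr enorm0.
exists (A, V1 `&` V2).
  by split=> //=; apply: filterI; apply: open_nbhs_nbhs.
move=> [xi sigma] /= [Axi [Os1 Os2]] v Vv.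
have [w [Kw /= wu0]] := lscV sigma Os1.
have [v' Kv' /= vv'] := uscV sigma Os2 v Vv.1.
move: wu0; rewrite lt_min => /andP[wu1 wu3].
have M := VI_Minty_lower Vv Kw (mono b xi).
have wS := hA w xi wu3 Axi.
set x := enorm (w - v) in M; have x0 : 0 <= x by exact: enorm_ge0.
have B : dotp (b + S w xi) (w - v) <= c * (2 * d1) + d2 * x.
  have -> : b + S w xi = (b + S u0 xi0) + (S w xi - S u0 xi0).
    by rewrite -addrA; congr (_ + _); rewrite addrC subrK.
  rewrite dotpDl lerD //; last first.
    by apply: le_trans (dotp_le _ _) _; rewrite ler_wpM2r // ltW.
  (* The outer differences are shorter than [d1]; the middle one contributes with a favourable sign
     by the inequality at [u0]. *)
  have -> : w - v = (w - u0) - (v' - u0) - (v - v').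
    by rewrite opprB addrA subrK opprB addrA subrK.
  have := hu0 v' Kv'.
  have := dotp_le (b + S u0 xi0) (w - u0).
  have := dotp_le (b + S u0 xi0) (v' - v); rewrite -/c -(opprB v v') enormN dotpNr.
  have := ler_wpM2l c0 (ltW wu1); have := ler_wpM2l c0 (ltW vv').
  by rewrite !dotpBr; lra.
have xe : x <= e / 2.
  rewrite leNgt; apply/negP => xe.
  have : c * (2 * d1) < mS * e ^+ 2 / 8.
    have d1le : d1 <= mS * e ^+ 2 / (16 * (c + 1)) by rewrite ge_min lexx orbT.
    apply: (@lt_le_trans _ _ ((c + 1) * (2 * d1))).
      by rewrite ltr_pM2r ?mulr_gt0 // ltrDl.
    have -> : mS * e ^+ 2 / 8 = (c + 1) * (2 * (mS * e ^+ 2 / (16 * (c + 1)))).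
      by field; rewrite gt_eqF.
    by rewrite ler_pM2l // ler_pM2l.
  have p1 : 0 < (x - e / 2) * mS * x.
    by rewrite !mulr_gt0 ?subr_gt0 // (lt_trans _ xe) // divr_gt0.
  have p2 : 0 < (x - e / 2) * mS * e.
    by rewrite !mulr_gt0 ?subr_gt0.
  by have := le_trans M B; rewrite /d2; lra.
have := enormD3 v w u0; rewrite (enormB v w) -/x.
have : d1 <= e / 2 by rewrite ge_min lexx.
by lra.
Qed.

Lemma VI_function_stable xi0 sigma0 (y : contJ T n) (u : contJ T m) (e : R) :
  0 < e -> VI_function Q S K xi0 sigma0 y u ->
  \forall p \near (xi0, sigma0), forall (z : contJ T n) (v : contJ T m),
    VI_function Q S K p.1 p.2 z v ->
    maxnorm (v - u) <= e + LQ / mS * maxnorm (z - y).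
Proof.
move=> e0 hu.
pose P (p : X1 * X2) t := forall (z : contJ T n) (v : contJ T m),
  VI_function Q S K p.1 p.2 z v ->
  enorm (v t - u t) <= e + LQ / mS * maxnorm (z - y).
have : \forall p \near (xi0, sigma0), `[0, T] `<=` P p.
  have /compact_near_coveringP/near_covering_withinP cov := @segment_compact R 0 T.
  apply: (cov _ (nbhs ((xi0, sigma0) : X1 * X2)) P (nbhs_filter _)) => t tJ.
  have e4 : 0 < e / 4 by rewrite divr_gt0.
  have stab := VI_stable e4 (hu t tJ).
  pose e' := e / 4 * mS / LQ.
  have e'0 : 0 < e' by rewrite divr_gt0 // mulr_gt0.
  have [d1 d10 hd1] := contJ_enorm u tJ e4.
  have [d2 d20 hd2] := contJ_enorm y tJ e'0.
  exists (ball t (Num.min d1 (Num.min d2 e')),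
    [set p | forall w, VI (Q t (y t)) p.1 p.2 w -> enorm (w - u t) <= e / 4]).
    by split => //=; apply: nbhsx_ballx; rewrite !lt_min d10 d20.
  move=> [s p] /= [+ hp] sJ z v hv.
  rewrite -ball_normE /= distrC !lt_min => /andP[st1 /andP[st2 st3]].
  have [w hw] := VI_ex (Q t (y t)) p.1 p.2.
  have vw := VI_dist (hv s sJ) hw.
  have : enorm (v s - w) <= e / 4 + e / 4 + LQ / mS * maxnorm (z - y).
    apply: le_trans vw _; rewrite ler_pdivrMr //.
    apply: le_trans (hQ _ _ sJ tJ) _.
    have -> : (e / 4 + e / 4 + LQ / mS * maxnorm (z - y)) * mS
        = LQ * (e' + (maxnorm (z - y) + e')).
      by rewrite /e'; field; rewrite !gt_eqF.
    rewrite ler_pM2l // lerD // ?(ltW st3) //.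
    apply: le_trans (enormD3 _ (y s) _) _.
    by rewrite lerD ?maxnormB_ub // ltW // hd2.
  have := hp w hw; have := hd1 s sJ st1.
  have := enormD3 (v s) w (u s); have := enormD3 w (u t) (u s).
  by rewrite (enormB (u t) (u s)); lra.
apply: filterS => p hp z v hv; apply: maxnormB_le.
  by rewrite addr_ge0 ?(ltW e0) // mulr_ge0 ?divr_ge0 ?maxnorm_ge0 ?ltW.
by move=> t tJ; exact: hp.
Qed.

End solution_function.

(** * Powers of the positive part, the kernel of the fractional integral *)

Section positive_part_power.
Variable R : realType.
Implicit Types (r x y : R).

(** For a positive exponent the kernel [ppow r (t - s)] vanishes for [s >= t], so integrals over
    [[0, t]] become integrals over the fixed segment [[0, T]] with a continuous kernel. *)
Definition ppow r x : R := Num.max x 0 `^ r.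

Lemma ppow_ge0 r x : 0 <= ppow r x.
Proof. exact: powR_ge0. Qed.

Lemma ppowE r x : 0 <= x -> ppow r x = x `^ r.
Proof. by move=> x0; rewrite /ppow max_l. Qed.

Lemma ppow_le0 r x : 0 < r -> x <= 0 -> ppow r x = 0.
Proof. by move=> r0 x0; rewrite /ppow max_r // powR0 // gt_eqF. Qed.

Lemma ppow_le r x y : 0 <= r -> x <= y -> ppow r x <= ppow r y.
Proof.
have m0 (z : R) : Num.max z 0 \is Num.nneg by rewrite nnegrE le_max lexx orbT.
move=> r0 xy; apply: ge0_ler_powR => //.
by rewrite ge_max !le_max xy lexx orbT.
Qed.

Lemma powRD_le r x y : 0 <= r <= 1 -> 0 <= x -> 0 <= y ->
  (x + y) `^ r <= x `^ r + y `^ r.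
Proof.
move=> /andP[r0 r1] x0 y0.
have [s0|s0] := leP (x + y) 0.
  have -> : x = 0 by apply/eqP; rewrite eq_le x0 andbT; lra.
  by rewrite add0r lerDr powR_ge0.
(* A number in [[0, 1]] is at most its power of exponent [r <= 1]; summing over the two fractions of
   [x + y] gives subadditivity. *)
have frac a : 0 <= a -> a <= x + y -> a / (x + y) <= (a / (x + y)) `^ r.
  rewrite le_eqVlt => /predU1P[<-|a0] ale; first by rewrite mul0r powR_ge0.
  apply: ger1_powR => //.
  by rewrite divr_gt0 // ler_pdivrMr // mul1r.
have E a : 0 <= a -> a `^ r = (a / (x + y)) `^ r * (x + y) `^ r.
  move=> a0; rewrite -powRM ?divr_ge0 // ?ltW //.
  by rewrite divfK // gt_eqF.
rewrite (E x) // (E y) // -mulrDl -[leLHS]mul1r ler_wpM2r ?powR_ge0 //.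
have -> : 1 = x / (x + y) + y / (x + y) by rewrite -mulrDl divff // gt_eqF.
by rewrite lerD // frac // ?lerDl ?lerDr.
Qed.

Lemma ppow_Hoelder r x y : 0 < r <= 1 -> `|ppow r x - ppow r y| <= `|x - y| `^ r.
Proof.
move=> /andP[r0 r1]; wlog xy : x y / y <= x.
  move=> h; have [|/ltW] := leP y x; first exact: h.
  by rewrite distrC (distrC x); exact: h.
rewrite !ger0_norm ?subr_ge0 //; last by apply: ppow_le => //; exact: ltW.
rewrite lerBlDr.
have [y0|y0] := leP y 0.
  have [x0|x0] := leP x 0; first by rewrite !ppow_le0 // addr0 powR_ge0.
  rewrite (ppow_le0 r0 y0) addr0 (ppowE _ (ltW x0)).
  by apply: ge0_ler_powR; rewrite ?nnegrE ?subr_ge0 ?(ltW r0) ?(ltW x0) //; lra.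
rewrite !ppowE ?(ltW y0) //; last by lra.
rewrite -{1}(subrK y x); apply: powRD_le; rewrite ?subr_ge0 ?(ltW r0) ?(ltW y0) //.
Qed.

Lemma ppow_continuous_le1 r : 0 < r <= 1 -> continuous (ppow r).
Proof.
move=> r01 x; have /andP[r0 _] := r01; apply/cvgrPdist_lt => e e0.
have d0 : 0 < e `^ r^-1 by rewrite powR_gt0.
apply/nbhs_ballP; exists (e `^ r^-1) => // y /= xy.
apply: le_lt_trans (ppow_Hoelder x y r01) _.
have -> : e = (e `^ r^-1) `^ r by rewrite -powRrM mulVf ?powRr1 ?gt_eqF // ltW.
by apply: gt0_ltr_powR => //; rewrite nnegrE ?powR_ge0.
Qed.

Lemma ppowS r x : 0 < r -> ppow r x = Num.max x 0 * ppow (r - 1) x.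
Proof. by move=> r0; rewrite /ppow mulr_powRB1 // le_max lexx orbT. Qed.

Lemma ppow_continuous r : 1 < r <= 2 -> continuous (ppow r).
Proof.
move=> /andP[r1 r2] x.
have -> : ppow r = (fun x => Num.max x 0 * ppow (r - 1) x).
  by apply/funext => y; rewrite ppowS // (lt_trans ltr01).
have c1 : {for x, continuous (fun y : R => Num.max y 0)}.
  by apply: continuous_max => //; exact: cst_continuous.
have c2 : {for x, continuous (ppow (r - 1))} by apply: ppow_continuous_le1; lra.
exact: (continuousM c1 c2).
Qed.

Lemma is_derive_ppow r x : 0 < x -> is_derive x 1 (ppow r) (r * ppow (r - 1) x).
Proof.
move=> x0; have [d D] := is_derive1_powR r x0.
have E : \forall y \near x, y `^ r = ppow r y.
  by near=> y; rewrite ppowE // ltW //; near: y; exact: lt_nbhsr.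
split; first by apply: near_eq_derivable d.
by rewrite -(near_eq_derive _ E) D ppowE // ltW.
Unshelve. all: by end_near. Qed.

Lemma continuous_derivable_oo_LRcontinuous (F : R -> R) (a b : R) :
  continuous F -> {in `]a, b[, forall x, derivable F x 1} ->
  derivable_oo_LRcontinuous F a b.
Proof.
by move=> cF dF; split => //; [apply: cvg_at_right_filter|apply: cvg_at_left_filter];
  exact: cF.
Qed.

Local Notation mu := (@lebesgue_measure R).

Lemma integral_ppow (q t : R) : 1 < q <= 2 -> 0 < t ->
  (\int[mu]_(s in `[0%R, t]) (ppow (q - 1) (t - s))%:E = (t `^ q / q)%:E)%E.
Proof.
move=> q12 t0; have /andP[q1 q2] := q12.
have q0 : 0 < q by lra.
(* The antiderivative is differentiated only for [x < t]; continuity at the endpoint is all that the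
   fundamental theorem asks there. *)
have dF x : x < t ->
    is_derive x 1 (fun s => - q^-1 * ppow q (t - s)) (ppow (q - 1) (t - x)).
  move=> xt; have tx : 0 < t - x by rewrite subr_gt0.
  have D := is_derive_ppow q tx.
  have D1 : is_derive x 1 (fun s => t - s) (- 1 : R).
    by have := is_deriveB (is_derive_cst t x 1) (is_derive_id x (1 : R)); rewrite sub0r.
  have := is_deriveZ (- q^-1) (@is_derive1_comp _ (ppow q) (fun s => t - s) x _ _ D D1).
  move/is_derive_eq; apply; rewrite /GRing.scale /=.
  by field; rewrite gt_eqF.
have c : continuous (fun s => - q^-1 * ppow q (t - s)).
  move=> x; have c1 : {for x, continuous (fun s => ppow q (t - s))}.
    apply: (@continuous_comp _ _ _ (fun s => t - s)); last exact: ppow_continuous.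
    by apply: continuousB => //; exact: cst_continuous.
  exact: (continuousM (@cst_continuous R R (- q^-1) x) c1).
rewrite (@continuous_FTC2 _ _ (fun s => - q^-1 * ppow q (t - s))) //.
- rewrite subrr subr0 ppow_le0 // ppowE ?(ltW t0) // -EFinB; congr (_%:E).
  by rewrite mulr0 sub0r mulNr opprK mulrC.
- apply: continuous_subspaceT => x.
  apply: (@continuous_comp _ _ _ (fun s => t - s)).
    by apply: continuousB => //; exact: cst_continuous.
  by apply: ppow_continuous_le1; lra.
- apply: continuous_derivable_oo_LRcontinuous => // x.
  by rewrite in_itv /= => /andP[_ xt]; have [] := dF x xt.
- move=> x; rewrite in_itv /= => /andP[_ xt].
  by rewrite derive1E; have [] := dF x xt.
Qed.

End positive_part_power.

(** * Positivity and recurrence inequality of the Gamma function *)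

Section gamma_function.
Variable R : realType.
Local Notation mu := (@lebesgue_measure R).
Implicit Types (a q t : R).

Let integrand a t : R := ppow a t * expR (- t).
Let E a : \bar R := (\int[mu]_(t in `[0%R, +oo[) (integrand a t)%:E)%E.

Let integrand_ge0 a t : 0 <= integrand a t.
Proof. by rewrite mulr_ge0 ?ppow_ge0 ?expR_ge0. Qed.

Let cexp : continuous (fun t : R => expR (- t)).
Proof.
move=> t; apply: (@continuous_comp _ _ _ (fun t : R => - t)).
  by apply: continuousN.
exact: continuous_expR.
Qed.

Let cint a : continuous (ppow a) -> continuous (integrand a).
Proof.
move=> c t; have c1 : {for t, continuous (ppow a)} by exact: c.
have c2 : {for t, continuous (fun t : R => expR (- t))} by exact: cexp.
exact: (continuousM c1 c2).
Qed.

Let mint a D : continuous (ppow a) -> measurable D ->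
  measurable_fun D (EFin \o integrand a).
Proof.
move=> /cint/continuous_measurable_fun c mD; apply/measurable_EFinP.
exact: measurable_funTS.
Qed.

Let GammaE q : continuous (ppow (q - 1)) -> Gamma q = fine (E (q - 1)).
Proof.
move=> c; rewrite /Gamma /Rintegral /E -integral_itv_obnd_cbnd; last exact: mint.
congr fine; apply: eq_integral => t; rewrite inE /= in_itv /= andbT => t0.
by rewrite /integrand ppowE // ltW.
Qed.

Let E_gt0 a : 0 < a -> continuous (ppow a) -> (0 < E a)%E.
Proof.
move=> a0 c; apply: (@lt_le_trans _ _ (\int[mu]_(t in `[1%R, 2%R]) (expR (-2))%:E)%E).
  rewrite integral_cst //= lebesgue_measure_itv /= lte_fin ltr1n /= -EFinB -EFinM.
  by rewrite lte_fin mulr_gt0 ?expR_gt0 //; lra.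
apply: (@le_trans _ _ (\int[mu]_(t in `[1%R, 2%R]) (integrand a t)%:E)%E); last first.
  apply: ge0_subset_integral => //=; first exact: mint.
    by move=> x _; rewrite lee_fin.
  by move=> x; rewrite /= !in_itv /= andbT => /andP[x1 _]; lra.
apply: ge0_le_integral => //=.
  exact: mint.
move=> x; rewrite in_itv /= => /andP[x1 x2]; rewrite lee_fin /integrand.
rewrite -[leLHS]mul1r ler_pM ?expR_ge0 ?ler_expR ?lerN2 //.
rewrite ppowE ?(le_trans ler01) //.
have p1 : (1 : R) `^ a = 1 by rewrite powR1.
by rewrite -[leLHS]p1; apply: ge0_ler_powR => //; rewrite ?nnegrE ?(ltW a0) // ?(le_trans ler01).
Qed.

Let E_lty a : 0 < a <= 1 -> (E a < +oo)%E.
Proof.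
move=> a01; have c := ppow_continuous_le1 a01; have /andP[a0 a1] := a01.
have h0 : 0 < 2^-1 :> R by lra.
(* The dominating function is four times the exponential density of rate 1/2, because the power of
   [t] is at most [1 + t], hence at most [2 * expR (t / 2)]. *)
apply: (@le_lt_trans _ _ (\int[mu]_(t in `[0%R, +oo[) (4%:E * (exponential_pdf 2^-1 t)%:E))%E).
  apply: ge0_le_integral => //=.
  - by move=> x _; rewrite lee_fin.
  - exact: mint.
  - apply: emeasurable_funM; first exact: measurable_cst.
    apply/measurable_EFinP; apply: measurable_funTS.
    exact: measurable_exponential_pdf.
  move=> x; rewrite in_itv /= andbT => x0.
  rewrite exponential_pdfE // -EFinM lee_fin /integrand.
  have -> : 4 * (2^-1 * expR (- 2^-1 * x)) = 2 * expR (x / 2) * expR (- x).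
    rewrite -(mulrA _ (expR (x / 2))) -expRD.
    have -> : x / 2 + - x = - 2^-1 * x by lra.
    by lra.
  rewrite ler_wpM2r ?expR_ge0 //.
  have x1 : ppow a x <= 1 + x.
    rewrite ppowE //; have [x1|/ltW x1] := leP x 1.
      rewrite (@le_trans _ _ 1) ?lerDl //.
      have p1 : (1 : R) `^ a = 1 by rewrite powR1.
      rewrite -[leRHS]p1.
      by apply: ge0_ler_powR => //; rewrite ?nnegrE ?(ltW a0).
    by apply: le_trans (ler1_powR x1 a1) _; rewrite lerDr.
  apply: le_trans x1 _; have := expR_ge1Dx (x / 2); lra.
rewrite ge0_integralZl //=; last 2 first.
- apply/measurable_EFinP; apply: measurable_funTS.
  exact: measurable_exponential_pdf.
- by move=> x _; rewrite lee_fin exponential_pdf_ge0 // ltW.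
rewrite lte_mul_pinfty //.
apply: (@le_lt_trans _ _ 1%E); last exact: ltry.
rewrite -(integral_exponential_pdf h0).
apply: ge0_subset_integral => //=.
  by apply/measurable_EFinP; exact: measurable_exponential_pdf.
by move=> x _; rewrite lee_fin exponential_pdf_ge0 // ltW.
Qed.

(** Integration by parts on [[0, N]]: the boundary term at [N] is nonpositive and is dropped, and
    monotone convergence lets [N] grow. Since the right side is already known to be finite, this
    also yields the finiteness of [E q]. *)
Let E_rec q : 1 < q <= 2 -> (E q <= q%:E * E (q - 1))%E.
Proof.
move=> q12; have /andP[q1 q2] := q12.
have c := ppow_continuous q12.
have c1 : continuous (ppow (q - 1)) by apply: ppow_continuous_le1; lra.
have q0 : 0 < q by lra.
pose D i := `[0, i%:R]%classic : set R.
have mD i : measurable (D i) by exact: measurable_itv.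
have ndD : nondecreasing_seq D.
  move=> i j ij; rewrite subsetEset => x; rewrite /D /= !in_itv /= => /andP[-> xi].
  by rewrite (le_trans xi) // ler_nat.
have EE : E q = (\int[mu]_(t in \bigcup_i D i) (integrand q t)%:E)%E.
  congr integral; apply/seteqP; split=> x /=; rewrite in_itv /= andbT.
    move=> x0; exists (Num.truncn x).+1 => //; rewrite /D /= in_itv /= x0 /=.
    by rewrite ltW // truncnS_gt.
  by move=> [i _]; rewrite /D /= in_itv /= => /andP[].
have := @ge0_nondecreasing_set_cvg_integral _ (measurableTypeR R) _ D (fun t => (integrand q t)%:E) mu ndD mD.
move=> /(_ (fun i => mint c (mD i))) /(_ (fun i x _ => integrand_ge0 q x)).
rewrite -EE => lim.
apply: (cvge_to_le lim); apply: nearW => i.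
(* The first interval is a single point, to which the fundamental theorem does not apply. *)
case: i => [|i].
  rewrite /D set_itv1 integral_set1 mule_ge0 ?lee_fin ?(ltW q0) // integral_ge0 //.
  by move=> x _; rewrite lee_fin.
set N : R := i.+1%:R; have N0 : 0 < N by rewrite ltr0n.
have dF (x : R) : 0 < x -> is_derive x 1 (fun t : R => - integrand q t)
    (integrand q x - q * integrand (q - 1) x).
  move=> x0; have D1 := is_derive_ppow q x0.
  have D2 : is_derive x 1 (fun t : R => expR (- t)) (expR (- x) * -1).
    exact: (@is_derive1_comp _ expR (fun t : R => - t) x _ _ (is_derive_expR _) (is_deriveNid _ _)).
  have := is_deriveN (is_deriveM D1 D2).
  move/is_derive_eq; apply; rewrite /GRing.scale /= /integrand; ring.
have ci t : {for t, continuous (integrand q)} by exact: cint.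
have ci1 t : {for t, continuous (fun t : R => q * integrand (q - 1) t)}.
  have ci' : {for t, continuous (integrand (q - 1))} by exact: cint.
  exact: (continuousM (@cst_continuous R R q t) ci').
have cF : continuous (fun t : R => - integrand q t).
  by move=> t; exact: (continuousN (ci t)).
have FTC : (\int[mu]_(t in D i.+1) (integrand q t - q * integrand (q - 1) t)%:E
    = (- integrand q N)%:E - (- integrand q 0)%:E)%E.
  rewrite /D (@continuous_FTC2 _ _ (fun t : R => - integrand q t)) //.
  - apply: continuous_subspaceT => x.
    exact: (continuousB (ci x) (ci1 x)).
  - apply: continuous_derivable_oo_LRcontinuous => // x.
    by rewrite in_itv /= => /andP[x0 _]; have [] := dF x x0.
  - move=> x; rewrite in_itv /= => /andP[x0 _].
    by rewrite derive1E; have [] := dF x x0.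
have i0 : mu.-integrable (D i.+1) (EFin \o integrand q).
  apply: continuous_compact_integrable; first exact: segment_compact.
  by apply: continuous_subspaceT; exact: cint.
have i1 : mu.-integrable (D i.+1) (EFin \o (fun t : R => q * integrand (q - 1) t)).
  apply: continuous_compact_integrable; first exact: segment_compact.
  apply: continuous_subspaceT => x.
  exact: ci1.
have le1 : (\int[mu]_(t in D i.+1) (integrand q t)%:E
    <= \int[mu]_(t in D i.+1) (q * integrand (q - 1) t)%:E)%E.
  rewrite -sube_le0 -integralB_EFin //; last exact: measurable_itv.
  apply: (@eq_ind_r _ _ (fun z => (z <= 0)%E) _ _ FTC).
  rewrite -EFinB lee_fin opprK.
  by rewrite {2}/integrand ppow_le0 // mul0r addr0 oppr_le0.
apply: (le_trans le1).
under eq_integral do rewrite EFinM.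
rewrite ge0_integralZl //=; last 4 first.
- exact: measurable_itv.
- exact: mint.
- by move=> x _; rewrite lee_fin.
- by rewrite lee_fin ltW.
rewrite lee_pmul2l ?lte_fin //.
apply: ge0_subset_integral => //=.
- exact: measurable_itv.
- exact: mint.
- by move=> x _; rewrite lee_fin.
- by move=> x; rewrite /D /= !in_itv /= => /andP[->].
Qed.

Lemma Gamma_gt0 q : 1 < q <= 2 -> 0 < Gamma q.
Proof.
move=> q12; have r01 : 0 < q - 1 <= 1 by lra.
have c := ppow_continuous_le1 r01.
rewrite GammaE // fine_gt0 // E_lty // andbT E_gt0 //.
by case/andP: r01.
Qed.

(** The direction needed to replace [1 / (q * Gamma q)], which integration of the kernel produces,
    by the [1 / Gamma (q + 1)] of the contraction constant. *)
Lemma Gamma_recurrence_le q : 1 < q <= 2 -> 0 < Gamma (q + 1) <= q * Gamma q.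
Proof.
move=> q12; have r01 : 0 < q - 1 <= 1 by lra.
have c1 := ppow_continuous_le1 r01; have c := ppow_continuous q12.
have q0 : 0 < q by lra.
rewrite !GammaE // addrK //.
have e1 := E_lty r01; have r := E_rec q12.
have f1 : E (q - 1) \is a fin_num.
  by rewrite ge0_fin_numE // integral_ge0 // => x _; rewrite lee_fin.
have e : (E q < +oo)%E by rewrite (le_lt_trans r) // -(fineK f1) -EFinM ltry.
have f : E q \is a fin_num.
  by rewrite ge0_fin_numE // integral_ge0 // => x _; rewrite lee_fin.
apply/andP; split; first by apply: fine_gt0; rewrite e andbT; exact: E_gt0.
by rewrite -lee_fin EFinM (fineK f) (fineK f1).
Qed.

End gamma_function.

(** * Almost-everywhere arguments and integrals of vector functions *)

Section almost_everywhere_lebesgue.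
Variable R : realType.
Local Notation mu := (@lebesgue_measure R).
Implicit Types P Q : R -> Prop.

Lemma ae_imp P Q : (forall t, P t -> Q t) ->
  {ae mu, forall t, P t} -> {ae mu, forall t, Q t}.
Proof. by move=> PQ; exact: (@filterS _ _ (ae_filter_ringOfSetsType mu)). Qed.

Lemma ae_imp2 P1 P2 Q : (forall t, P1 t -> P2 t -> Q t) ->
  {ae mu, forall t, P1 t} -> {ae mu, forall t, P2 t} -> {ae mu, forall t, Q t}.
Proof. exact: (@filterS2 _ _ (ae_filter_ringOfSetsType mu)). Qed.

Lemma ae_all_nat (P : nat -> R -> Prop) :
  (forall i, {ae mu, forall t, P i t}) -> {ae mu, forall t, forall i, P i t}.
Proof. exact: ae_foralln. Qed.

Lemma ae_all_count (I : countType) (P : I -> R -> Prop) :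
  (forall i, {ae mu, forall t, P i t}) -> {ae mu, forall t, forall i, P i t}.
Proof.
move=> h; have : {ae mu, forall t, forall p : nat,
    if unpickle p is Some i then P i t else True}.
  by apply: ae_all_nat => p; case: unpickle => [i|]; [exact: h|exact: aeW].
by apply: ae_imp => t H i; have := H (pickle i); rewrite pickleK.
Qed.

End almost_everywhere_lebesgue.

Section real_integral_ae.
Variable R : realType.
Local Notation mu := (@lebesgue_measure R).
Variables (D : set R) (mD : measurable (D : set (measurableTypeR R))).

Lemma ae_bounded_integrable (f : R -> R) (M : R) : (mu D < +oo)%E ->
  measurable_fun D f -> {ae mu, forall t, D t -> `|f t| <= M} ->
  mu.-integrable D (EFin \o f).
Proof.
move=> Dfin mf fM; apply/integrableP; split; first exact/measurable_EFinP.
apply: (@le_lt_trans _ _ (`|M|%:E * mu D)%E); last by rewrite lte_mul_pinfty.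
apply: integral_le_bound => //; first exact: measurableT_comp.
by apply: ae_imp fM => t h /h {}h; rewrite lee_fin (le_trans h) // ler_norm.
Qed.

(** The minimum of [f] and [g] equals [f] almost everywhere and is below [g] everywhere, which
    reduces the claim to the pointwise comparison. *)
Lemma ae_le_Rintegral (f g : R -> R) :
  mu.-integrable D (EFin \o f) -> mu.-integrable D (EFin \o g) ->
  {ae mu, forall t, D t -> f t <= g t} ->
  \int[mu]_(t in D) f t <= \int[mu]_(t in D) g t.
Proof.
move=> fi gi fg.
have mf : measurable_fun D f by apply/measurable_EFinP; exact: measurable_int fi.
have mg : measurable_fun D g by apply/measurable_EFinP; exact: measurable_int gi.
pose h t := Num.min (f t) (g t).
have mh : measurable_fun D h by exact: measurable_minr.
have fh : {ae mu, forall t, D t -> (f t)%:E = (h t)%:E}.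
  apply: ae_imp fg => t h' /h' {}h' /=; rewrite /h min_l //.
have hi : mu.-integrable D (EFin \o h).
  have i2 := integrableD mD (integrable_abse fi) (integrable_abse gi).
  apply: le_integrable i2 => //.
    exact/measurable_EFinP.
  move=> t _; rewrite /= lee_fin [leRHS]ger0_norm ?addr_ge0 // /h.
  by case: (ltP (f t) (g t)) => _; rewrite ?lerDl ?lerDr.
have -> : \int[mu]_(t in D) f t = \int[mu]_(t in D) h t.
  by congr fine; apply: ae_eq_integral => //; exact/measurable_EFinP.
by apply: le_Rintegral => // t _; rewrite /h ge_min lexx orbT.
Qed.

Lemma Rintegral_sum I (s : seq I) (f : I -> R -> R) :
  (forall i, mu.-integrable D (EFin \o f i)) ->
  mu.-integrable D (EFin \o (fun t => \sum_(i <- s) f i t)) /\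
  \int[mu]_(t in D) (\sum_(i <- s) f i t) = \sum_(i <- s) \int[mu]_(t in D) f i t.
Proof.
move=> fi; elim: s => [|i s [IHi IH]].
  split; last first.
    rewrite big_nil -[RHS](mul0r (fine (mu D))) -Rintegral_cst //.
    by apply: eq_Rintegral => t _; rewrite big_nil.
  have -> : (EFin \o (fun t => \sum_(i <- [::]) f i t)) = (fun=> 0%E).
    by apply/funext => t /=; rewrite big_nil.
  exact: integrable0.
have E : (fun t => \sum_(j <- i :: s) f j t) =
    (fun t => f i t + \sum_(j <- s) f j t).
  by apply/funext => t; rewrite big_cons.
rewrite E; split; last by rewrite RintegralD // IH big_cons.
exact: (integrableD mD (fi i) IHi).
Qed.

End real_integral_ae.

Section vector_integral.
Variables (R : realType) (n : nat).
Local Notation mu := (@lebesgue_measure R).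
Variables (D : set R) (mD : measurable (D : set (measurableTypeR R))).
Implicit Types (f g : R -> 'cV[R]_n) (w : R -> R).

Lemma L1_integrable f i : L1 D f -> mu.-integrable D (EFin \o (fun t => f t i 0)).
Proof. by move=> /(_ i). Qed.

Lemma L1_measurable f i : L1 D f -> measurable_fun D (fun t => f t i 0).
Proof.
by move=> /(L1_integrable i) fi; apply/measurable_EFinP; exact: measurable_int fi.
Qed.

Lemma L1D f g : L1 D f -> L1 D g -> L1 D (fun t => f t + g t).
Proof.
move=> lf lg i; have := integrableD mD (lf i) (lg i).
by apply: eq_integrable => // t _; rewrite mxE EFinD.
Qed.

Lemma L1Z w (C : R) f : measurable_fun D w -> (forall t, D t -> `|w t| <= C) ->
  L1 D f -> L1 D (fun t => w t *: f t).
Proof.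
move=> mw wC lf i.
have bw : [bounded w t | t in D].
  exists C; split; first exact: num_real.
  by move=> M /ltW CM t Dt; rewrite /= (le_trans (wC t Dt)).
have := integrableMr mD mw bw (lf i).
by apply: eq_integrable => // t _; rewrite mxE EFinM.
Qed.

Lemma L1Zl (a : R) f : L1 D f -> L1 D (fun t => a *: f t).
Proof. by apply: L1Z => //. Qed.

Lemma L1B f g : L1 D f -> L1 D g -> L1 D (fun t => f t - g t).
Proof.
move=> lf lg; have := L1D lf (L1Zl (-1) lg).
by under eq_fun do rewrite scaleN1r.
Qed.

Lemma vintegralD f g : L1 D f -> L1 D g ->
  vintegral D (fun t => f t + g t) = vintegral D f + vintegral D g.
Proof.
move=> lf lg; apply/matrixP => i j; rewrite !mxE.
rewrite -(RintegralD mD (L1_integrable i lf) (L1_integrable i lg)).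
by apply: eq_Rintegral => t _; rewrite mxE.
Qed.

Lemma vintegralZ (a : R) f : L1 D f ->
  vintegral D (fun t => a *: f t) = a *: vintegral D f.
Proof.
move=> lf; apply/matrixP => i j; rewrite !mxE.
rewrite -(RintegralZl a mD (L1_integrable i lf)).
by apply: eq_Rintegral => t _; rewrite mxE.
Qed.

Lemma vintegralB f g : L1 D f -> L1 D g ->
  vintegral D (fun t => f t - g t) = vintegral D f - vintegral D g.
Proof.
move=> lf lg; rewrite -[in RHS]scaleN1r -vintegralZ // -vintegralD //.
  by congr vintegral; apply/funext => t; rewrite scaleN1r.
exact: L1Zl.
Qed.

Lemma eq_vintegral f g : (forall t, D t -> f t = g t) ->
  vintegral D f = vintegral D g.
Proof.
move=> fg; apply/matrixP => i j; rewrite !mxE.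
by apply: eq_Rintegral => t; rewrite inE => Dt; rewrite fg.
Qed.

Lemma dotp_vintegral v f : L1 D f ->
  mu.-integrable D (EFin \o (fun t => dotp v (f t))) /\
  dotp v (vintegral D f) = \int[mu]_(t in D) dotp v (f t).
Proof.
move=> lf.
have fi i : mu.-integrable D (EFin \o (fun t => v i 0 * f t i 0)).
  by have := integrableZl mD (v i 0) (lf i); apply: eq_integrable.
have [I E] := Rintegral_sum mD (index_enum 'I_n) fi.
split => //; rewrite /dotp E; apply: eq_bigr => i _.
by rewrite mxE -(RintegralZl (v i 0) mD (L1_integrable i lf)).
Qed.

(* Test the integral against its own direction. *)
Lemma enorm_vintegral_le f w : L1 D f -> mu.-integrable D (EFin \o w) ->
  (forall t, D t -> 0 <= w t) -> {ae mu, forall t, D t -> enorm (f t) <= w t} ->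
  enorm (vintegral D f) <= \int[mu]_(t in D) w t.
Proof.
move=> lf wi w0 fw; set v := vintegral D f.
have [->|v0] := eqVneq (enorm v) 0; first exact: Rintegral_ge0.
have {}v0 : 0 < enorm v by rewrite lt_def v0 enorm_ge0.
have [I E] := dotp_vintegral v lf.
rewrite -(ler_pM2l v0) -expr2 sqr_enorm E.
rewrite -(RintegralZl _ mD wi); apply: ae_le_Rintegral => //.
  by have := integrableZl mD (enorm v) wi; apply: eq_integrable.
apply: ae_imp fw => t h Dt; apply: le_trans (dotp_le _ _) _.
by rewrite ler_pM2l // h.
Qed.

Lemma ae_bounded_L1 f (M : R) : (mu D < +oo)%E ->
  (forall i, measurable_fun D (fun t => f t i 0)) ->
  {ae mu, forall t, D t -> enorm (f t) <= M} -> L1 D f.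
Proof.
move=> Dfin mf fM i; apply: (@ae_bounded_integrable _ _ mD _ M) => //.
by apply: ae_imp fM => t h Dt; rewrite (le_trans (coord_le_enorm _ _)) ?h.
Qed.

End vector_integral.

(** * The Green operator of the fractional boundary value problem *)

Section Green_operator.
Variables (R : realType) (n : nat) (T q : R).
Local Notation mu := (@lebesgue_measure R).
Hypotheses (T0 : 0 < T) (q12 : 1 < q <= 2).
Implicit Types (f g h : R -> 'cV[R]_n) (s t b : R).

Let J := `[0, T]%classic : set R.
Let mJ : measurable (J : set (measurableTypeR R)).
Proof. exact: measurable_itv. Qed.

Let q1 : 0 < q - 1 <= 1.
Proof. by case/andP: q12 => ? ?; apply/andP; split; lra. Qed.
Let q1p : 0 < q - 1. Proof. by case/andP: q1. Qed.
Let q0 : 0 < q. Proof. by case/andP: q12 => ? ?; lra. Qed.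
Let G0 : 0 < Gamma q. Proof. exact: Gamma_gt0. Qed.

Lemma measure_segment : mu J = T%:E.
Proof. by rewrite lebesgue_measure_itv /= lte_fin T0 sube0. Qed.

Lemma measure_segment_lty : (mu J < +oo)%E.
Proof. by rewrite measure_segment ltry. Qed.

Lemma vintegral_segment f t : 0 <= t <= T ->
  vintegral `[0, t] (fun s => (t - s) `^ (q - 1) *: f s) =
  vintegral J (fun s => ppow (q - 1) (t - s) *: f s).
Proof.
move=> /andP[t0 tT]; apply/matrixP => i j; rewrite [LHS]mxE [RHS]mxE.
rewrite Rintegral_mkcond [RHS]Rintegral_mkcond; congr (Rintegral _ _ _).
apply/funext => s; rewrite !patchE !mem_setE /J.
rewrite !in_itv /=; have [s0|_] := leP 0 s => //=.
have [st|st] := leP s t; first by rewrite (le_trans st) // !mxE ppowE // subr_ge0.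
by case: ifP => // _; rewrite mxE ppow_le0 ?mul0r // subr_le0 ltW.
Qed.

(** Kernel of the problem with zero boundary values: the fractional integral minus the linear
    function of [t] that cancels it at [T]. For [s] in [[0, T]] it vanishes at both [t = 0] and
    [t = T]. *)
Definition Green t s := (Gamma q)^-1 * ppow (q - 1) (t - s)
  - t / (Gamma q * T) * ppow (q - 1) (T - s).

Definition Green_op f t := vintegral J (fun s => Green t s *: f s).

Lemma ppow_shift_continuous t : continuous (fun s => ppow (q - 1) (t - s)).
Proof.
move=> s; apply: (@continuous_comp _ _ _ (fun s => t - s)).
  by apply: continuousB => //; exact: cst_continuous.
exact: ppow_continuous_le1.
Qed.

Lemma Green_continuous t : continuous (Green t).
Proof.
move=> s.
have c a x : {for s, continuous (fun s => a * ppow (q - 1) (x - s))}.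
  have cx : {for s, continuous (fun s => ppow (q - 1) (x - s))}.
    exact: ppow_shift_continuous.
  exact: (continuousM (@cst_continuous R R a s) cx).
exact: (continuousB (c _ _) (c _ _)).
Qed.

Let Green_meas t D : measurable_fun (D : set (measurableTypeR R)) (Green t).
Proof.
apply: measurable_funTS; apply: continuous_measurable_fun.
exact: Green_continuous.
Qed.

Let ppow_le_T s t : 0 <= s -> t <= T -> ppow (q - 1) (t - s) <= T `^ (q - 1).
Proof.
move=> s0 tT; rewrite -(ppowE _ (ltW T0)).
by apply: ppow_le; [exact: ltW|lra].
Qed.

Let Green_coef t : 0 <= t <= T ->
  0 <= t / (Gamma q * T) /\ t / (Gamma q * T) <= (Gamma q)^-1.
Proof.
move=> /andP[t0 tT]; split.
  by rewrite divr_ge0 ?mulr_ge0 ?(ltW G0) ?(ltW T0).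
rewrite invfM mulrCA ler_piMr ?invr_ge0 ?(ltW G0) //.
by rewrite ler_pdivrMr // mul1r.
Qed.

Let Green_bound_cst := (Gamma q)^-1 * T `^ (q - 1) *+ 2.

Lemma Green_bound t s : 0 <= t <= T -> J s -> `|Green t s| <= Green_bound_cst.
Proof.
move=> /andP[t0 tT]; rewrite /J /= in_itv /= => /andP[s0 sT].
rewrite /Green /Green_bound_cst mulr2n; apply: le_trans (ler_normB _ _) _.
rewrite !(normrM _ (ppow _ _)) !(ger0_norm (ppow_ge0 _ _)).
have [c0 c1] := Green_coef (introT andP (conj t0 tT)).
rewrite (ger0_norm c0) gtr0_norm ?invr_gt0 //.
by apply: lerD; apply: ler_pM; rewrite ?ppow_ge0 ?invr_ge0 ?(ltW G0) ?ppow_le_T.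
Qed.

Lemma Green_L1 t f : 0 <= t <= T -> L1 J f -> L1 J (fun s => Green t s *: f s).
Proof.
move=> tT; apply: (L1Z mJ (C := Green_bound_cst)); first exact: Green_meas.
by move=> s; exact: Green_bound.
Qed.

Lemma Green_opB f g t : 0 <= t <= T -> L1 J f -> L1 J g ->
  Green_op (fun s => f s - g s) t = Green_op f t - Green_op g t.
Proof.
move=> tT lf lg; rewrite /Green_op -(vintegralB mJ (Green_L1 tT lf) (Green_L1 tT lg)).
by apply: eq_vintegral => s _; rewrite scalerBr.
Qed.

Lemma Green_opD f g t : 0 <= t <= T -> L1 J f -> L1 J g ->
  Green_op (fun s => f s + g s) t = Green_op f t + Green_op g t.
Proof.
move=> tT lf lg; rewrite /Green_op -(vintegralD mJ (Green_L1 tT lf) (Green_L1 tT lg)).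
by apply: eq_vintegral => s _; rewrite scalerDr.
Qed.

Lemma Green_opZ (a : R) f t : 0 <= t <= T -> L1 J f ->
  Green_op (fun s => a *: f s) t = a *: Green_op f t.
Proof.
move=> tT lf; rewrite /Green_op -(vintegralZ mJ a (Green_L1 tT lf)).
by apply: eq_vintegral => s _; rewrite !scalerA mulrC.
Qed.

Lemma Green_opE f t : 0 <= t <= T -> L1 J f ->
  Green_op f t =
  (Gamma q)^-1 *: vintegral `[0, t] (fun s => (t - s) `^ (q - 1) *: f s)
  - (t / (Gamma q * T)) *: vintegral J (fun s => (T - s) `^ (q - 1) *: f s).
Proof.
move=> tT lf.
rewrite (vintegral_segment f tT) (vintegral_segment f (_ : 0 <= T <= T)); last first.
  by rewrite lexx ltW.
have l x : x <= T -> L1 J (fun s => ppow (q - 1) (x - s) *: f s).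
  move=> xT; apply: (L1Z mJ (C := T `^ (q - 1))) => //.
    apply: measurable_funTS; apply: continuous_measurable_fun.
    exact: ppow_shift_continuous.
  move=> s; rewrite /J /= in_itv /= => /andP[s0 _].
  by rewrite ger0_norm ?ppow_ge0 // ppow_le_T.
have tT' : t <= T by case/andP: tT.
rewrite -(vintegralZ mJ _ (l t tT')) -(vintegralZ mJ _ (l T (lexx T))).
rewrite -(vintegralB mJ (L1Zl mJ _ (l t tT')) (L1Zl mJ _ (l T (lexx T)))).
by apply: eq_vintegral => s _; rewrite !scalerA -scalerBl.
Qed.

Let integral_ppow_J t : 0 <= t <= T ->
  mu.-integrable J (EFin \o (fun s => ppow (q - 1) (t - s))) /\
  \int[mu]_(s in J) ppow (q - 1) (t - s) <= T `^ q / q.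
Proof.
move=> /andP[t0 tT].
have ig x : mu.-integrable J (EFin \o (fun s => ppow (q - 1) (x - s))).
  apply: continuous_compact_integrable; first exact: segment_compact.
  by apply: continuous_subspaceT; exact: ppow_shift_continuous.
split => //.
have -> : T `^ q / q = \int[mu]_(s in J) ppow (q - 1) (T - s).
  by rewrite /Rintegral integral_ppow.
apply: le_Rintegral => // s _; apply: ppow_le; first exact: ltW.
by lra.
Qed.

(** Origin of the factor 2 in hypothesis (9): the fractional integral and its linear correction each
    contribute at most b T^q / (q Gamma(q)), the coefficient of the correction being at most
    [(Gamma q)^-1]. *)
Lemma Green_op_bound f t b : 0 <= t <= T -> L1 J f -> 0 <= b ->
  {ae mu, forall s, J s -> enorm (f s) <= b} ->
  enorm (Green_op f t) <= 2 * (b / Gamma (q + 1)) * T `^ q.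
Proof.
move=> tT lf b0 fb; have [t0 tT'] := andP tT.
have [i1 e1] := integral_ppow_J tT.
have [|i2 e2] := integral_ppow_J (t := T); first by rewrite lexx ltW.
have c1 : 0 <= b * (Gamma q)^-1 by rewrite mulr_ge0 ?invr_ge0 ?(ltW G0).
have c2 : 0 <= b * (t / (Gamma q * T)).
  by rewrite mulr_ge0 // (Green_coef tT).1.
have j1 : mu.-integrable J
    (EFin \o (fun s => b * (Gamma q)^-1 * ppow (q - 1) (t - s))).
  by have := integrableZl mJ (b * (Gamma q)^-1) i1; apply: eq_integrable.
have j2 : mu.-integrable J
    (EFin \o (fun s => b * (t / (Gamma q * T)) * ppow (q - 1) (T - s))).
  by have := integrableZl mJ (b * (t / (Gamma q * T))) i2; apply: eq_integrable.
apply: le_trans.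
  apply: (enorm_vintegral_le mJ (w := fun s => b * (Gamma q)^-1 * ppow (q - 1) (t - s)
      + b * (t / (Gamma q * T)) * ppow (q - 1) (T - s)) (Green_L1 tT lf)).
  - exact: (integrableD mJ j1 j2).
  - by move=> s _; rewrite addr_ge0 // mulr_ge0 ?ppow_ge0.
  - apply: ae_imp fb => s h Js; rewrite enormZ mulrC -!mulrA -mulrDr.
    apply: ler_pM; rewrite ?enorm_ge0 ?normr_ge0 ?h //.
    rewrite /Green; apply: le_trans (ler_normB _ _) _.
    rewrite !(normrM _ (ppow _ _)) !(ger0_norm (ppow_ge0 _ _)).
    have [d0 d1] := Green_coef tT.
    by rewrite (ger0_norm d0) gtr0_norm ?invr_gt0 // -!mulrA.
rewrite (RintegralD mJ j1 j2) (RintegralZl _ mJ i1) (RintegralZl _ mJ i2).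
have /andP[g1 g2] := Gamma_recurrence_le q12.
have tq : 0 <= T `^ q by exact: powR_ge0.
have k1 := ler_wpM2l c1 e1; have k2 := ler_wpM2l c2 e2.
apply: le_trans (lerD k1 k2) _.
have le1 : b * (t / (Gamma q * T)) <= b * (Gamma q)^-1.
  by rewrite ler_wpM2l // (Green_coef tT).2.
apply: (@le_trans _ _ (2 * (b * (Gamma q)^-1 * (T `^ q / q)))).
  by rewrite mulr_natl mulr2n lerD2l ler_wpM2r // divr_ge0 // ltW.
rewrite -!mulrA ler_pM2l // ler_wpM2l // [leRHS]mulrC mulrCA ler_wpM2l //.
by rewrite -invfM lef_pV2 ?posrE ?mulr_gt0 // mulrC.
Qed.

(** Since [q - 1] lies in []0, 1]], the kernel is Hoelder in its first variable, uniformly in the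
    second. The modulus depends on [f] only through [b], which gives the equicontinuity of the
    solutions. *)
Lemma Green_op_modulus f s t b : 0 <= s <= T -> 0 <= t <= T -> L1 J f -> 0 <= b ->
  {ae mu, forall x, J x -> enorm (f x) <= b} ->
  enorm (Green_op f s - Green_op f t) <=
    b * ((Gamma q)^-1 * `|s - t| `^ (q - 1)
         + `|s - t| / (Gamma q * T) * T `^ (q - 1)) * T.
Proof.
move=> sT tT lf b0 fb.
set c := b * _; have c0 : 0 <= c.
  rewrite mulr_ge0 // addr_ge0 // mulr_ge0 ?powR_ge0 ?invr_ge0 ?(ltW G0) //.
  by rewrite divr_ge0 ?mulr_ge0 ?(ltW G0) ?(ltW T0).
have -> : Green_op f s - Green_op f t
    = vintegral J (fun x => (Green s x - Green t x) *: f x).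
  rewrite /Green_op -(vintegralB mJ (Green_L1 sT lf) (Green_L1 tT lf)).
  by apply: eq_vintegral => x _; rewrite [RHS]scalerBl.
have -> : c * T = \int[mu]_(x in J) (cst c x).
  rewrite (Rintegral_cst mu mJ c); congr (_ * _).
  exact: esym (congr1 fine measure_segment).
apply: (enorm_vintegral_le mJ) => //.
- have := L1B mJ (Green_L1 sT lf) (Green_L1 tT lf).
  by under eq_fun do rewrite -scalerBl.
- apply: continuous_compact_integrable; first exact: segment_compact.
  by apply: continuous_subspaceT; exact: cst_continuous.
- apply: ae_imp fb => x h Jx; rewrite enormZ mulrC /c /cst.
  apply: ler_pM; rewrite ?enorm_ge0 ?normr_ge0 ?h //.
  have -> : Green s x - Green t x = (Gamma q)^-1 *
      (ppow (q - 1) (s - x) - ppow (q - 1) (t - x))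
      - (s - t) / (Gamma q * T) * ppow (q - 1) (T - x).
    by rewrite /Green; ring.
  apply: le_trans (ler_normB _ _) _; apply: lerD.
    rewrite normrM gtr0_norm ?invr_gt0 // ler_pM2l ?invr_gt0 //.
    by apply: le_trans (ppow_Hoelder _ _ q1) _; rewrite opprB addrA subrK.
  rewrite !normrM (ger0_norm (ppow_ge0 _ _)) (gtr0_norm (_ : 0 < (Gamma q * T)^-1)); last first.
    by rewrite invr_gt0 mulr_gt0.
  apply: ler_pM => //; [|exact: ppow_ge0|].
    by rewrite mulr_ge0 ?invr_ge0 ?mulr_ge0 ?(ltW G0) ?(ltW T0).
  by apply: ppow_le_T => //; move: Jx; rewrite /J /= in_itv /= => /andP[].
Qed.

End Green_operator.

(** * Almost everywhere convergence from nearly minimal L2 norm *)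

Section Komlos.
Variables (R : realType) (n : nat).
Local Notation mu := (@lebesgue_measure R).
Variables (D : set R) (mD : measurable (D : set (measurableTypeR R))).
Hypothesis Dfin : (mu D < +oo)%E.
Implicit Types (f g h : R -> 'cV[R]_n).

Lemma geometric_increments_cvg (x : nat -> R) (c : R) :
  (forall j, `|x j.+1 - x j| <= c * 2^-1 ^+ j) -> exists l : R, x @ \oo --> l.
Proof.
move=> xc; have c0 : 0 <= c.
  by have := xc 0%N; rewrite expr0 mulr1; exact: le_trans.
have : cvgn (series (telescope x)).
  apply: normed_cvg; apply: (series_le_cvg (v_ := geometric c 2^-1)) => //.
  - by move=> j; exact: normr_ge0.
  - by move=> j; rewrite /= mulr_ge0 // exprn_ge0.
  - apply: is_cvg_geometric_series; rewrite gtr0_norm ?invr_gt0 //.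
    by rewrite invf_lt1 // ltr1n.
move=> /cvg_ex[l xl]; exists (x 0%N + l).
have E : x = (fun j => x 0%N + series (telescope x) j).
  by apply/funext => j; exact: eq_sum_telescope.
rewrite {1}E.
exact: (cvgD (cvg_cst _) xl).
Qed.

(** Used to discard a null set on which nothing is known about [f]. *)
Lemma measurable_fun_off (N : set R) (f : R -> R) :
  measurable (N : set (measurableTypeR R)) -> measurable_fun (D `\` N) f ->
  measurable_fun D (fun t => if t \in N then 0 else f t).
Proof.
move=> mN mf; have DE : D = (D `\` N) `|` (D `&` N).
  by rewrite setUC setUIDK.
have : measurable_fun ((D `\` N) `|` (D `&` N)) (fun t => if t \in N then 0 else f t).
  apply/measurable_funU; [exact: measurableD|exact: measurableI|split].
    apply: eq_measurable_fun mf => t; rewrite inE => -[_ Nt].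
    by rewrite memNset.
  have m0 : measurable_fun (D `&` N) (fun=> 0 : R) by exact: measurable_cst.
  apply: eq_measurable_fun m0 => t; rewrite inE => -[_ Nt].
  by rewrite mem_set.
by rewrite -DE.
Qed.

Let sqnorm f : R := \int[mu]_(t in D) dotp (f t) (f t).

Let bmeas M f := (forall i, measurable_fun D (fun t => f t i 0)) /\
  {ae mu, forall t, D t -> enorm (f t) <= M}.

Let dotp_meas f g : (forall i, measurable_fun D (fun t => f t i 0)) ->
  (forall i, measurable_fun D (fun t => g t i 0)) ->
  measurable_fun D (fun t => dotp (f t) (g t)).
Proof. by move=> mf mg; apply: measurable_sum => i; exact: measurable_funM. Qed.

Let dotp_int M f g : bmeas M f -> bmeas M g ->
  mu.-integrable D (EFin \o (fun t => dotp (f t) (g t))).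
Proof.
move=> [mf fM] [mg gM]; apply: (@ae_bounded_integrable _ _ mD _ (M * M)) => //.
  exact: dotp_meas.
apply: ae_imp2 fM gM => t hf hg Dt.
have [a b] := (hf Dt, hg Dt).
have h1 := dotp_le (f t) (g t).
have h2 := dotp_le (- f t) (g t); rewrite dotpNl enormN in h2.
have h3 : enorm (f t) * enorm (g t) <= M * M by rewrite ler_pM ?enorm_ge0.
by rewrite ler_norml; apply/andP; split; lra.
Qed.

Let parallelogram M f g : bmeas M f -> bmeas M g ->
  sqnorm (fun t => f t - g t) + 4 * sqnorm (fun t => 2^-1 *: (f t + g t))
  = 2 * sqnorm f + 2 * sqnorm g.
Proof.
move=> bf bg.
have iff := dotp_int bf bf; have igg := dotp_int bg bg; have ifg := dotp_int bf bg.
have lin (a b c : R) : \int[mu]_(t in D)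
    (a * dotp (f t) (f t) + b * dotp (g t) (g t) + c * dotp (f t) (g t))
    = a * sqnorm f + b * sqnorm g + c * \int[mu]_(t in D) dotp (f t) (g t).
  have Z (d : R) h1 h2 : mu.-integrable D (EFin \o (fun t => dotp (h1 t) (h2 t))) ->
      mu.-integrable D (EFin \o (fun t => d * dotp (h1 t : 'cV[R]_n) (h2 t))).
    by move=> i; have := integrableZl mD d i; apply: eq_integrable.
  rewrite (RintegralD mD (integrableD mD (Z a _ _ iff) (Z b _ _ igg)) (Z c _ _ ifg)).
  rewrite (RintegralD mD (Z a _ _ iff) (Z b _ _ igg)).
  by rewrite !(RintegralZl _ mD).
have -> : sqnorm (fun t => f t - g t)
    = 1 * sqnorm f + 1 * sqnorm g + (-2) * \int[mu]_(t in D) dotp (f t) (g t).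
  rewrite -lin; apply: eq_Rintegral => t _.
  by rewrite dotpBl !dotpBr (dotpC (g t) (f t)); ring.
have -> : sqnorm (fun t => 2^-1 *: (f t + g t))
    = 4^-1 * sqnorm f + 4^-1 * sqnorm g + 2^-1 * \int[mu]_(t in D) dotp (f t) (g t).
  rewrite -lin; apply: eq_Rintegral => t _.
  by rewrite dotpZl dotpZr dotpDl !dotpDr (dotpC (g t) (f t)); lra.
by lra.
Qed.

(* Elements of nearly minimal L2 norm form a Cauchy sequence by the parallelogram
   law; this replaces weak compactness together with Mazur's lemma. *)
Lemma midpoint_closed_ae_cvg (C : nat -> set (R -> 'cV[R]_n)) (M : R) :
  (forall j f, C j f -> (forall i, measurable_fun D (fun t => f t i 0)) /\
    {ae mu, forall t, D t -> enorm (f t) <= M}) ->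
  (forall j, C j !=set0) ->
  (forall i j, (i <= j)%N -> C j `<=` C i) ->
  (forall j f g, C j f -> C j g -> C j (fun t => 2^-1 *: (f t + g t))) ->
  exists h : nat -> R -> 'cV[R]_n, (forall j, C j (h j)) /\
  exists f : R -> 'cV[R]_n, (forall i, measurable_fun D (fun t => f t i 0)) /\
    {ae mu, forall t, D t -> forall i, (fun j => h j t i 0) @ \oo --> f t i 0}.
Proof.
move=> CM C0 Cdec Cmid.
have sq0 f : 0 <= sqnorm f.
  by apply: Rintegral_ge0 => t _; exact: dotp_ge0.
have sqM j f : C j f -> sqnorm f <= M ^+ 2 * fine (mu D).
  move=> Cf; have bf := CM j f Cf; have [mf fM] := bf.
  rewrite -(Rintegral_cst mu mD (M ^+ 2)); apply: (ae_le_Rintegral mD) => //.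
  - exact: (dotp_int bf bf).
  - apply: (@ae_bounded_integrable _ _ mD _ `|M ^+ 2|) => //.
    by apply: (@ae_imp _ setT) => [t _ _|]; [exact: lexx|exact: aeW].
  - apply: ae_imp fM => t h Dt; rewrite -sqr_enorm lerXn2r ?nnegrE ?enorm_ge0 ?h //.
    by apply: le_trans (h Dt); exact: enorm_ge0.
(* As the sets decrease, these infima increase; they are bounded, and their supremum [s] is the
   limiting minimal squared norm. *)
pose r j := inf (sqnorm @` C j).
have hi j : has_inf (sqnorm @` C j).
  split; first by have [f Cf] := C0 j; exists (sqnorm f); exists f.
  by exists 0 => _ [f _ <-].
have r_le j f : C j f -> r j <= sqnorm f.
  by move=> Cf; apply: ge_inf; [exact: (hi j).2|exists f].
have r_mono i j : (i <= j)%N -> r i <= r j.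
  move=> ij; apply: lb_le_inf; first exact: (hi j).1.
  by move=> _ [f Cf <-]; apply: r_le; exact: Cdec Cf.
have hs : has_sup (range r).
  split; first by exists (r 0%N); exists 0%N.
  exists (M ^+ 2 * fine (mu D)) => _ [j _ <-].
  by have [f Cf] := C0 j; apply: le_trans (r_le j f Cf) (sqM j f Cf).
pose s := sup (range r).
have r_s j : r j <= s by apply: ub_le_sup; [exact: hs.2|exists j].
(* Chosen so that [4 ^+ j * (8 * e j)] equals 1/2^(j+1), a summable series. *)
pose e j : R := (16 * 4 ^+ j * 2 ^+ j)^-1.
have e0 j : 0 < e j by rewrite invr_gt0 !mulr_gt0 ?exprn_gt0.
have eS j : e j.+1 <= e j.
  rewrite /e lef_pV2 ?posrE ?mulr_gt0 ?exprn_gt0 // ler_pM ?mulr_ge0 ?exprn_ge0 //.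
    by rewrite ler_wpM2l // ler_weXn2l // ler1n.
  by rewrite ler_weXn2l // ler1n.
pose near_inf j (p : nat * (R -> 'cV[R]_n)) :=
  [/\ (j <= p.1)%N, s - e j < r p.1, C p.1 p.2 & sqnorm p.2 < s + e j].
have [kh hkh] : {kh & forall j, near_inf j (kh j)}.
  apply: choice => j.
  have [_ [k _ <-] sk] := sup_adherent (e0 j) hs.
  (* Going beyond [j] puts the chosen function in [C j]. *)
  pose k' := maxn k j.
  have sk' : s - e j < r k' by apply: lt_le_trans sk (r_mono _ _ (leq_maxl _ _)).
  have [_ [f Cf <-] fr] := inf_adherent (e0 j) (hi k').
  exists (k', f); split => //=; first exact: leq_maxr.
  by apply: lt_le_trans fr _; rewrite lerD2r; exact: r_s.
pose k j := (kh j).1; pose h j := (kh j).2.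
have Chj j : C j (h j) by have [jk _ Ck _] := hkh j; exact: Cdec jk _ Ck.
(* The midpoint lies in the larger of the two sets, so its squared norm still exceeds [s - e j]; the
   parallelogram law then bounds the difference by [2 * (s + e j) + 2 * (s + e j.+1) - 4 * (s - e
   j)]. *)
have diff_small j : sqnorm (fun t => h j t - h j.+1 t) <= 8 * e j.
  have [_ rk1 C1 s1] := hkh j; have [_ rk2 C2 s2] := hkh j.+1.
  rewrite -/(k _) -/(h _) in rk1 C1 s1; rewrite -/(k _) -/(h _) in rk2 C2 s2.
  pose k' := minn (k j) (k j.+1).
  have C1' : C k' (h j) by exact: Cdec (geq_minl _ _) _ C1.
  have C2' : C k' (h j.+1) by exact: Cdec (geq_minr _ _) _ C2.
  have := r_le _ _ (Cmid _ _ _ C1' C2').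
  have sk' : s - e j < r k'.
    rewrite /k' /minn; case: ifP => // _.
    by apply: le_lt_trans rk2; rewrite lerB.
  have := parallelogram (CM _ _ C1') (CM _ _ C2').
  by have := eS j; lra.
(* The weights [4 ^+ j] make finiteness of the sum at [t] force increments of order 2^(-j), hence
   convergence of the sequence at [t] itself, without passing to a subsequence. *)
pose Delta j t : \bar R :=
  (4 ^+ j * dotp (h j t - h j.+1 t) (h j t - h j.+1 t))%:E.
have Delta0 j t : (0 <= Delta j t)%E.
  by rewrite lee_fin mulr_ge0 ?exprn_ge0 ?dotp_ge0.
have mDelta j : measurable_fun D (Delta j).
  apply/measurable_EFinP; apply: measurable_funM => //.
  have md i : measurable_fun D (fun t => (h j t - h j.+1 t) i 0).
    under eq_fun do rewrite !mxE.
    by apply: measurable_funB; apply: (CM _ _ (Chj _)).1.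
  exact: dotp_meas.
have iDelta : mu.-integrable D (fun t => \sum_(j <oo) Delta j t)%E.
  apply/integrableP; split.
    by apply: (@ge0_emeasurable_sum _ _ _ D Delta xpredT) => [j t _ _|j _].
  under eq_integral do rewrite gee0_abs ?nneseries_ge0 //.
  rewrite integral_nneseries //.
  apply: (@le_lt_trans _ _ (\sum_(j <oo) (1 / (2 ^ j.+1)%:R)%:E)%E); last first.
    by apply: le_lt_trans (epsilon_trick0 xpredT ler01) (ltry _).
  apply: lee_nneseries => [j _ _|j _]; first by apply: integral_ge0 => t _; exact: Delta0.
  have b2 : bmeas (M + M) (fun t => h j t - h j.+1 t).
    have [m1 M1] := CM _ _ (Chj j); have [m2 M2] := CM _ _ (Chj j.+1); split.
      by move=> i; under eq_fun do rewrite !mxE; exact: measurable_funB.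
    apply: ae_imp2 M1 M2 => t q1 q2 Dt; apply: le_trans (enormD _ _) _.
    by rewrite enormN lerD ?q1 ?q2.
  have i2 := dotp_int b2 b2.
  rewrite /Delta; under eq_integral do rewrite EFinM.
  rewrite integralZl // -(fineK (integrable_fin_num mD i2)) -EFinM lee_fin.
  apply: (@le_trans _ _ (4 ^+ j * (8 * e j))).
    by rewrite ler_wpM2l ?exprn_ge0 // diff_small.
  rewrite /e natrX exprS div1r le_eqVlt; apply/orP; left; apply/eqP.
  by field; rewrite !expf_neq0.
have cvg_ae : {ae mu, forall t, D t -> forall i, exists l : R,
    (fun j => h j t i 0) @ \oo --> l}.
  have := integrable_ae mD iDelta; apply: ae_imp => t fin Dt i.
  pose c := fine (\sum_(j <oo) Delta j t)%E.
  apply: (@geometric_increments_cvg _ (Num.sqrt c)) => j.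
  have : (Delta j t <= c%:E)%E.
    rewrite fineK; last exact: fin.
    rewrite (nneseries_split 0 j.+1) //= add0n.
    rewrite big_nat_recr //= -addeA addeC -addeA leeDl //.
    by rewrite adde_ge0 ?nneseries_ge0 // sume_ge0.
  rewrite lee_fin -sqr_enorm => hc.
  have hc' : (2 ^+ j * enorm (h j t - h j.+1 t)) ^+ 2 <= c.
    by rewrite exprMn -exprM mulnC exprM (_ : 2 ^+ 2 = 4 :> R) //; ring.
  have : 2 ^+ j * enorm (h j t - h j.+1 t) <= Num.sqrt c.
    have := ler_wsqrtr hc'; rewrite sqrtr_sqr ger0_norm //.
    by rewrite mulr_ge0 ?exprn_ge0 ?enorm_ge0.
  rewrite exprVn => hd; rewrite ler_pdivlMr ?exprn_gt0 // mulrC.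
  apply: le_trans hd; rewrite ler_wpM2l ?exprn_ge0 // enormB.
  have -> : h j.+1 t i 0 - h j t i 0 = (h j.+1 t - h j t) i 0 by rewrite !mxE.
  exact: coord_le_enorm.
have [N [mN N0 subN]] := cvg_ae.
have good t : (D `\` N) t -> forall i, exists l : R, (fun j => h j t i 0) @ \oo --> l.
  move=> [Dt Nt]; apply: contrapT => bad; apply: Nt; apply: subN => /=.
  by move=> H; apply: bad; exact: H.
pose lim_h t i : R := lim ((fun j => h j t i 0) @ \oo).
have lim_hP t i : (D `\` N) t -> (fun j => h j t i 0) @ \oo --> lim_h t i.
  by move=> /good/(_ i)[l hl]; rewrite /lim_h (cvg_lim _ hl).
exists h; split => //.
exists (fun t => if t \in N then 0 else \col_i lim_h t i); split.
  move=> i.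
  have -> : (fun t => (if t \in N then 0 else \col_i lim_h t i) i 0) =
      (fun t => if t \in N then 0 else lim_h t i).
    by apply/funext => t; case: ifP => _; rewrite mxE.
  apply: measurable_fun_off => //.
  apply: (@measurable_fun_cvg _ _ _ _ (fun j t => h j t i 0)).
    by move=> j; apply: measurable_funS mD (@subDsetl _ _ _) ((CM _ _ (Chj j)).1 i).
  by move=> t; exact: lim_hP.
exists N; split => // t bad; apply: contrapT => Nt; apply: bad => Dt i.
by rewrite memNset // mxE; exact: lim_hP.
Qed.

End Komlos.

(** * Nearest-point projection onto a compact convex set *)

Definition convex_proj (R : realType) (n : nat) (A : set 'cV[R]_n)
    (x : 'cV[R]_n) :=
  xget 0 (SOL_VI A (fun u => u - x)).

Section convex_projection.
Variables (R : realType) (n : nat).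
Implicit Types (A B : set 'cV[R]_n) (x y v : 'cV[R]_n).

Definition dist A x := enorm (x - convex_proj A x).

Definition convex_body A := [/\ A !=set0, compact A & convex_subset A].

(** Describing the nearest point by the inequality of the monotone map [u - x] makes its existence
    an instance of [monotone_VI_exists] and its nonexpansiveness one of [VI_Lipschitz]. *)
Lemma projP A x : convex_body A -> SOL_VI A (fun u => u - x) (convex_proj A x).
Proof.
move=> [A0 cA xA]; apply: xgetPex; apply: monotone_VI_exists => //.
  by move=> u; apply: continuousB => //; exact: cst_continuous.
by move=> u v; rewrite opprB addrA subrK dotp_ge0.
Qed.

Lemma proj_in A x : convex_body A -> A (convex_proj A x).
Proof. by move=> /(projP x)[]. Qed.

Lemma proj_le A x v : convex_body A -> A v -> dist A x <= enorm (x - v).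
Proof.
move=> bA Av; have [_ /(_ v Av)] := projP x bA.
set p := convex_proj A x => h; rewrite /dist -/p.
rewrite -(@ler_pXn2r _ 2) ?nnegrE ?enorm_ge0 //.
have -> : x - v = (x - p) - (v - p) by rewrite opprB addrA subrK.
rewrite [leRHS]sqr_enormB -addrA lerDl addr_ge0 ?sqr_ge0 //.
by move: h; rewrite -(opprB x p) dotpNl !oppr_ge0 pmulr_rle0.
Qed.

Lemma proj_nonexpansive A x y : convex_body A ->
  enorm (convex_proj A x - convex_proj A y) <= enorm (x - y).
Proof.
move=> bA; rewrite -[leRHS]divr1.
apply: (VI_Lipschitz ltr01 _ _ (projP x bA) (projP y bA)).
  by move=> u v; rewrite mul1r opprB addrA subrK sqr_enorm.
by move=> u; rewrite opprB addrC addrA subrK enormB.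
Qed.

Lemma dist_Lipschitz A x y : convex_body A -> dist A x <= dist A y + enorm (x - y).
Proof.
move=> bA; apply: le_trans (proj_le x bA (proj_in y bA)) _.
by rewrite [leRHS]addrC; exact: enormD3.
Qed.

Lemma dist_ltP A x (r : R) : convex_body A ->
  dist A x < r <-> exists2 a, A a & enorm (a - x) < r.
Proof.
move=> bA; split=> [h|[a Aa]]; last by rewrite enormB; apply: le_lt_trans; exact: proj_le.
by exists (convex_proj A x); [exact: proj_in|rewrite enormB].
Qed.

Lemma dist_excess A B x (c : R) : convex_body A -> convex_body B ->
  (forall a, A a -> exists2 b, B b & enorm (a - b) <= c) ->
  dist B x <= dist A x + c.
Proof.
move=> bA bB AB; have [b Bb ab] := AB _ (proj_in x bA).
by apply: le_trans (proj_le x bB Bb) _; apply: le_trans (enormD3 _ (convex_proj A x) _) _; rewrite lerD2l.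
Qed.

(* The projection is the gradient of half the squared distance to A, subtracted
   from the identity. *)
Lemma sqr_dist_expansion A x v : convex_body A ->
  `|dist A (x + v) ^+ 2 - dist A x ^+ 2 - 2 * dotp (x - convex_proj A x) v|
    <= enorm v ^+ 2.
Proof.
move=> bA; set p := convex_proj A x; pose p' := convex_proj A (x + v).
(* Each projection is used as a competitor for the other point; the two resulting bounds differ by
   [dotp (p' - p) v], which nonexpansiveness controls. *)
have le1 : dist A (x + v) ^+ 2 <= enorm (x - p) ^+ 2 + 2 * dotp (x - p) v + enorm v ^+ 2.
  rewrite -sqr_enormD (addrAC x (- p) v) lerXn2r ?nnegrE ?enorm_ge0 //.
  exact: (proj_le (x + v) bA (proj_in x bA)).
have le2 : dist A x ^+ 2 <= enorm (x + v - p') ^+ 2 - 2 * dotp (x + v - p') v + enorm v ^+ 2.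
  rewrite -sqr_enormB (addrAC x v) addrK lerXn2r ?nnegrE ?enorm_ge0 //.
  exact: (proj_le x bA (proj_in (x + v) bA)).
have le3 : dotp (p' - p) v <= enorm v ^+ 2.
  apply: le_trans (dotp_le _ _) _; rewrite expr2 ler_wpM2r ?enorm_ge0 //.
  apply: le_trans (proj_nonexpansive (x + v) x bA) _.
  by rewrite addrAC subrr add0r.
have E3 : dotp (x + v - p') v = dotp (x - p) v - dotp (p' - p) v + enorm v ^+ 2.
  rewrite sqr_enorm -dotpBl -dotpDl.
  by congr dotp; rewrite opprB addrA subrK addrAC.
have arith (a b c d e : R) : b <= a + 2 * c + e -> a <= b - 2 * (c - d + e) + e ->
    d <= e -> `|b - a - 2 * c| <= e.
  by move=> ? ? ?; rewrite ler_norml; apply/andP; split; lra.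
by apply: arith le1 _ le3; rewrite -E3.
Qed.

End convex_projection.

(** * Measurability of a Lipschitz integrand along measurable functions *)

Section rational_points.
Variables (R : realType) (n : nat).

Definition ratrv (z : 'cV[rat]_n) : 'cV[R]_n := \col_i ratr (z i 0).

Lemma ratrv_dense (x : 'cV[R]_n) (e : R) : 0 < e ->
  exists z : 'cV[rat]_n, enorm (x - ratrv z) < e.
Proof.
move=> e0; have e1 : 0 < e / (n%:R + 1) by rewrite divr_gt0 // ltr_wpDl.
have h i : {r : rat | `|x i 0 - ratr r| < e / (n%:R + 1)}.
  apply: cid; have [|r] := @rat_in_itvoo R (x i 0 - e / (n%:R + 1)) (x i 0).
    by rewrite ltrBlDr ltrDl.
  rewrite in_itv /= => /andP[r1 r2]; exists r.
  by rewrite gtr0_norm ?subr_gt0 //; lra.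
exists (\col_i sval (h i)).
apply: le_lt_trans (enorm_le_mx_norm _) _.
have le : `|x - ratrv (\col_i sval (h i))| <= e / (n%:R + 1).
  rewrite [leLHS]mx_normrE; apply/bigmax_leP; split; first exact: ltW.
  by move=> [i j] _; rewrite /= ord1 !mxE ltW // (svalP (h i)).
apply: le_lt_trans (ler_wpM2l (ler0n R n) le) _.
rewrite mulrCA -[ltRHS]mulr1 ltr_pM2l // ltr_pdivrMr ?ltr_wpDl // mul1r.
by rewrite ltrDl.
Qed.

End rational_points.

Section Caratheodory.
Variables (R : realType) (n : nat) (E : set R).
Hypothesis mE : measurable (E : set (measurableTypeR R)).
Variables (phi : R -> 'cV[R]_n -> 'cV[R]_n -> R) (L : R).
Hypothesis L0 : 0 < L.
Hypothesis phiL : forall t z x z' x', E t ->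
  phi t z x <= phi t z' x' + L * (enorm (z - z') + enorm (x - x')).
Hypothesis mphi : forall (z x : 'cV[rat]_n) (r : rat),
  measurable (E `&` [set t | phi t (ratrv R z) (ratrv R x) < ratr r]
    : set (measurableTypeR R)).

Lemma measurable_enorm_ball (y : R -> 'cV[R]_n) z (r : R) :
  (forall i, measurable_fun E (fun t => y t i 0)) ->
  measurable (E `&` [set t | enorm (y t - z) < r] : set (measurableTypeR R)).
Proof.
move=> my.
have m : measurable_fun E (fun t => enorm (y t - z)).
  apply: (@measurableT_comp _ _ _ _ _ _ (@Num.sqrt R)).
    by apply: continuous_measurable_fun; exact: sqrt_continuous.
  apply: measurable_sum => i; under eq_fun do rewrite !mxE.
  by apply: measurable_funM; apply: measurable_funB => //; exact: measurable_cst.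
have := m mE `]-oo, r[%classic (measurable_itv _).
by congr measurable; apply/seteqP; split=> t /=; rewrite in_itv.
Qed.

(** A sublevel set is a countable union over rational centres [z], [x], a radius [rho] and a
    threshold [r]. The condition [P] absorbs the Lipschitz error [2 * L * rho] of replacing the
    arguments by the centres. *)
Lemma Caratheodory_measurable (y h : R -> 'cV[R]_n) :
  (forall i, measurable_fun E (fun t => y t i 0)) ->
  (forall i, measurable_fun E (fun t => h t i 0)) ->
  measurable_fun E (fun t => phi t (y t) (h t)).
Proof.
move=> my mh _; apply: (measurability _ (RGenInftyO.measurableE R)) => //.
move=> _ [_ [c ->] <-].
pose I := ('cV[rat]_n * 'cV[rat]_n * rat * rat)%type.
pose P (p : I) := let: (z, x, rho, r) := p in ratr r + 2 * L * ratr rho <= c.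
pose W (p : I) := let: (z, x, rho, r) := p in
  (E `&` [set t | enorm (y t - ratrv R z) < ratr rho]) `&`
  (E `&` [set t | enorm (h t - ratrv R x) < ratr rho]) `&`
  (E `&` [set t | phi t (ratrv R z) (ratrv R x) < ratr r]).
have -> : E `&` (fun t => phi t (y t) (h t)) @^-1` `]-oo, c[ =
    \bigcup_(p : I) (if `[< P p >] then W p else set0).
  apply/seteqP; split=> [t [Et /=]|t [[[[z x] rho] r] _]].
    rewrite in_itv /= => phic.
    (* With [rho < d] the two errors together take less than half of the gap below [c], which leaves
       room for the rational threshold [r]. *)
    pose d := (c - phi t (y t) (h t)) / (8 * L).
    have d0 : 0 < d by rewrite divr_gt0 ?subr_gt0 ?mulr_gt0.
    have [rho] := rat_in_itvoo d0; rewrite in_itv /= => /andP[rho0 rhod].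
    have [z hz] := ratrv_dense (y t) rho0; have [x hx] := ratrv_dense (h t) rho0.
    have Ld : 8 * (L * d) = c - phi t (y t) (h t).
      by rewrite /d; field; rewrite gt_eqF.
    have Lrho : L * ratr rho < L * d by rewrite ltr_pM2l.
    have [r] : exists r : rat, ratr r \in
        `]phi t (y t) (h t) + 2 * L * ratr rho, c - 2 * L * ratr rho[.
      by apply: rat_in_itvoo; lra.
    rewrite in_itv /= => /andP[r1 r2].
    exists (z, x, rho, r) => //; rewrite asboolT; last by rewrite /P; lra.
    split; [split; split => //|split => //=].
    apply: le_lt_trans r1; apply: le_trans (phiL (ratrv R z) (ratrv R x) (y t) (h t) Et) _.
    rewrite lerD2l -mulrA mulrCA ler_pM2l // mulr_natl mulr2n.
    by rewrite (enormB _ (y t)) (enormB _ (h t)) lerD // ltW.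
  case: asboolP => // Pp [[[Et /= hy] [_ /= hh]] [_ /= hr]]; split => //=.
  rewrite in_itv /=; apply: lt_le_trans Pp.
  apply: le_lt_trans (phiL (y t) (h t) (ratrv R z) (ratrv R x) Et) _.
  apply: ltr_leD => //; rewrite -mulrA mulrCA ler_pM2l // mulr_natl mulr2n.
  by rewrite lerD // ltW.
apply: countable_bigcupT_measurable; first exact: countableP.
move=> [[[z x] rho] r]; case: ifP => _; last exact: measurable0.
apply: measurableI; last exact: mphi.
by apply: measurableI; exact: measurable_enorm_ball.
Qed.

End Caratheodory.

(** * Level sets of fuzzy mappings and their measurable selections *)

Section fuzzy_levels.
Variables (R : realType) (n : nat).
Implicit Types (w : fuzzy R n) (a : R).

Lemma level_sub0 w a : 0 <= a <= 1 -> level w a `<=` level w 0.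
Proof.
move=> /andP[a0 a1] x; rewrite /level eqxx; case: eqP => [//|/eqP an] wx.
apply: subset_closure; exists a => //=.
by rewrite in_itv /= a1 andbT lt_def an.
Qed.

Lemma level_body w a : 0 <= a <= 1 -> convex_body (level w a).
Proof.
move=> a01; have /andP[a0 a1] := a01; split; last 2 first.
- exact: fuzzy_compact.
- have cvx b x x' l : 0 <= l <= 1 -> b <= w x -> b <= w x' ->
      b <= w (l *: x + (1 - l) *: x').
    move=> l01 bx bx'; apply: le_trans (@fuzzy_convex _ _ w l x x' l01).
    by rewrite le_min bx.
  move=> l x x' l01; rewrite /level; case: eqP => _; last exact: cvx.
  move=> cx cx'; apply: closed_enorm_lim; first exact: closed_closure.
  move=> e e0; have e2 : 0 < e / 2 by rewrite divr_gt0.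
  (* The two approximating points may come from different levels; both lie in the level of the
     smaller value, which is convex. *)
  have [u [[b /= b01 bu] ux]] := cx _ (near_enorm x e2).
  have [u' [[b' /= b01' bu'] ux']] := cx' _ (near_enorm x' e2).
  exists (l *: u + (1 - l) *: u').
    apply: subset_closure; exists (Num.min b b').
      move: b01 b01'; rewrite /= !in_itv /= => /andP[b0 b1] /andP[b0' b1'].
      by rewrite lt_min b0 b0' ge_min b1.
    by apply: cvx => //; rewrite ge_min ?bu ?bu' ?orbT.
  have -> : l *: u + (1 - l) *: u' - (l *: x + (1 - l) *: x') =
      l *: (u - x) + (1 - l) *: (u' - x').
    by rewrite !scalerBr opprD addrACA.
  have /andP[l0 l1] := l01.
  apply: le_lt_trans (enormD _ _) _; rewrite !enormZ !ger0_norm ?subr_ge0 //.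
  have h1 := ler_wpM2l l0 (ltW ux).
  have h2 : (1 - l) * enorm (u' - x') <= (1 - l) * (e / 2).
    by rewrite ler_wpM2l ?subr_ge0 // ltW.
  by lra.
- have [x wx] := fuzzy_normal w; exists x; rewrite /level; case: eqP => _.
    by apply: subset_closure; exists 1; rewrite /= ?wx // in_itv /= ltr01 lexx.
  by rewrite /= wx.
Qed.

(** The infimum in the Hausdorff distance is attained, at the projection, so that no extra epsilon
    appears. *)
Lemma fuzzy_dist_excess w1 w2 a c x : 0 <= a <= 1 ->
  (fuzzy_dist w1 w2 <= c%:E)%E -> level w1 a x ->
  exists2 y, level w2 a y & enorm (x - y) <= c.
Proof.
move=> a01 dc lx.
have : (set_dist x (level w2 a) <= c%:E)%E.
  apply: le_trans dc; apply: (@le_trans _ _ (hausdorff_dist (level w1 a) (level w2 a))).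
    rewrite /hausdorff_dist le_max; apply/orP; left.
    by apply: ereal_sup_ubound; exists x.
  by apply: ereal_sup_ubound; exists a => //=; rewrite in_itv.
have b2 := level_body w2 a01.
move=> h; exists (convex_proj (level w2 a) x); first exact: proj_in.
rewrite -lee_fin; apply: le_trans h.
apply: le_ereal_inf_tmp => _ [y ly <-]; rewrite lee_fin.
exact: proj_le.
Qed.

End fuzzy_levels.

Lemma contJ_coord_continuous (R : realType) (T : R) k (y : contJ T k) i :
  {within `[0, T], continuous (fun t => y t i 0)}.
Proof.
move=> t; apply: (@continuous_comp _ _ _ (y : subspace `[0, T] -> _)
  (fun v : 'cV[R]_k => v i 0)); first exact: contJ_cts.
exact: coord_continuous.
Qed.

Section fuzzy_mapping.
Variables (R : realType) (n : nat) (T alpha LF : R) (F : R -> 'cV[R]_n -> fuzzy R n).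
Local Notation mu := (@lebesgue_measure R).
Hypotheses (halpha : 0 <= alpha <= 1) (LF0 : 0 < LF).
Hypothesis FL : forall (t : R) z1 z2, t \in `[0, T] ->
  (fuzzy_dist (F t z1) (F t z2) <= (LF * enorm (z1 - z2))%:E)%E.

Lemma level_Lipschitz t z1 z2 x : t \in `[0, T] -> level (F t z1) alpha x ->
  exists2 y, level (F t z2) alpha y & enorm (x - y) <= LF * enorm (z1 - z2).
Proof. by move=> tJ; apply: fuzzy_dist_excess; [exact: halpha|exact: FL]. Qed.

(** In (3) the exceptional null set depends on [z]. Countably many rational points share one null
    set, and every [z] is within 1 of such a point, so the Lipschitz condition adds at most [LF] to
    the bound. *)
Lemma level_ae_bounded (p : R -> R) : Linfty_nonneg `[0, T] p ->
  (forall z, {ae mu, forall t, t \in `[0, T] -> (fuzzy_norm (F t z) <= (p t)%:E)%E}) ->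
  exists2 M : R, 0 <= M & {ae mu, forall t, t \in `[0, T] ->
    forall z x, level (F t z) alpha x -> enorm x <= M}.
Proof.
move=> [_ [M pM]] Fp; exists (`|M| + LF); first by rewrite addr_ge0 ?(ltW LF0).
have := ae_all_count (fun z : 'cV[rat]_n => Fp (ratrv R z)).
apply: ae_imp2 pM => t pM Fp' tJ z x lx.
have [z' zz'] := ratrv_dense z ltr01.
have [y ly xy] := level_Lipschitz (ratrv R z') tJ lx.
have yM : enorm y <= `|M|.
  rewrite -lee_fin; apply: (@le_trans _ _ (p t)%:E).
    apply: le_trans (Fp' z' tJ); apply: ereal_sup_ubound; exists y => //.
    exact: level_sub0 ly.
  have /andP[_ ptM] : 0 <= p t <= M by exact: pM.
  by rewrite lee_fin (le_trans ptM) // ler_norm.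
have := enormD3 x y 0; rewrite !subr0 => h; apply: le_trans h _.
rewrite addrC lerD //; apply: le_trans xy _.
by rewrite -[leRHS]mulr1 ler_pM2l // ltW.
Qed.

Let G t z := level (F t z) alpha.

Let body t z : convex_body (G t z). Proof. exact: level_body. Qed.

Hypothesis Fmeas : forall z, strongly_measurable `[0, T] (fun t => F t z).

Lemma Lebesgue_measurable_ae_Borel (A : set R) : Lebesgue_measurable A ->
  exists2 B : set R, measurable (B : set (measurableTypeR R)) &
    {ae mu, forall t, A t <-> B t}.
Proof.
rewrite /Lebesgue_measurable g_sigma_completed_algebra_genE.
move=> [B mB [N [N' [mN' N'0 NN']]]] <-; exists B => //.
exists N'; split => // t /= h; apply: NN'; apply: contrapT => Nt; apply: h.
by split; [case|left].
Qed.

(** A level meets the open ball of radius [r] about [x] exactly when its distance to [x] is below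
    [r]. Only countably many such sets occur at rational data, so one null set makes all of them
    Borel. *)
Lemma dist_level_ae_Borel : exists2 N : set R,
  measurable (N : set (measurableTypeR R)) /\ mu N = 0%E &
  forall (z x : 'cV[rat]_n) (r : rat), measurable ((`[0, T] `\` N) `&`
    [set t | dist (G t (ratrv R z)) (ratrv R x) < ratr r] : set (measurableTypeR R)).
Proof.
pose I := ('cV[rat]_n * 'cV[rat]_n * rat)%type.
pose A (p : I) := [set t : R | t \in `[0, T] /\
  dist (G t (ratrv R p.1.1)) (ratrv R p.1.2) < ratr p.2].
have mA p : Lebesgue_measurable (A p).
  have := @Fmeas (ratrv R p.1.1) alpha halpha _ (@open_enorm_ball _ _ (ratrv R p.1.2) (ratr p.2)).
  congr Lebesgue_measurable; apply/seteqP; split=> t /= [tJ].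
    move=> [a [Ga ar]]; split => //; apply/dist_ltP; first exact: body.
    by exists a.
  move=> /dist_ltP => /(_ (body _ _))[a Ga ar]; split => //.
  by exists a.
have /choice[B hB] : forall p, exists B : set R,
    measurable (B : set (measurableTypeR R)) /\ {ae mu, forall t, A p t <-> B t}.
  by move=> p; have [B mB h] := Lebesgue_measurable_ae_Borel (mA p); exists B.
have [N [mN N0 subN]] := ae_all_count (fun p => (hB p).2).
exists N => // z x r.
have -> : (`[0, T] `\` N) `&` [set t | dist (G t (ratrv R z)) (ratrv R x) < ratr r]
    = (`[0, T] `\` N) `&` B (z, x, r).
  apply/seteqP; split=> t [[tJ Nt] h]; split => //.
    have E : forall p, A p t <-> B p t.
      by apply: contrapT => bad; apply: Nt; exact: subN.
    by apply/(E (z, x, r)); split.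
  have E : forall p, A p t <-> B p t.
    by apply: contrapT => bad; apply: Nt; exact: subN.
  by have [] := (E (z, x, r)).2 h.
apply: measurableI; last exact: (hB _).1.
by apply: measurableD => //; exact: measurable_itv.
Qed.

Let dist_level_Lipschitz t z x z' x' : t \in `[0, T] ->
  dist (G t z) x <= dist (G t z') x' + (LF + 1) * (enorm (z - z') + enorm (x - x')).
Proof.
move=> tJ.
have arith (a b d1 d2 d3 : R) : d1 <= d2 + LF * a -> d2 <= d3 + b -> 0 <= a ->
    0 <= LF * b -> d1 <= d3 + (LF + 1) * (a + b) by lra.
have h1 : dist (G t z) x <= dist (G t z') x + LF * enorm (z - z').
  apply: dist_excess; [exact: body|exact: body|move=> a /(level_Lipschitz z tJ)].
  by move=> [b Gb ab]; exists b => //; rewrite (enormB z).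
have h2 := dist_Lipschitz x x' (body t z').
exact: arith h1 h2 (enorm_ge0 _) (mulr_ge0 (ltW LF0) (enorm_ge0 _)).
Qed.

(* The projections of [h t] on the levels are measurable as limits of difference
   quotients of the squared distance. *)
Lemma measurable_level_projection (y : contJ T n) (h : R -> 'cV[R]_n) :
  (forall i, measurable_fun `[0, T] (fun t => h t i 0)) ->
  exists f : R -> 'cV[R]_n, (forall i, measurable_fun `[0, T] (fun t => f t i 0)) /\
    {ae mu, forall t, t \in `[0, T] -> level (F t (y t)) alpha (f t) /\
      forall a, level (F t (y t)) alpha a -> enorm (f t - h t) <= enorm (a - h t)}.
Proof.
move=> mh; have [N [mN N0] mdist] := dist_level_ae_Borel.
have mJ : measurable (`[0, T] : set (measurableTypeR R)) by exact: measurable_itv.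
pose E := `[0, T] `\` N : set R.
have mE : measurable (E : set (measurableTypeR R)) by exact: measurableD.
have my i : measurable_fun E (fun t => y t i 0).
  apply: (measurable_funS mJ (@subDsetl _ _ _)).
  apply: subspace_continuous_measurable_fun => //.
  exact: contJ_coord_continuous.
have {}mh i : measurable_fun E (fun t => h t i 0).
  exact: measurable_funS mJ (@subDsetl _ _ _) (mh i).
have md (k : R -> 'cV[R]_n) : (forall i, measurable_fun E (fun t => k t i 0)) ->
    measurable_fun E (fun t => dist (G t (y t)) (k t)).
  move=> mk; apply: (@Caratheodory_measurable R n E mE (fun t z x => dist (G t z) x) (LF + 1)) => //.
    by rewrite addr_gt0.
  by move=> t z x z' x' [tJ _]; exact: dist_level_Lipschitz.
exists (fun t => if t \in N then 0 else convex_proj (G t (y t)) (h t)); split.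
  move=> i.
  have -> : (fun t => (if t \in N then 0 else convex_proj (G t (y t)) (h t)) i 0) =
      (fun t => if t \in N then 0 else convex_proj (G t (y t)) (h t) i 0).
    by apply/funext => t; case: ifP => _; rewrite ?mxE.
  apply: measurable_fun_off => //.
  pose s j : R := j.+1%:R^-1.
  have s0 j : 0 < s j by rewrite invr_gt0 ltr0n.
  pose v j : 'cV[R]_n := s j *: delta_mx i 0.
  (* Coordinate [i] of the projection is that of [h t] minus half the partial derivative of the
     squared distance; by [sqr_dist_expansion] this difference quotient errs by at most
     [s j / 2]. *)
  pose quot j t := h t i 0 - 2^-1 * (s j)^-1 *
    (dist (G t (y t)) (h t + v j) ^+ 2 - dist (G t (y t)) (h t) ^+ 2).
  have dv (u : 'cV[R]_n) j : dotp u (v j) = s j * u i 0.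
    rewrite dotpZr /dotp (bigD1 i) //= !mxE !eqxx mulr1 big1 ?addr0 // => k ki.
    by rewrite mxE (negbTE ki) mulr0.
  have arith (a b d1 d2 e : R) : e != 0 -> a - (b - 2^-1 * e^-1 * (d1 - d2)) =
      2^-1 * e^-1 * (d1 - d2 - 2 * (e * (b - a))).
    by move=> e0; field.
  have sqv j : enorm (v j) ^+ 2 = s j ^+ 2.
    by rewrite sqr_enorm dv mxE mxE !eqxx mulr1 expr2.
  apply: (@measurable_fun_cvg _ _ _ _ quot).
    move=> j; apply: measurable_funB => //; apply: measurable_funM => //.
    by apply: measurable_funB; apply: measurable_funX; apply: md => // l;
      under eq_fun do rewrite mxE; exact: measurable_funD.
  move=> t Et; apply/cvgrPdist_le => e e0.
  near=> j.
  have := sqr_dist_expansion (h t) (v j) (body t (y t)).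
  rewrite dv sqv !mxE => hexp.
  have -> : convex_proj (G t (y t)) (h t) i 0 - quot j t = 2^-1 * (s j)^-1 *
      (dist (G t (y t)) (h t + v j) ^+ 2 - dist (G t (y t)) (h t) ^+ 2
      - 2 * (s j * (h t i 0 - convex_proj (G t (y t)) (h t) i 0))).
    by apply: arith; rewrite gt_eqF.
  rewrite normrM gtr0_norm ?mulr_gt0 ?invr_gt0 //.
  apply: le_trans (ler_wpM2l _ hexp) _.
    by rewrite mulr_ge0 ?invr_ge0 // ltW.
  have -> : 2^-1 * (s j)^-1 * s j ^+ 2 = 2^-1 * s j by field; rewrite gt_eqF.
  have : s j < e by near: j; exact: near_infty_natSinv_lt (PosNum e0).
  by have := s0 j; lra.
exists N; split => // t bad; apply: contrapT => Nt; apply: bad => tJ.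
rewrite memNset //; split; first exact: proj_in.
by move=> a Ga; rewrite enormB (enormB a); exact: proj_le.
Unshelve. all: by end_near. Qed.

End fuzzy_mapping.

(** * Continuous superposition and passage to the limit in the Green operator *)

Section continuous_composition.
Variables (R : realType) (T : R).
Local Notation mu := (@lebesgue_measure R).

Lemma within_comp_contJ n (V : topologicalType) (phi : R -> 'cV[R]_n -> V)
    (y : contJ T n) :
  {within `[0, T] `*` setT, continuous (fun tz : R * 'cV[R]_n => phi tz.1 tz.2)} ->
  {within `[0, T], continuous (fun s => phi s (y s))}.
Proof.
move=> /subspace_continuousP cphi.
have /subspace_continuousP cy := @contJ_cts _ _ _ y.
apply/subspace_continuousP => t tJ U Uphi.
have [[A B] /= [At By] AB] := cphi (t, y t) (conj tJ I) U Uphi.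
have hB := cy t tJ B By.
apply: filterS2 At hB => s As Bs sJ.
exact: (AB (s, y s) (conj As (Bs sJ)) (conj sJ I)).
Qed.

Lemma within_continuous_L1 n (f : R -> 'cV[R]_n) :
  (forall i, {within `[0, T], continuous (fun t => f t i 0)}) -> L1 `[0, T] f.
Proof.
move=> cf i; apply: continuous_compact_integrable; first exact: segment_compact.
exact: cf.
Qed.

Lemma within_continuous_coord n (f : R -> 'cV[R]_n) i :
  {within `[0, T], continuous f} -> {within `[0, T], continuous (fun t => f t i 0)}.
Proof.
move=> cf t; apply: (@continuous_comp _ _ _ (f : subspace `[0, T] -> _)
  (fun v : 'cV[R]_n => v i 0)); first exact: cf.
exact: coord_continuous.
Qed.

Lemma mulmx_L1 n m (A : R -> 'M[R]_(n, m)) (u : contJ T m) :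
  {within `[0, T], continuous A} -> L1 `[0, T] (fun s => A s *m u s).
Proof.
move=> cA; apply: within_continuous_L1 => i.
have -> : (fun t => (A t *m u t) i 0) = (fun t => \sum_j A t i j * u t j 0).
  by apply/funext => t; rewrite mxE.
move=> t; apply: (@continuous_sum_for _ (subspace `[0, T])) => j.
have c1 : {for t, continuous ((fun s => A s i j) : subspace `[0, T] -> R)}.
  apply: (@continuous_comp _ _ _ (A : subspace `[0, T] -> _)
    (fun B : 'M[R]_(n, m) => B i j)); first exact: cA.
  exact: coord_continuous.
have c2 : {for t, continuous ((fun s => u s j 0) : subspace `[0, T] -> R)}.
  exact: contJ_coord_continuous.
exact: (continuousM c1 c2).
Qed.

Variable q : R.
Hypotheses (T0 : 0 < T) (q12 : 1 < q <= 2).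

Lemma Green_op_cvg n (h : nat -> R -> 'cV[R]_n) (f : R -> 'cV[R]_n) (M t : R) i :
  0 <= t <= T ->
  (forall j i, measurable_fun `[0, T] (fun s => h j s i 0)) ->
  (forall j, {ae mu, forall s, s \in `[0, T] -> enorm (h j s) <= M}) ->
  (forall i, measurable_fun `[0, T] (fun s => f s i 0)) ->
  {ae mu, forall s, s \in `[0, T] -> forall i, (fun j => h j s i 0) @ \oo --> f s i 0} ->
  (fun j => Green_op T q (h j) t i 0) @ \oo --> Green_op T q f t i 0.
Proof.
move=> tT mh hM mf hf.
have mJ : measurable (`[0, T] : set (measurableTypeR R)) by exact: measurable_itv.
have mG : measurable_fun (`[0, T] : set (measurableTypeR R)) (Green T q t).
  apply: measurable_funTS; apply: continuous_measurable_fun.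
  exact: Green_continuous.
pose C := (Gamma q)^-1 * T `^ (q - 1) *+ 2.
have GC s : s \in `[0, T] -> `|Green T q t s| <= C by exact: (Green_bound T0 q12 tT).
pose k j s := (Green T q t s * h j s i 0)%:E : \bar R.
have [||||| _ _] := @dominated_convergence _ _ _ mu _ mJ k
    (fun s => (Green T q t s * f s i 0)%:E) (cst (C * M)%:E).
- move=> j; apply/measurable_EFinP; exact: (measurable_funM mG (mh j i)).
- by apply/measurable_EFinP; exact: (measurable_funM mG (mf i)).
- apply: ae_imp hf => s hs sJ; apply: cvg_EFin; first by apply: nearW.
  exact: (cvgM (cvg_cst _) (hs sJ i)).
- apply: continuous_compact_integrable; first exact: segment_compact.
  by apply: continuous_subspaceT; exact: cst_continuous.
- apply: ae_imp (ae_all_nat hM) => s hs j sJ.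
  rewrite /k /cst /= lee_fin normrM ler_pM //; first exact: GC.
  by rewrite (le_trans (coord_le_enorm _ _)) // hs.
have ER (g : R -> 'cV[R]_n) : Green_op T q g t i 0 =
    fine (\int[mu]_(s in `[0%R, T]) (Green T q t s * g s i 0)%:E)%E.
  by rewrite mxE; apply: eq_Rintegral => s _; rewrite mxE.
move=> cv; rewrite ER; under eq_fun do rewrite ER.
apply: fine_cvg; rewrite fineK; first exact: cv.
have fM : {ae mu, forall s, s \in `[0, T] -> `|f s i 0| <= M}.
  apply: ae_imp2 hf (ae_all_nat hM) => s hs hMs sJ.
  have cn := cvg_norm (hs sJ i).
  have cn' : (fun j => `|h j s i 0|) @ \oo --> `|f s i 0| by exact: cn.
  have := cvgr_to_le cn'; apply; apply: nearW => j.
  by rewrite (le_trans (coord_le_enorm _ _)) // hMs.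
have : mu.-integrable `[0, T] (EFin \o (fun s => Green T q t s * f s i 0)).
  apply: (@ae_bounded_integrable _ _ mJ _ (C * M)).
  - by rewrite measure_segment // ltry.
  - exact: (measurable_funM mG (mf i)).
  - by apply: ae_imp fM => s hs sJ; rewrite normrM ler_pM // ?GC ?hs.
exact: integrable_fin_num.
Qed.

End continuous_composition.

(** * Estimates for the mild form of the problem *)

Section parametric_problem_solutions.
Variables (R : realType) (n m : nat) (mxnorm : 'M[R]_(n, m) -> R).
Hypothesis hcompat : compatible_norm mxnorm.
Variables (T q alpha : R).
Hypotheses (T0 : 0 < T) (q12 : 1 < q <= 2) (halpha : 0 <= alpha <= 1).
Variables (X1 X2 : metricType R).
Variables (F : R -> 'cV[R]_n -> fuzzy R n) (g : R -> 'cV[R]_n -> 'M[R]_(n, m)).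
Variables (Q : R -> 'cV[R]_n -> 'cV[R]_m) (c1 c2 : R -> 'cV[R]_n -> 'cV[R]_n).
Variables (S : 'cV[R]_m -> X1 -> 'cV[R]_m) (K : X2 -> set 'cV[R]_m).
Hypothesis hg :
  {within `[0, T] `*` setT, continuous (fun tz : R * 'cV[R]_n => g tz.1 tz.2)}.
Hypothesis hc1 :
  {within `[0, T] `*` setT, continuous (fun tz : R * 'cV[R]_n => c1 tz.1 tz.2)}.
Hypothesis hc2 :
  {within `[0, T] `*` setT, continuous (fun tz : R * 'cV[R]_n => c2 tz.1 tz.2)}.
Variable LF : R.
Hypothesis LF0 : 0 < LF.
Hypothesis hF : forall (t : R) z1 z2, t \in `[0, T] ->
  (fuzzy_dist (F t z1) (F t z2) <= (LF * enorm (z1 - z2))%:E)%E.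
Variables (etag Lg : R).
Hypotheses (etag0 : 0 < etag) (Lg0 : 0 < Lg).
Hypothesis g_bound : forall (t : R) z, t \in `[0, T] -> mxnorm (g t z) <= etag.
Hypothesis g_lip : forall (t : R) z1 z2, t \in `[0, T] ->
  mxnorm (g t z1 - g t z2) <= Lg * enorm (z1 - z2).
Variables (M1 M2 Lc1 Lc2 : R).
Hypotheses (M10 : 0 < M1) (M20 : 0 < M2) (Lc10 : 0 < Lc1) (Lc20 : 0 < Lc2).
Hypothesis c1_bound : forall (t : R) z, t \in `[0, T] -> enorm (c1 t z) <= M1.
Hypothesis c2_bound : forall (t : R) z, t \in `[0, T] -> enorm (c2 t z) <= M2.
Hypothesis c1_lip : forall (t : R) z1 z2, t \in `[0, T] ->
  enorm (c1 t z1 - c1 t z2) <= Lc1 * enorm (z1 - z2).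
Hypothesis c2_lip : forall (t : R) z1 z2, t \in `[0, T] ->
  enorm (c2 t z1 - c2 t z2) <= Lc2 * enorm (z1 - z2).

Local Notation mu := (@lebesgue_measure R).
Local Notation J := (`[0, T]%classic : set R).
Implicit Types (y z : contJ T n) (u v : contJ T m) (f h : R -> 'cV[R]_n).

Let mJ : measurable (J : set (measurableTypeR R)).
Proof. exact: measurable_itv. Qed.

Let JP t : t \in `[0, T] -> 0 <= t <= T. Proof. by rewrite in_itv. Qed.

Let forcing f y u s := f s + g s (y s) *m u s.

Let mild f y u t := mild_rhs q c1 c2 y (forcing f y u) t.

(** Linear interpolation between the two nonlocal boundary values. The mild form is this plus the
    Green operator, and only the latter involves the selection and the control. *)
Let bd y t := (t / T) *: vintegral J (fun s => c2 s (y s))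
  + (1 - t / T) *: vintegral J (fun s => c1 s (y s)).

Let c_L1 (c : R -> 'cV[R]_n -> 'cV[R]_n) y :
  {within `[0, T] `*` setT, continuous (fun tz : R * 'cV[R]_n => c tz.1 tz.2)} ->
  L1 J (fun s => c s (y s)).
Proof.
move=> hc; apply: within_continuous_L1 => i; apply: within_continuous_coord.
exact: (@within_comp_contJ _ _ _ _ c y hc).
Qed.

Let g_L1 y u : L1 J (fun s => g s (y s) *m u s).
Proof. by apply: mulmx_L1; exact: (@within_comp_contJ _ _ _ _ g y hg). Qed.

Let forcing_L1 f y u : L1 J f -> L1 J (forcing f y u).
Proof. by move=> lf; exact: (L1D mJ lf (g_L1 y u)). Qed.

Lemma mild_rhsE y h t : t \in `[0, T] -> L1 J h ->
  mild_rhs q c1 c2 y h t = Green_op T q h t + bd y t.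
Proof.
move=> tJ lh; rewrite /mild_rhs /bd (Green_opE T0 q12 (JP tJ) lh).
by rewrite -!addrA.
Qed.

Let frac01 t : t \in `[0, T] -> 0 <= t / T <= 1.
Proof.
move=> /JP/andP[t0 tT].
by rewrite divr_ge0 ?(ltW T0) //= ler_pdivrMr // mul1r.
Qed.

Let vintegral_le_cst h (b : R) : L1 J h -> 0 <= b ->
  (forall s, s \in `[0, T] -> enorm (h s) <= b) -> enorm (vintegral J h) <= b * T.
Proof.
move=> lh b0 hb.
have -> : b * T = \int[mu]_(x in J) (cst b x).
  rewrite (Rintegral_cst mu mJ b); congr (_ * _).
  exact: esym (congr1 fine (measure_segment T0)).
apply: (enorm_vintegral_le mJ) => //.
  apply: continuous_compact_integrable; first exact: segment_compact.
  by apply: continuous_subspaceT; exact: cst_continuous.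
by apply: aeW => s; exact: hb.
Qed.

Let bd_dist y z t : t \in `[0, T] ->
  enorm (bd y t - bd z t) <= (Lc2 * T + Lc1 * T) * maxnorm (y - z).
Proof.
move=> tJ; have /andP[a0 a1] := frac01 tJ.
have B (c : R -> 'cV[R]_n -> 'cV[R]_n) (L : R) : 0 < L ->
    {within `[0, T] `*` setT, continuous (fun tz : R * 'cV[R]_n => c tz.1 tz.2)} ->
    (forall (t : R) (z1 z2 : 'cV[R]_n), t \in `[0, T] ->
      enorm (c t z1 - c t z2) <= L * enorm (z1 - z2)) ->
    enorm (vintegral J (fun s => c s (y s)) - vintegral J (fun s => c s (z s)))
      <= L * maxnorm (y - z) * T.
  move=> L0 cc cL; rewrite -(vintegralB mJ (c_L1 y cc) (c_L1 z cc)).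
  apply: vintegral_le_cst.
  - exact: (L1B mJ (c_L1 y cc) (c_L1 z cc)).
  - by rewrite mulr_ge0 ?maxnorm_ge0 // ltW.
  - move=> s sJ; apply: le_trans (cL _ _ _ sJ) _.
    by rewrite ler_pM2l // maxnormB_ub.
have b1 := B c1 Lc1 Lc10 hc1 c1_lip; have b2 := B c2 Lc2 Lc20 hc2 c2_lip.
rewrite /bd opprD addrACA -!scalerBr.
apply: le_trans (enormD _ _) _; rewrite !enormZ !ger0_norm ?subr_ge0 //.
have e1 : (t / T) * enorm (vintegral J (fun s => c2 s (y s)) -
    vintegral J (fun s => c2 s (z s))) <= Lc2 * maxnorm (y - z) * T.
  by apply: le_trans b2; rewrite ler_piMl ?enorm_ge0.
have e2 : (1 - t / T) * enorm (vintegral J (fun s => c1 s (y s)) -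
    vintegral J (fun s => c1 s (z s))) <= Lc1 * maxnorm (y - z) * T.
  by apply: le_trans b1; rewrite ler_piMl ?enorm_ge0 // gerBl.
by apply: le_trans (lerD e1 e2) _; rewrite le_eqVlt; apply/orP; left; apply/eqP; ring.
Qed.

Let bd_bound y t : t \in `[0, T] -> enorm (bd y t) <= M2 * T + M1 * T.
Proof.
move=> tJ; have /andP[a0 a1] := frac01 tJ.
apply: le_trans (enormD _ _) _; rewrite !enormZ !ger0_norm ?subr_ge0 //.
apply: lerD.
  apply: le_trans (vintegral_le_cst (c_L1 y hc2) (ltW M20) (fun s => c2_bound (y s))).
  by rewrite ler_piMl ?enorm_ge0.
apply: le_trans (vintegral_le_cst (c_L1 y hc1) (ltW M10) (fun s => c1_bound (y s))).
by rewrite ler_piMl ?enorm_ge0 // gerBl.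
Qed.

Let bd_modulus y s t : enorm (bd y s - bd y t) <= `|s - t| * (M2 + M1).
Proof.
rewrite /bd opprD addrACA -!scalerBl.
have -> : 1 - s / T - (1 - t / T) = - (s / T - t / T) by ring.
rewrite -mulrBl; apply: le_trans (enormD _ _) _; rewrite !enormZ normrN.
rewrite normrM (gtr0_norm (_ : 0 < T^-1)) ?invr_gt0 // -mulrDr -mulrA.
rewrite ler_wpM2l ?normr_ge0 // mulrC ler_pdivrMr // mulrDl lerD //.
  exact: vintegral_le_cst (c_L1 y hc2) (ltW M20) (fun s => c2_bound (y s)).
exact: vintegral_le_cst (c_L1 y hc1) (ltW M10) (fun s => c1_bound (y s)).
Qed.

Let control_bound y u s : s \in `[0, T] -> enorm (g s (y s) *m u s) <= etag * maxnorm u.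
Proof.
move=> sJ; apply: le_trans (hcompat _ _) _.
apply: le_trans (ler_wpM2r (enorm_ge0 _) (g_bound (y s) sJ)) _.
by rewrite ler_pM2l // maxnorm_ub.
Qed.

Let control_dist y z u v s : s \in `[0, T] ->
  enorm (g s (y s) *m u s - g s (z s) *m v s)
    <= Lg * maxnorm (y - z) * maxnorm u + etag * maxnorm (u - v).
Proof.
move=> sJ.
have -> : g s (y s) *m u s - g s (z s) *m v s =
    (g s (y s) - g s (z s)) *m u s + g s (z s) *m (u s - v s).
  by rewrite mulmxBl mulmxBr addrA subrK.
apply: le_trans (enormD _ _) _; apply: lerD.
  apply: le_trans (hcompat _ _) _.
  apply: le_trans (ler_wpM2r (enorm_ge0 _) (g_lip (y s) (z s) sJ)) _.
  apply: ler_pM; rewrite ?enorm_ge0 ?maxnorm_ub //.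
    by rewrite mulr_ge0 ?enorm_ge0 // ltW.
  by rewrite ler_pM2l // maxnormB_ub.
apply: le_trans (hcompat _ _) _.
apply: le_trans (ler_wpM2r (enorm_ge0 _) (g_bound (z s) sJ)) _.
by rewrite ler_pM2l // maxnormB_ub.
Qed.

(** With [d = LF * maxnorm (y - z)], controls at distance at most [LQ / mS * maxnorm (y - z)] and
    [maxnorm u <= etaK], the right side is bounded by the contraction constant of (9) times
    [maxnorm (y - z)]. *)
Let mild_dist y z u v f h t (d : R) : t \in `[0, T] -> L1 J f -> L1 J h -> 0 <= d ->
  {ae mu, forall s, s \in `[0, T] -> enorm (f s - h s) <= d} ->
  enorm (mild f y u t - mild h z v t) <=
    2 * ((d + (Lg * maxnorm (y - z) * maxnorm u + etag * maxnorm (u - v)))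
         / Gamma (q + 1)) * T `^ q
    + (Lc2 * T + Lc1 * T) * maxnorm (y - z).
Proof.
move=> tJ lf lh d0 fh; rewrite /mild.
rewrite (mild_rhsE _ tJ (forcing_L1 y u lf)) (mild_rhsE _ tJ (forcing_L1 z v lh)).
rewrite opprD addrACA; apply: le_trans (enormD _ _) _.
apply: lerD; last exact: bd_dist.
have l1 := forcing_L1 y u lf; have l2 := forcing_L1 z v lh.
rewrite -(Green_opB T0 q12 (JP tJ) l1 l2).
apply: (Green_op_bound T0 q12 (JP tJ) (L1B mJ l1 l2)).
  by rewrite !addr_ge0 ?mulr_ge0 ?maxnorm_ge0 ?(ltW Lg0) ?(ltW etag0).
apply: ae_imp fh => s hs sJ; rewrite /forcing opprD addrACA.
apply: le_trans (enormD _ _) _.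
by rewrite lerD ?hs // control_dist.
Qed.

Let mild_ae_bound y u f (M : R) : {ae mu, forall s, s \in `[0, T] -> enorm (f s) <= M} ->
  {ae mu, forall s, J s -> enorm (forcing f y u s) <= M + etag * maxnorm u}.
Proof.
apply: ae_imp => s hs sJ; apply: le_trans (enormD _ _) _.
by rewrite lerD ?hs // control_bound.
Qed.

Let mild_bound y u f (M B : R) t : t \in `[0, T] -> L1 J f -> 0 <= M -> maxnorm u <= B ->
  {ae mu, forall s, s \in `[0, T] -> enorm (f s) <= M} ->
  enorm (mild f y u t) <=
    2 * ((M + etag * B) / Gamma (q + 1)) * T `^ q + (M2 * T + M1 * T).
Proof.
move=> tJ lf M0 uB fM; rewrite /mild (mild_rhsE _ tJ (forcing_L1 y u lf)).
have B0 : 0 <= B by apply: le_trans uB; exact: maxnorm_ge0.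
apply: le_trans (enormD _ _) _; apply: lerD; last exact: bd_bound.
apply: (Green_op_bound T0 q12 (JP tJ) (forcing_L1 y u lf)).
  by rewrite addr_ge0 // mulr_ge0 // ltW.
apply: ae_imp (mild_ae_bound y u fM) => s hs sJ; apply: le_trans (hs sJ) _.
by rewrite lerD2l ler_pM2l.
Qed.

(** A modulus of continuity common to all mild right-hand sides whose forcing term is bounded by
    [b]. *)
Let modulus (b x : R) := b * ((Gamma q)^-1 * ppow (q - 1) x
  + x / (Gamma q * T) * T `^ (q - 1)) * T + x * (M2 + M1).

Let modulus_small (b e : R) : 0 < e -> exists2 d : R, 0 < d &
  forall x, 0 <= x -> x < d -> modulus b x <= e.
Proof.
move=> e0.
have q1 : 0 < q - 1 <= 1 by case/andP: q12 => ? ?; apply/andP; split; lra.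
have cm : {for (0 : R), continuous (modulus b)}.
  have cst (a : R) := @cst_continuous R R a 0.
  have id0 : {for (0 : R), continuous (fun x : R => x)} by exact: cvg_id.
  have cp : {for (0 : R), continuous (ppow (q - 1))} by exact: ppow_continuous_le1.
  have k1 := continuousM (cst (Gamma q)^-1) cp.
  have k2 := continuousM (continuousM id0 (cst (Gamma q * T)^-1)) (cst (T `^ (q - 1))).
  have k3 := continuousM (continuousM (cst b) (continuousD k1 k2)) (cst T).
  exact: (continuousD k3 (continuousM id0 (cst (M2 + M1)))).
have m0 : modulus b 0 = 0.
  rewrite /modulus ppow_le0 //; last by case/andP: q1.
  by rewrite !(mulr0, mul0r, addr0).
have cm' : modulus b @ (0 : R) --> (0 : R) by rewrite -[X in _ --> X]m0; exact: cm.
have : \forall x \near (0 : R), modulus b x < e by apply: (cvgr_lt _ cm').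
move=> /nbhs_ballP[d /= d0 hd].
exists d => // x x0 xd; apply: ltW; apply: hd.
by rewrite -ball_normE /= sub0r normrN ger0_norm.
Qed.

Let mild_modulus y u f (M B : R) s t : s \in `[0, T] -> t \in `[0, T] ->
  L1 J f -> 0 <= M -> maxnorm u <= B ->
  {ae mu, forall s, s \in `[0, T] -> enorm (f s) <= M} ->
  enorm (mild f y u s - mild f y u t) <= modulus (M + etag * B) `|s - t|.
Proof.
move=> sJ tJ lf M0 uB fM; rewrite /mild.
rewrite (mild_rhsE _ sJ (forcing_L1 y u lf)) (mild_rhsE _ tJ (forcing_L1 y u lf)).
have B0 : 0 <= B by apply: le_trans uB; exact: maxnorm_ge0.
rewrite opprD addrACA; apply: le_trans (enormD _ _) _.
apply: lerD; last exact: bd_modulus.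
rewrite ppowE //.
apply: (Green_op_modulus T0 q12 (JP sJ) (JP tJ) (forcing_L1 y u lf)).
  by rewrite addr_ge0 // mulr_ge0 // ltW.
apply: ae_imp (mild_ae_bound y u fM) => x hx xJ; apply: le_trans (hx xJ) _.
by rewrite lerD2l ler_pM2l.
Qed.

Let mild_contJ y u f (M : R) : L1 J f -> 0 <= M ->
  {ae mu, forall s, s \in `[0, T] -> enorm (f s) <= M} ->
  exists z : contJ T n, forall t, t \in `[0, T] -> z t = mild f y u t.
Proof.
move=> lf M0 fM; apply: contJ_ex; apply/within_continuous_enormP => t e tJ e0.
have e2 : 0 < e / 2 by rewrite divr_gt0.
have [d d0 hd] := modulus_small (M + etag * maxnorm u) e2.
exists d => // s sJ sd.
apply: le_lt_trans (mild_modulus y sJ tJ lf M0 (lexx _) fM) _.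
by apply: le_lt_trans (hd _ (normr_ge0 _) sd) _; lra.
Qed.

(** The state [y'] inside the right-hand side is kept apart from [y] so as to cover both successive
    iterates and genuine solutions. *)
Lemma mild_cluster (y : nat -> contJ T n) (y' : nat -> contJ T n)
    (u : nat -> contJ T m) (f : nat -> R -> 'cV[R]_n) (M B : R) :
  0 <= M -> (forall k, maxnorm (u k) <= B) -> (forall k, L1 J (f k)) ->
  (forall k, {ae mu, forall s, s \in `[0, T] -> enorm (f k s) <= M}) ->
  (forall k t, t \in `[0, T] -> y k t = mild (f k) (y' k) (u k) t) ->
  exists z : contJ T n, forall (e : R) (N : nat), 0 < e ->
    exists2 k, (N <= k)%N & maxnorm (y k - z) <= e.
Proof.
move=> M0 uB lf fM ymild.
apply: (@equicontinuous_cluster _ _ _ _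
  (2 * ((M + etag * B) / Gamma (q + 1)) * T `^ q + (M2 * T + M1 * T))).
  by move=> k t tJ; rewrite ymild //; exact: mild_bound.
move=> e e0; have [d d0 hd] := modulus_small (M + etag * B) e0.
exists d => // k s t sJ tJ st; rewrite !ymild //.
by apply: le_trans (mild_modulus _ sJ tJ (lf k) M0 (uB k) (fM k)) _; exact: hd.
Qed.

(** * Limits of approximate solutions *)

Hypothesis Fmeas : forall z : 'cV[R]_n, strongly_measurable `[0, T] (fun t => F t z).
Variable MF : R.
Hypothesis MF0 : 0 <= MF.
Hypothesis hMF : {ae mu, forall t, t \in `[0, T] ->
  forall (z : 'cV[R]_n) x, level (F t z) alpha x -> enorm x <= MF}.

Let selection f y :=
  {ae mu, forall s, s \in `[0, T] -> level (F s (y s)) alpha (f s)}.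

Let selection_bound f y : selection f y ->
  {ae mu, forall s, s \in `[0, T] -> enorm (f s) <= MF}.
Proof. by apply: ae_imp2 hMF => s hs fs sJ; exact: hs (fs sJ). Qed.

Let bounded_L1 f (M : R) : (forall i, measurable_fun J (fun t => f t i 0)) ->
  {ae mu, forall s, s \in `[0, T] -> enorm (f s) <= M} -> L1 J f.
Proof. by move=> mf fM; apply: (ae_bounded_L1 mJ (measure_segment_lty T0) mf fM). Qed.

Let mild_midpoint f h y u t : t \in `[0, T] -> L1 J f -> L1 J h ->
  mild (fun s => 2^-1 *: (f s + h s)) y u t = 2^-1 *: (mild f y u t + mild h y u t).
Proof.
move=> tJ lf lh; have l1 := forcing_L1 y u lf; have l2 := forcing_L1 y u lh.
have half (V : lmodType R) (x : V) : x = 2^-1 *: (x + x).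
  have e1 : 2^-1 + 2^-1 = 1 :> R by lra.
  by rewrite scalerDr -scalerDl e1 scale1r.
rewrite /mild (mild_rhsE _ tJ l1) (mild_rhsE _ tJ l2).
have -> : forcing (fun s => 2^-1 *: (f s + h s)) y u =
    (fun s => 2^-1 *: (forcing f y u s + forcing h y u s)).
  apply/funext => s; rewrite /forcing [in RHS]addrACA [RHS]scalerDr; congr (_ + _).
  exact: half.
have l3 := L1D mJ l1 l2.
rewrite (mild_rhsE _ tJ (L1Zl mJ 2^-1 l3)) (Green_opZ T0 q12 _ (JP tJ) l3).
rewrite (Green_opD T0 q12 (JP tJ) l1 l2) addrACA [RHS]scalerDr; congr (_ + _).
exact: half.
Qed.

Let mild_cvg (h : nat -> R -> 'cV[R]_n) f y u t i :
  t \in `[0, T] ->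
  (forall j i, measurable_fun J (fun s => h j s i 0)) ->
  (forall j, {ae mu, forall s, s \in `[0, T] -> enorm (h j s) <= MF}) ->
  (forall i, measurable_fun J (fun s => f s i 0)) ->
  L1 J f ->
  {ae mu, forall s, s \in `[0, T] -> forall i, (fun j => h j s i 0) @ \oo --> f s i 0} ->
  (fun j => mild (h j) y u t i 0) @ \oo --> mild f y u t i 0.
Proof.
move=> tJ mh hM mf lf hf.
have E k : L1 J k -> mild k y u t i 0 = Green_op T q k t i 0 +
    (Green_op T q (fun s => g s (y s) *m u s) t + bd y t) i 0.
  move=> lk; rewrite /mild (mild_rhsE _ tJ (forcing_L1 y u lk)).
  by rewrite (Green_opD T0 q12 (JP tJ) lk (g_L1 y u)) -addrA mxE.
rewrite [X in _ --> X](E f lf).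
have -> : (fun j => mild (h j) y u t i 0) = (fun j => Green_op T q (h j) t i 0 +
    (Green_op T q (fun s => g s (y s) *m u s) t + bd y t) i 0).
  by apply/funext => j; apply: E; exact: bounded_L1 (mh j) (hM j).
have cv := Green_op_cvg T0 q12 (i := i) (JP tJ) mh hM mf hf.
apply: cvgD; [exact: cv|exact: cvg_cst].
Qed.

Local Notation SOL := (SOL_PBFFDVI q alpha F g Q c1 c2 S K
  : X1 * X2 -> set (contJ T n * contJ T m)).

(** The approximate selections belong to varying states [z]; they are first moved to the limit pair
    [(y, u)], where the error is absorbed in [eps j]. There the conditions are stable under
    midpoints, the levels being convex and [mild] affine in the selection. *)
Lemma SOL_approx_closed p y u : VI_function Q S K p.1 p.2 y u ->
  (forall e : R, 0 < e -> exists z v f, [/\ maxnorm (z - y) <= e,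
    maxnorm (v - u) <= e, L1 J f, selection f z &
    forall t, t \in `[0, T] -> enorm (z t - mild f z v t) <= e]) ->
  SOL p (y, u).
Proof.
move=> VIu approx; split => //=.
have /andP[G1 _] := Gamma_recurrence_le q12.
have Tq : 0 <= T `^ q by exact: powR_ge0.
(* For a fixed selection, replacing the pair [(y, u)] by one within [e] in both components moves
   [mild] by at most [kappa * e]. *)
pose kappa := 2 * ((Lg * maxnorm u + etag) / Gamma (q + 1)) * T `^ q
  + (Lc2 * T + Lc1 * T).
have kappa0 : 0 <= kappa.
  rewrite addr_ge0 ?mulr_ge0 ?divr_ge0 ?addr_ge0 ?mulr_ge0 ?maxnorm_ge0 ?invr_ge0 //;
  by rewrite ltW.
pose eps j : R := j.+1%:R^-1.
have eps0 j : 0 < eps j by rewrite invr_gt0 ltr0n.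
pose C j := [set f : R -> 'cV[R]_n | [/\ forall i, measurable_fun J (fun t => f t i 0),
  {ae mu, forall s, s \in `[0, T] -> enorm (f s) <= MF},
  {ae mu, forall s, s \in `[0, T] ->
    exists2 a, level (F s (y s)) alpha a & enorm (f s - a) <= eps j} &
  forall t, t \in `[0, T] -> enorm (y t - mild f y u t) <= eps j]].
have C0 j : C j !=set0.
  (* One choice for both relaxed conditions: the selection error is at most [LF * e], and the defect
     in the integral equation at most [(2 + kappa) * e]. *)
  pose e := eps j / (2 + kappa + LF).
  have den0 : 0 < 2 + kappa + LF by rewrite addr_gt0 // ltr_wpDr.
  have e0 : 0 < e by rewrite divr_gt0.
  have eE : (2 + kappa + LF) * e = eps j by rewrite /e mulrC divfK // gt_eqF.
  have LFe : 0 < LF * e by rewrite mulr_gt0.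
  have ke : 0 <= kappa * e by rewrite mulr_ge0 // ltW.
  have [z [v [f [zy vu lf sf zt]]]] := approx e e0.
  have zy' : maxnorm (y - z) <= e by rewrite maxnormBC.
  have vu' : maxnorm (u - v) <= e by rewrite maxnormBC.
  have fM := selection_bound sf.
  exists f; split => //.
  - by move=> i; exact: (L1_measurable i lf).
  - apply: ae_imp sf => s hs sJ.
    have [a la fa] := level_Lipschitz halpha hF (y s) sJ (hs sJ).
    exists a => //; apply: le_trans fa _; apply: (@le_trans _ _ (LF * e)).
      by rewrite ler_pM2l // (le_trans (maxnormB_ub _ _ sJ)).
    by move: eE ke LFe e0; lra.
  - move=> t tJ.
    have ff : {ae mu, forall s, s \in `[0, T] -> enorm (f s - f s) <= 0}.
      by apply: aeW => s _; rewrite subrr enorm0.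
    have := mild_dist y z u v tJ lf lf (lexx 0) ff; rewrite add0r => md.
    have fz : enorm (mild f y u t - mild f z v t) <= kappa * e.
      apply: le_trans md _; rewrite /kappa [leRHS]mulrDl; apply: lerD; last first.
        by rewrite ler_wpM2l // addr_ge0 // mulr_ge0 // ltW.
      have -> : 2 * ((Lg * maxnorm u + etag) / Gamma (q + 1)) * T `^ q * e =
          2 * (((Lg * maxnorm u + etag) * e) / Gamma (q + 1)) * T `^ q by ring.
      rewrite ler_wpM2r // ler_pM2l // ler_wpM2r ?invr_ge0 ?(ltW G1) //.
      rewrite [leRHS]mulrDl; apply: lerD; last by rewrite ler_pM2l.
      by rewrite -!mulrA ler_pM2l // mulrC ler_wpM2l ?maxnorm_ge0.
    apply: le_trans (enorm_dist3 (le_trans (maxnormB_ub y z tJ) zy') (zt t tJ) fz) _.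
    by move: eE LFe; lra.
have CM j f : C j f -> (forall i, measurable_fun J (fun t => f t i 0)) /\
    {ae mu, forall t, J t -> enorm (f t) <= MF}.
  by move=> [mf fM _ _]; split.
have CL1 j f : C j f -> L1 J f.
  by move=> /CM[mf fM]; exact: bounded_L1 mf fM.
have Cdec i j : (i <= j)%N -> C j `<=` C i.
  move=> ij f [mf fM fl fy].
  have le : eps j <= eps i by rewrite lef_pV2 ?posrE ?ltr0n // ler_nat.
  split => //.
  - by apply: ae_imp fl => s hs /hs[a la fa]; exists a => //; exact: le_trans fa le.
  - by move=> t tJ; exact: le_trans (fy t tJ) le.
have half2 (V : lmodType R) (x x' : V) : 2^-1 *: x + (1 - 2^-1) *: x' = 2^-1 *: (x + x').
  by rewrite scalerDr; congr (_ + _ *: _); lra.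
have normhalf k (x x' : 'cV[R]_k) (b : R) : enorm x <= b -> enorm x' <= b ->
    enorm (2^-1 *: (x + x')) <= b.
  move=> xb xb'; rewrite enormZ gtr0_norm ?invr_gt0 //.
  by have := enormD x x'; lra.
have Cmid j f h : C j f -> C j h -> C j (fun t => 2^-1 *: (f t + h t)).
  move=> Cf Ch; have lf := CL1 _ _ Cf; have lh := CL1 _ _ Ch.
  have [mf fM fl fy] := Cf; have [mh hM hl hy] := Ch; split.
  - by move=> i; exact: (L1_measurable i (L1Zl mJ 2^-1 (L1D mJ lf lh))).
  - by apply: ae_imp2 fM hM => s hf hh sJ; rewrite normhalf ?hf ?hh.
  - apply: ae_imp2 fl hl => s hf hh sJ.
    have [a la fa] := hf sJ; have [b lb hb] := hh sJ.
    exists (2^-1 *: (a + b)).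
      have [_ _ cvx] := level_body (F s (y s)) halpha.
      rewrite -half2; apply: cvx => //; lra.
    rewrite -scalerBr opprD addrACA; exact: normhalf.
  - move=> t tJ; rewrite mild_midpoint // (_ : y t = 2^-1 *: (y t + y t)).
      by rewrite -scalerBr opprD addrACA; apply: normhalf; [exact: fy|exact: hy].
    by rewrite -half2 -scalerDl addrC subrK scale1r.
have [h [Ch [f [mf hf]]]] :=
  midpoint_closed_ae_cvg mJ (measure_segment_lty T0) CM C0 Cdec Cmid.
(* At almost every time [h j s] tends to [f s] while its distance to the closed level is at most
   [eps j], so the limit lies in the level. *)
have sf : selection f y.
  have hl : {ae mu, forall s, forall j, s \in `[0, T] ->
      exists2 a, level (F s (y s)) alpha a & enorm (h j s - a) <= eps j}.
    by apply: ae_all_nat => j; have [] := Ch j.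
  apply: ae_imp2 hl hf => s hs hfs sJ.
  have [_ cpt _] := level_body (F s (y s)) halpha.
  apply: closed_enorm_lim; first exact: compact_closed (@norm_hausdorff _ _) cpt.
  move=> e e0; have e3 : 0 < e / 3 by rewrite divr_gt0.
  have near1 : \forall j \near \oo, enorm (h j s - f s) <= e / 3.
    by apply: coord_cvg_enorm => // i; exact: hfs.
  have near2 : \forall j \near \oo, eps j < e / 3.
    exact: near_infty_natSinv_lt (PosNum e3).
  have [j [j1 j2]] := filter_ex (filterI near1 near2).
  have [a la ha] := hs j sJ; exists a => //.
  have := enormD3 a (h j s) (f s); rewrite (enormB a (h j s)).
  by move: j1 j2 => /=; lra.
have lf : L1 J f by exact: bounded_L1 mf (selection_bound sf).
exists f; split => // t tJ.
apply/matrixP => i k; rewrite ord1.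
have cv := @mild_cvg h f y u t i tJ (fun j => (CM _ _ (Ch j)).1) (fun j => (CM _ _ (Ch j)).2)
  mf lf hf.
apply/eqP; rewrite -subr_eq0 -normr_le0; apply/ler_addgt0Pl => e e0; rewrite addr0.
have e2 : 0 < e / 2 by rewrite divr_gt0.
have near1 : \forall j \near \oo, `|mild f y u t i 0 - mild (h j) y u t i 0| <= e / 2.
  by move: cv => /cvgr_dist_le/(_ _ e2).
have near2 : \forall j \near \oo, eps j < e / 2.
  exact: near_infty_natSinv_lt (PosNum e2).
have [j [j1 j2]] := filter_ex (filterI near1 near2).
have [_ _ _ /(_ t tJ) yj] := Ch j.
have yj' : `|y t i 0 - mild (h j) y u t i 0| <= eps j.
  by apply: le_trans yj; have := coord_le_enorm (y t - mild (h j) y u t) i; rewrite !mxE.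
apply: le_trans (ler_distD (mild (h j) y u t i 0) _ _) _.
apply: le_trans (lerD yj' (_ : _ <= e / 2)) _; first by rewrite distrC.
by move: j2 => /=; lra.
Qed.

(** * Existence of solutions *)

Variables LQ mS : R.
Hypotheses (LQ0 : 0 < LQ) (mS0 : 0 < mS).
Hypothesis hQ : forall (t1 t2 : R) (z1 z2 : 'cV[R]_n),
  t1 \in `[0, T] -> t2 \in `[0, T] ->
  enorm (Q t1 z1 - Q t2 z2) <= LQ * (`|t1 - t2| + enorm (z1 - z2)).
Hypothesis Smono : forall (u1 u2 : 'cV[R]_m) xi,
  mS * enorm (u1 - u2) ^+ 2 <= dotp (S u1 xi - S u2 xi) (u1 - u2).
Hypothesis hK : forall sigma,
  [/\ K sigma !=set0, compact (K sigma) & convex_subset (K sigma)].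
Hypothesis cS : continuous (fun ux : 'cV[R]_m * X1 => S ux.1 ux.2).
Hypothesis cK : multimap_continuous K.

(* Nadler's iteration: y' is the right-hand side built from y and the current
   selection f, and f' selects from the levels along y' as close to f as possible. *)
Lemma SOL_nonempty p (etaK : R) :
  (forall y u, VI_function Q S K p.1 p.2 y u -> maxnorm u <= etaK) -> 0 < etaK ->
  2 * ((LF + Lg * etaK + etag * (LQ / mS)) / Gamma (q + 1)) * T `^ q
    + Lc2 * T + Lc1 * T < 1 ->
  SOL p !=set0.
Proof.
move=> ubd etaK0; set lambda := _ + _ => lambda1.
have /andP[G1 _] := Gamma_recurrence_le q12.
have Tq : 0 <= T `^ q by exact: powR_ge0.
have LQm : 0 < LQ / mS by rewrite divr_gt0.
have lambda0 : 0 <= lambda.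
  rewrite /lambda ?addr_ge0 ?mulr_ge0 ?divr_ge0 ?addr_ge0 ?mulr_ge0 ?invr_ge0 //;
  by rewrite ltW.
have /choice[U hU] : forall y, exists u, VI_function Q S K p.1 p.2 y u.
  by move=> y; exact: (VI_function_ex LQ0 mS0 hQ Smono hK cS).
have UM y : maxnorm (U y) <= etaK by exact: ubd.
have Udist y z : maxnorm (U y - U z) <= LQ / mS * maxnorm (y - z).
  apply: maxnormB_le; first by rewrite mulr_ge0 ?maxnorm_ge0 // ltW.
  move=> t tJ; apply: le_trans (VI_function_dist mS0 hQ Smono (hU y) (hU z) tJ) _.
  by rewrite ler_pM2l // maxnormB_ub.
pose ok (x : contJ T n * (R -> 'cV[R]_n)) :=
  (forall i, measurable_fun J (fun t => x.2 t i 0)) /\ selection x.2 x.1.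
pose step (x x' : contJ T n * (R -> 'cV[R]_n)) := [/\ ok x',
  forall t, t \in `[0, T] -> x'.1 t = mild x.2 x.1 (U x.1) t &
  {ae mu, forall s, s \in `[0, T] ->
    enorm (x'.2 s - x.2 s) <= LF * maxnorm (x'.1 - x.1)}].
have okL1 x : ok x -> L1 J x.2.
  by move=> [mx sx]; exact: bounded_L1 mx (selection_bound sx).
(* A total successor function is wanted, hence the guard [ok x]; pairs that are not [ok] get an
   arbitrary successor. *)
have /choice[next hnext] : forall x, exists x', ok x -> step x x'.
  move=> x; have [okx|nokx] := pselect (ok x); last by exists x.
  have [mx sx] := okx.
  have [y' hy'] := mild_contJ x.1 (U x.1) (okL1 _ okx) MF0 (selection_bound sx).
  have [f' [mf' hf']] := measurable_level_projection halpha LF0 hF Fmeas y' mx.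
  exists (y', f') => _; split => //=.
    by split => //=; apply: ae_imp hf' => s hs sJ; have [] := hs sJ.
  apply: ae_imp2 sx hf' => s xs hs sJ; have [_ nearest] := hs sJ.
  have [b lb xb] := level_Lipschitz halpha hF (y' s) sJ (xs sJ).
  apply: le_trans (nearest b lb) _; rewrite enormB; apply: le_trans xb _.
  by rewrite ler_pM2l // enormB maxnormB_ub.
have [f0 [mf0 hf0]] := measurable_level_projection halpha LF0 hF Fmeas
  (0 : contJ T n) (h := fun=> 0) (fun i => measurable_cst _).
pose x k := iter k next ((0 : contJ T n), f0).
have okx k : ok (x k).
  elim: k => [|k IHk]; last by have [] := hnext _ IHk.
  by split => //=; apply: ae_imp hf0 => s hs sJ; have [] := hs sJ.
have stepx k : step (x k) (x k.+1) by exact: hnext.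
pose c := maxnorm ((x 2%N).1 - (x 1%N).1).
have contr k : maxnorm ((x k.+2).1 - (x k.+1).1) <= lambda ^+ k * c.
  elim: k => [|k IHk]; first by rewrite expr0 mul1r.
  have [_ y2 _] := stepx k.+2; have [_ y1 f21] := stepx k.+1.
  set d := maxnorm ((x k.+2).1 - (x k.+1).1) in IHk f21.
  have d0 : 0 <= d by exact: maxnorm_ge0.
  rewrite exprS -mulrA; apply: (@le_trans _ _ (lambda * d)); last first.
    by rewrite ler_wpM2l.
  apply: maxnormB_le; first by rewrite mulr_ge0.
  move=> t tJ; rewrite y2 // y1 //.
  have LFd : 0 <= LF * d by rewrite mulr_ge0 // ltW.
  have := mild_dist (x k.+2).1 (x k.+1).1 (U (x k.+2).1) (U (x k.+1).1) tJ
    (okL1 _ (okx k.+2)) (okL1 _ (okx k.+1)) LFd f21.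
  rewrite -/d => /le_trans; apply.
  have -> : lambda * d = 2 * ((LF * d + (Lg * d * etaK + etag * (LQ / mS * d)))
      / Gamma (q + 1)) * T `^ q + (Lc2 * T + Lc1 * T) * d.
    by rewrite /lambda; ring.
  rewrite lerD2r ler_wpM2r // ler_pM2l // ler_wpM2r ?invr_ge0 ?(ltW G1) //.
  rewrite lerD2l; apply: lerD; first by rewrite ler_wpM2l ?UM // mulr_ge0 // ltW.
  by rewrite ler_pM2l // Udist.
(* The initial state [0] is not a value of the mild operator, so compactness is applied from the
   first iterate on. *)
have [y hy] : exists z : contJ T n, forall (e : R) (N : nat), 0 < e ->
    exists2 k, (N <= k)%N & maxnorm ((x k.+1).1 - z) <= e.
  apply: (@mild_cluster (fun k => (x k.+1).1) (fun k => (x k).1)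
    (fun k => U (x k).1) (fun k => (x k).2) MF etaK MF0).
  - by move=> k; exact: UM.
  - by move=> k; exact: okL1.
  - by move=> k; apply: selection_bound; exact: (okx k).2.
  - by move=> k t tJ; have [_ -> //] := stepx k.
exists (y, U y); apply: SOL_approx_closed => // e e0.
(* Small enough for the states and, after multiplication by [LQ / mS], for the controls as well. *)
pose e' := Num.min e (e / (LQ / mS)).
have e'0 : 0 < e' by rewrite lt_min e0 divr_gt0.
have : (fun k => lambda ^+ k * c) @ \oo --> (0 : R).
  rewrite -(mul0r c); apply: cvgMl; apply: cvg_expr.
  by rewrite ger0_norm.
move=> /cvgr_dist_le/(_ e e0)[N _ hN].
have [k Nk ky] := hy e' N e'0.
exists (x k.+1).1, (U (x k.+1).1), (x k.+1).2; split.
- by apply: le_trans ky _; rewrite ge_min lexx.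
- apply: le_trans (Udist _ _) _; rewrite mulrC -ler_pdivlMr //.
  by apply: le_trans ky _; rewrite ge_min lexx orbT.
- exact: okL1.
- exact: (okx k.+1).2.
(* The mild right-hand side built from an iterate is the next iterate, so the defect is the distance
   bounded by [contr]. *)
- move=> t tJ; have [_ yk _] := stepx k.+1; rewrite -yk //.
  rewrite enormB; apply: le_trans (maxnormB_ub _ _ tJ) _.
  apply: le_trans (contr k) _; have := hN k Nk.
  by rewrite /= sub0r normrN; apply: le_trans; exact: ler_norm.
Qed.

(** * Upper semicontinuity *)

Hypothesis lcK : multimap_locally_compact K.

Lemma SOL_upper_semicontinuous (p0 : X1 * X2) (U : set (contJ T n * contJ T m)) :
  open U -> SOL p0 `<=` U ->
  exists O : set (X1 * X2), [/\ open O, O p0 &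
    forall p, O p -> SOL p `<=` U].
Proof.
move=> oU solU; apply: contrapT => noO.
have bad (A : set (X1 * X2)) : nbhs p0 A -> exists x : X1 * X2 * (contJ T n * contJ T m),
    [/\ A x.1, SOL x.1 x.2 & ~ U x.2].
  rewrite nbhsE => -[B [oB Bp0] BA]; apply: contrapT => none; apply: noO.
  exists B; split => // p Bp yu solyu; apply: contrapT => nU.
  by apply: none; exists (p, yu); split => //; exact: BA.
(* Bounds the controls uniformly for parameters near [p0], which equicontinuity of the states
   requires. *)
have [V V0 cptV] := lcK p0.2.
have [B B0 VB] := compact_enorm_bounded cptV.
have nV : nbhs p0 [set p | V p.2].
  by exists (setT, V) => [|[a b] [_ Vb]] //; split => //; exact: filterT.
have /choice[x hx] : forall k : nat, exists x : X1 * X2 * (contJ T n * contJ T m),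
    [/\ (ball p0 (k.+1%:R^-1 : R) `&` [set p | V p.2]) x.1,
      SOL x.1 x.2 & ~ U x.2].
  move=> k; apply: bad; apply: filterI => //.
  by apply: nbhsx_ballx; rewrite invr_gt0 ltr0n.
have /choice[f hf] : forall k, exists f, [/\ L1 J f, selection f (x k).2.1 &
    forall t, t \in `[0, T] -> (x k).2.1 t = mild f (x k).2.1 (x k).2.2 t].
  by move=> k; have [_ [_ [f [lf sf yf]]] _] := hx k; exists f.
have uB k : maxnorm (x k).2.2 <= B.
  apply: maxnorm_le => // t tJ; have [[_ Vk] [VIk _] _] := hx k.
  apply: VB; apply: subset_closure; exists (x k).1.2 => //.
  by have [] := VIk t tJ.
have [y hy] : exists z : contJ T n, forall (e : R) (N : nat), 0 < e ->
    exists2 k, (N <= k)%N & maxnorm ((x k).2.1 - z) <= e.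
  apply: (@mild_cluster (fun k => (x k).2.1) (fun k => (x k).2.1)
    (fun k => (x k).2.2) f MF B MF0) => //.
  - by move=> k; have [] := hf k.
  - by move=> k; have [_ /selection_bound] := hf k.
  - by move=> k; have [_ _] := hf k.
have [u VIu] := VI_function_ex LQ0 mS0 hQ Smono hK cS p0.1 p0.2 y.
have LQm : 0 < LQ / mS by rewrite divr_gt0.
(* The control converges along the same indices as the state, since [VI_function_stable] allows the
   parameters and the state to move together. *)
have close (e : R) : 0 < e -> exists k,
    maxnorm ((x k).2.1 - y) <= e /\ maxnorm ((x k).2.2 - u) <= e.
  move=> e0; have e2 : 0 < e / 2 by rewrite divr_gt0.
  have := VI_function_stable LQ0 mS0 hQ Smono hK cS cK e2 VIu.
  have -> : (p0.1, p0.2) = p0 by case: (p0).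
  move=> /nbhs_ballP[d /= d0 hd].
  have /filter_ex[N hN] : \forall k \near \oo, k.+1%:R^-1 < d.
    exact: near_infty_natSinv_lt (PosNum d0).
  have e'0 : 0 < Num.min e (e / 2 / (LQ / mS)) by rewrite lt_min e0 divr_gt0.
  have [k Nk ky] := hy _ N e'0; exists k.
  have [[bk _] [VIk _] _] := hx k.
  have ky1 : maxnorm ((x k).2.1 - y) <= e by apply: le_trans ky _; rewrite ge_min lexx.
  split => //.
  have : ball p0 d (x k).1.
    apply: le_ball bk; apply: ltW; apply: le_lt_trans hN.
    by rewrite lef_pV2 ?posrE ?ltr0n // ler_nat.
  move=> /hd/(_ _ _ VIk) /le_trans; apply.
  have : LQ / mS * maxnorm ((x k).2.1 - y) <= e / 2.
    rewrite mulrC -ler_pdivlMr //.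
    by apply: le_trans ky _; rewrite ge_min lexx orbT.
  by lra.
have sol : SOL p0 (y, u).
  apply: SOL_approx_closed => // e e0.
  have [k [ky ku]] := close e e0; have [lf sf yf] := hf k.
  exists (x k).2.1, (x k).2.2, (f k); split => // t tJ.
  by rewrite -yf // subrr enorm0 ltW.
have : nbhs (y, u) U by apply: open_nbhs_nbhs; split => //; exact: solU.
move=> /nbhs_ballP[e /= e0 eU].
have e2 : 0 < e / 2 by rewrite divr_gt0.
have [k [ky ku]] := close _ e2.
have [_ _ nUk] := hx k; apply: nUk; apply: eU.
have e2e : e / 2 < e by lra.
split; rewrite /= -ball_normE /= distrC.
  exact: le_lt_trans ky e2e.
exact: le_lt_trans ku e2e.
Qed.

End parametric_problem_solutions.

Theorem theorem4p1 (R : realType) (n m : nat)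
  (mxnorm : 'M[R]_(n, m) -> R)
  (hmxnorm : matrix_norm mxnorm) (hcompat : compatible_norm mxnorm)
  (T q alpha : R) (hT : 0 < T) (hq : 1 < q <= 2) (halpha : 0 <= alpha <= 1)
  (X1 X2 : metricType R)
  (F : R -> 'cV[R]_n -> fuzzy R n)
  (g : R -> 'cV[R]_n -> 'M[R]_(n, m))
  (Q : R -> 'cV[R]_n -> 'cV[R]_m)
  (c1 c2 : R -> 'cV[R]_n -> 'cV[R]_n)
  (S : 'cV[R]_m -> X1 -> 'cV[R]_m)
  (K : X2 -> set 'cV[R]_m)
  (hg : {within `[0, T] `*` setT, continuous (fun tz : R * 'cV[R]_n => g tz.1 tz.2)})
  (hQ : {within `[0, T] `*` setT, continuous (fun tz : R * 'cV[R]_n => Q tz.1 tz.2)})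
  (hc1 : {within `[0, T] `*` setT, continuous (fun tz : R * 'cV[R]_n => c1 tz.1 tz.2)})
  (hc2 : {within `[0, T] `*` setT, continuous (fun tz : R * 'cV[R]_n => c2 tz.1 tz.2)})
  (LF : R) (LF_gt0 : 0 < LF)
  (h1 : forall (t : R) z1 z2, t \in `[0, T] ->
    (fuzzy_dist (F t z1) (F t z2) <= (LF * enorm (z1 - z2))%:E)%E)
  (h2 : forall z, strongly_measurable `[0, T] (fun t => F t z))
  (h3 : exists2 p : R -> R, Linfty_nonneg `[0, T] p &
    forall z, {ae @lebesgue_measure R, forall t, t \in `[0, T] ->
      (fuzzy_norm (F t z) <= (p t)%:E)%E})
  (etag Lg : R) (etag_gt0 : 0 < etag) (Lg_gt0 : 0 < Lg)
  (h4_bound : forall (t : R) z, t \in `[0, T] -> mxnorm (g t z) <= etag)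
  (h4_lip : forall (t : R) z1 z2, t \in `[0, T] ->
    mxnorm (g t z1 - g t z2) <= Lg * enorm (z1 - z2))
  (LQ : R) (LQ_gt0 : 0 < LQ)
  (h5 : forall (t1 t2 : R) z1 z2, t1 \in `[0, T] -> t2 \in `[0, T] ->
    enorm (Q t1 z1 - Q t2 z2) <= LQ * (`|t1 - t2| + enorm (z1 - z2)))
  (mS : R) (mS_gt0 : 0 < mS)
  (h6 : forall u1 u2 xi,
    mS * enorm (u1 - u2) ^+ 2 <= dotp (S u1 xi - S u2 xi) (u1 - u2))
  (h7 : forall sigma,
    [/\ K sigma !=set0, compact (K sigma) & convex_subset (K sigma)])
  (M1 M2 Lc1 Lc2 : R) (M1_gt0 : 0 < M1) (M2_gt0 : 0 < M2)
  (Lc1_gt0 : 0 < Lc1) (Lc2_gt0 : 0 < Lc2)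
  (h8_bound1 : forall (t : R) z, t \in `[0, T] -> enorm (c1 t z) <= M1)
  (h8_bound2 : forall (t : R) z, t \in `[0, T] -> enorm (c2 t z) <= M2)
  (h8_lip1 : forall (t : R) z1 z2, t \in `[0, T] ->
    enorm (c1 t z1 - c1 t z2) <= Lc1 * enorm (z1 - z2))
  (h8_lip2 : forall (t : R) z1 z2, t \in `[0, T] ->
    enorm (c2 t z1 - c2 t z2) <= Lc2 * enorm (z1 - z2))
  (h9 : forall (xi : X1) (sigma : X2), exists etaK : R,
    [/\ 0 < etaK,
        forall (y : contJ T n) (u : contJ T m),
          VI_function Q S K xi sigma y u -> maxnorm u <= etaK &
        2 * ((LF + Lg * etaK + etag * (LQ / mS)) / Gamma (q + 1)) * T `^ q
          + Lc2 * T + Lc1 * T < 1])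
  (h10_S : continuous (fun ux : 'cV[R]_m * X1 => S ux.1 ux.2))
  (h10_K : multimap_continuous K)
  (h11 : multimap_locally_compact K) :
  multimap_usc (SOL_PBFFDVI q alpha F g Q c1 c2 S K
    : X1 * X2 -> set (contJ T n * contJ T m)).
Proof.
have [p pLinfty Fp] := h3.
have [MF MF0 hMF] := level_ae_bounded halpha LF_gt0 h1 pLinfty Fp.
split=> [x|x0 U]; last first.
  exact: (SOL_upper_semicontinuous hcompat hT hq halpha hg hc1 hc2 LF_gt0 h1
    etag_gt0 Lg_gt0 h4_bound h4_lip M1_gt0 M2_gt0 Lc1_gt0 Lc2_gt0 h8_bound1
    h8_bound2 h8_lip1 h8_lip2 MF0 hMF LQ_gt0 mS_gt0 h5 h6 h7 h10_S h10_K h11).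
have [etaK [etaK0 uK contraction]] := h9 x.1 x.2.
exact: (SOL_nonempty hcompat hT hq halpha hg hc1 hc2 LF_gt0 h1 etag_gt0 Lg_gt0
  h4_bound h4_lip M1_gt0 M2_gt0 Lc1_gt0 Lc2_gt0 h8_bound1 h8_bound2 h8_lip1
  h8_lip2 h2 MF0 hMF LQ_gt0 mS_gt0 h5 h6 h7 h10_S uK etaK0 contraction).
Qed.
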